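(* Let $k$ be a positive integer and let $D$ be the canonical decomposition of a connected distance-hereditary graph $G$. Then $\mathrm{lrw}(G)\le k$ if and only if for each bag $B$ of $D$, there are at most two components $T$ of $D\setminus V(B)$ such that $f_D(B,T)=k$, and every other component $T'$ of $D\setminus V(B)$ satisfies $f_D(B,T')\le k-1$.
   Context: Graphs. All graphs are finite, simple and undirected. For a graph $G$ and $x\in V(G)$, the local complementation $G*x$ is obtained from $G$ by replacing the subgraph induced by the neighbors of $x$ with its complement. For an edge $xy$, the pivoting is $G\wedge xy:=G*x*y*x$ $(=G*y*x*y)$. A star is a tree with a distinguished vertex, its center, adjacent to all other vertices. $G$ is distance-hereditary if distances between two vertices in any connected induced subgraph containing both equal their distance in $G$. Linear rank-width. $\mathrm{cutrk}_G(X)$ is the rank over $\mathrm{GF}(2)$ of the submatrix $A_G[X,V(G)\setminus X]$ of the adjacency matrix. The width of an ordering (linear layout) $(x_1,\ldots,x_n)$ of $V(G)$, $n\ge 2$, is $\max_{1\le i\le n-1}\mathrm{cutrk}_G(\{x_1,\ldots,x_i\})$; $\mathrm{lrw}(G)$ is the minimum width over all linear layouts, and is $0$ if $|V(G)|\le 1$. Split decompositions. A split of a connected graph $G$ is a partition $(X,Y)$ of $V(G)$ with $|X|,|Y|\ge 2$ such that for some nonempty $X'\subseteq X$, $Y'\subseteq Y$ the edges between $X$ and $Y$ are exactly all pairs $xy$ with $x\in X'$, $y\in Y'$; a connected graph with no split is prime. A marked graph $D$ is a connected graph with a set $M(D)$ of edges (marked edges) forming a matching, each being a cut-edge. Ends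 of marked edges are marked vertices; other edges and vertices are unmarked. The bags of $D$ are the components of $(V(D),E(D)\setminus M(D))$. Given a split $(X,Y)$ of $G$ and nonempty sets $X'\subseteq X$, $Y'\subseteq Y$ such that the edges of $G$ between $X$ and $Y$ are exactly all pairs $xy$ with $x\in X'$, $y\in Y'$, the simple decomposition of $G$ is the marked graph on $V(G)\cup\{x',y'\}$ ($x',y'$ new) with edges those of $G[X]$ and $G[Y]$, the marked edge $x'y'$, and unmarked edges joining $x'$ to all of $X'$ and $y'$ to all of $Y'$. A split decomposition of $G$ is either $G$ itself (no marked edges) or is obtained from a split decomposition of $G$ by replacing a bag $H$ by a simple decomposition of $H$. Recomposing $D$ along a marked edge $xy$ gives $(D\wedge xy)\setminus\{x,y\}$; $\mathcal{G}[D]$ is the graph obtained by recomposing all marked edges. A canonical (split) decomposition is one in which each bag is prime, a star or a complete graph and which is not a refinement of another decomposition with this property; every connected graph has a unique one up to isomorphism, and $G$ is distance-hereditary iff all its bags are of type K (complete) or S (star). A vertex $v$ of $D$ represents an unmarked vertex $x$ if $v=x$ or there is a path of even length from $v$ to $x$ in $D$ starting with a marked edge in which marked and unmarked edges alternate. Two unmarked vertices are linked in $D$ if there is a path between them in which unmarked and marked edges alternate. For an unmarked vertex $x$, $D*x$ is obtained by replacing each bag $B$ containing a representative $w$ of $x$ by $B*w$; for linked unmarked $x,y$, $D\wedge xy:=D*x*y*x$. Limbs. Let $D$ be the canonical decomposition of a connected distance-hereditary graph, $B$ a bag, and $y$ an unmarked vertex represented by a marked vertex of $B$. Let $T$ be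 the component of $D\setminus V(B)$ containing $y$, and let $v\in V(T)$, $w\in V(B)$ be the adjacent marked vertices of $D$; $v$ is regarded as an unmarked vertex of the split decomposition $T$. The limb $\mathcal{L}_D[B,y]$ is: $T*v\setminus v$ if $B$ is of type K; $T\setminus v$ if $B$ is a star and $w$ is a leaf of $B$; $T\wedge vy\setminus v$ if $B$ is a star and $w$ is its center. It is a split decomposition (with the inherited marked edges), and $\mathcal{LG}_D[B,y]:=\mathcal{G}[\mathcal{L}_D[B,y]]$. For a bag $B$ and a component $T$ of $D\setminus V(B)$, $f_D(B,T):=\mathrm{lrw}(\mathcal{LG}_D[B,y])$ for any unmarked vertex $y\in V(T)$ represented by a marked vertex of $B$ (the value does not depend on the choice of $y$). *)

(* Defs.v *)
From mathcomp Require Import all_boot all_order all_algebra.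

Set Implicit Arguments.
Unset Strict Implicit.
Unset Printing Implicit Defensive.

(* Graphs live inside an ambient finite type U: the vertex set is a subset of U
   and an edge is a 2-element set of vertices.  The part of U outside the vertex
   set supplies the new vertices x', y' of simple decompositions. *)

Section Graphs.
Variable U : finType.
Implicit Types (x y : U) (V X Y : {set U}) (r : rel U).

Record graph := Graph {
  verts : {set U};
  edges : {set {set U}};
  edges_wf : [forall e in edges, (#|e| == 2) && (e \subset verts)] }.

Implicit Types G H : graph.

Definition adj G : rel U := fun x y => [set x; y] \in edges G.

Definition edges_of V r : {set {set U}} :=
  [set [set p.1; p.2] | p : U * U
     & [&& p.1 \in V, p.2 \in V, p.1 != p.2 & r p.1 p.2]].

Fact edges_of_wf V r :
  [forall e in edges_of V r, (#|e| == 2) && (e \subset V)].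
Proof.
apply/forall_inP => e /imsetP[[x y]]; rewrite inE /= => /and4P[xV yV xy _] ->.
by rewrite cards2 xy /= subUset !sub1set xV yV.
Qed.

(* The edges are the pairs {x, y} of distinct elements of V with r x y or
   r y x. *)
Definition graph_of V r : graph := Graph (edges_of_wf V r).

Definition induced G X : graph := graph_of (verts G :&: X) (adj G).

Definition local_compl G x : graph :=
  graph_of (verts G) (fun a b => adj G a b (+) (adj G x a && adj G x b)).

Definition pivot G x y : graph :=
  local_compl (local_compl (local_compl G x) y) x.

Definition component_of G x : {set U} :=
  [set y in verts G | connect (adj G) x y].

Definition components G : {set {set U}} :=
  [set component_of G x | x in verts G].

Definition connected G : bool :=
  [forall x in verts G, forall y in verts G, connect (adj G) x y].

Definition acyclic G : bool :=
  [forall n : 'I_#|U|.+1, forall c : n.-tuple U,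
     (2 < n) ==> ~~ (cycle (adj G) c && uniq c)].

Definition tree G : bool := connected G && acyclic G.

Definition star_at G c : bool :=
  [&& tree G, c \in verts G & [forall x in verts G, (x != c) ==> adj G c x]].

Definition complete G : bool :=
  [forall x in verts G, forall y in verts G, (x != y) ==> adj G x y].

(* The length of a shortest path; it is #|U|, larger than any finite distance,
   when x and y are not connected. *)
Definition dist G x y : nat :=
  find (fun n => [exists p : n.-tuple U, path (adj G) x p && (last x p == y)])
       (iota 0 #|U|).

Definition distance_hereditary G : Prop :=
  forall X, X \subset verts G -> connected (induced G X) ->
  forall x y, x \in X -> y \in X -> dist (induced G X) x y = dist G x y.

Definition cut_matrix G X : 'M['F_2]_(#|X|, #|verts G :\: X|) :=
  (\matrix_(i, j) (adj G (enum_val i) (enum_val j))%:R)%R.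

Definition cutrk G X : nat := \rank (cut_matrix G X).

Definition layout G (s : seq U) : bool := uniq s && ([set:: s] == verts G).

Definition layout_width G (s : seq U) : nat :=
  \max_(1 <= i < size s) cutrk G [set:: take i s].

Definition lrw G : nat :=
  if #|verts G| <= 1 then 0 else
  layout_width G
    [arg min_(s < enum_tuple (verts G) | layout G s) layout_width G s].

Definition split_via G X Y X' Y' : Prop :=
  [/\ X :|: Y = verts G, [disjoint X & Y], 2 <= #|X| & 2 <= #|Y|] /\
  [/\ X' \subset X, Y' \subset Y, X' != set0, Y' != set0 &
      forall x y, x \in X -> y \in Y ->
        adj G x y = (x \in X') && (y \in Y')].

Definition prime_graph G : Prop :=
  connected G /\ ~ exists X Y X' Y', split_via G X Y X' Y'.

End Graphs.

Section Decompositions.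
Variable U : finType.
Implicit Types (x y v w : U) (B T X Y : {set U}) (G H : graph U).

(* A graph with a set of marked edges.  That the graph is connected and that the
   marked edges form a matching of cut-edges is not part of the record: it holds
   by construction for split decompositions of connected graphs. *)
Record mgraph := MGraph { mgraph_graph :> graph U; marked : {set {set U}} }.

Implicit Types D : mgraph.

Definition madj D : rel U := fun x y => adj D x y && ([set x; y] \in marked D).
Definition uadj D : rel U :=
  fun x y => adj D x y && ([set x; y] \notin marked D).

Definition marked_vertex D x : bool :=
  (x \in verts D) && [exists y, madj D x y].
Definition unmarked_vertex D x : bool :=
  (x \in verts D) && ~~ [exists y, madj D x y].

Definition minduced D X : mgraph :=
  MGraph (induced D X) [set e in marked D | e \subset verts D :&: X].
Definition mdel D X : mgraph := minduced D (~: X).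

(* Bags, like components, are handled through their vertex sets. *)
Definition bags D : {set {set U}} := components (graph_of (verts D) (uadj D)).
Definition bag_graph D B : graph U := graph_of (verts D :&: B) (uadj D).

Definition simple_decomposition H X Y X' Y' x' y' : mgraph :=
  MGraph (graph_of (verts H :|: [set x'; y'])
            (fun a b => [|| [&& a \in X, b \in X & adj H a b],
                            [&& a \in Y, b \in Y & adj H a b],
                            (a == x') && (b == y'),
                            (a == x') && (b \in X')
                          | (a == y') && (b \in Y')]))
         [set [set x'; y']].

Definition replace_bag D B (S : mgraph) : mgraph :=
  MGraph (graph_of (verts D :|: verts S)
            (fun a b => [set a; b] \in
               (edges D :\: edges (bag_graph D B)) :|: edges S))
         (marked D :|: marked S).

Definition refine_step D D' : Prop :=
  exists B X Y X' Y' x' y',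
    [/\ B \in bags D, split_via (bag_graph D B) X Y X' Y',
        [/\ x' \notin verts D, y' \notin verts D & x' != y'] &
        D' = replace_bag D B
               (simple_decomposition (bag_graph D B) X Y X' Y' x' y')].

Inductive refinement D : mgraph -> Prop :=
| refinement_refl : refinement D D
| refinement_step D1 D2 :
    refinement D D1 -> refine_step D1 D2 -> refinement D D2.

Definition split_decomposition G D : Prop := refinement (MGraph G set0) D.

Definition bags_prime_star_complete D : Prop :=
  forall B, B \in bags D ->
    [\/ prime_graph (bag_graph D B), exists c, star_at (bag_graph D B) c
      | complete (bag_graph D B)].

Definition canonical_decomposition G D : Prop :=
  [/\ split_decomposition G D, bags_prime_star_complete D &
      ~ exists D', [/\ split_decomposition G D', bags_prime_star_complete D',
                       refinement D' D & D' <> D]].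

Definition recompose D x y : mgraph :=
  mdel (MGraph (pivot D x y) (marked D)) [set x; y].

(* All ordered pairs are scanned; every marked edge is recomposed when the first
   of its two orientations is met, and is gone at the second. *)
Definition recompose_all D : graph U :=
  foldl (fun D' p => if madj D' p.1 p.2 then recompose D' p.1 p.2 else D')
        D (enum {: U * U}).

Fixpoint alternating D (m : bool) x (p : seq U) : bool :=
  if p is y :: p' then
    (if m then madj D x y else uadj D x y) && alternating D (~~ m) y p'
  else true.

Definition represents D v x : bool :=
  unmarked_vertex D x &&
  ((v == x) ||
   [exists n : 'I_#|U|, exists p : n.-tuple U,
     [&& ~~ odd n, uniq (v :: p), last v p == x & alternating D true v p]]).

(* D * x for an unmarked vertex x: marked edges are kept, and each bag with a
   representative of x (there is at most one per bag) is locally complemented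
   at it. *)
Definition mlocal_compl D x : mgraph :=
  MGraph (graph_of (verts D) (fun a b => madj D a b ||
            [exists B in bags D,
               if [pick w in B | represents D w x] is Some w
               then adj (local_compl (bag_graph D B) w) a b
               else adj (bag_graph D B) a b]))
         (marked D).

Definition mpivot D x y : mgraph :=
  mlocal_compl (mlocal_compl (mlocal_compl D x) y) x.

(* In T = D[C] the vertex v is unmarked, because its marked edge vw is not an
   edge of T.  The last branch is the one of a star of which w is a leaf; bags
   with a marked vertex have at least 3 vertices, so the three types exclude each
   other.  A marked edge vw always exists when y is represented by a marked vertex
   of B, so the None branch is not relevant. *)
Definition limb D B y : mgraph :=
  let C := component_of (mdel D B) y in
  let T := minduced D C in
  if [pick p : U * U | [&& p.1 \in C, p.2 \in B & madj D p.1 p.2]]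
    is Some (v, w) then
    if complete (bag_graph D B) then mdel (mlocal_compl T v) [set v]
    else if star_at (bag_graph D B) w then mdel (mpivot T v y) [set v]
    else mdel T [set v]
  else T.

Definition limb_graph D B y : graph U := recompose_all (limb D B y).

(* f_D(B, T), T given by its vertex set.  A suitable y always exists, and the
   value does not depend on it. *)
Definition limb_lrw D B T : nat :=
  if [pick y in T | [exists w in B, marked_vertex D w && represents D w y]]
    is Some y
  then lrw (limb_graph D B y) else 0.

End Decompositions.

(* Main.v *)
Require Import Defs.
From mathcomp Require Import all_boot all_order all_algebra.

(** Let b be a position of a bag B, with L the vertices of G hanging at b and u, v
    two vertices outside L that are linked to two other positions of B, at least
    one of them adjacent to b.  For P in L, the cut-rank of P in the limb at b plus
    one is the rank of A_G[P + u, (L - P) + v]; this covers the three types of limb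
    at once.  Hence limb widths are monotone (submatrices) and at most lrw(G).  If
    a cut of a layout of width k restricts to a cut of rank k of the limb, then all
    vertices outside L lie on one side of it, and this cannot happen for three
    positions of a bag.  Conversely one lays out G bag by bag: appending the leaves
    of a position of limb width below k costs at most one more than the cuts of the
    limb, and one walks along the at most two positions of width k of each bag.
    All this needs bags that are complete or stars; prime bags with more than three
    vertices do not occur, because a connected distance-hereditary graph with at
    least four vertices has a split. *)

Set Implicit Arguments.
Unset Strict Implicit.
Unset Printing Implicit Defensive.

(** Limbs arise from operations on decompositions followed by recomposition. Recomposed graphs are
    never written out: adjacency in them is [linked], a relation that recomposition preserves and
    that [mlocal_compl] changes as local complementation changes adjacency. So everything is read
    off in [D]. Between two branches of a bag adjacency is a product of indicators
    ([linked_branches]); inside a limb, away from the pivot vertex, it differs from that of [G] by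
    such products. Up to row operations this is what elimination at one nonzero entry produces,
    whence the added one in the rank formula. Its value is independent of [u] and [v], so they may
    be chosen anew for every cut; this settles most cases where given outer vertices lie on the
    wrong side. Three positions of width [k] are excluded because the cuts of a layout are nested:
    the middle one of three cuts separates leaves of the other two positions. Conversely, the walk
    starts at a position of width [k] with fewest leaves, so that it only has to proceed in one
    direction. *)

Import GRing.Theory.

(** * Ranks of Boolean matrices over the field with two elements *)

Section BooleanRank.
Variable U : finType.
Implicit Types (F H : U -> U -> bool) (P Q X : {set U}) (G : graph U).

Definition bmx F : 'M['F_2]_#|U| :=
  (\matrix_(i, j) (F (enum_val i) (enum_val j))%:R)%R.

Definition rk F : nat := \rank (bmx F).

Lemma eq_rk F H : F =2 H -> rk F = rk H.
Proof. by move=> FH; congr (\rank _); apply/matrixP => i j; rewrite !mxE FH. Qed.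

Lemma rk_tr F : rk (fun a c => F c a) = rk F.
Proof.
by rewrite /rk -mxrank_tr; congr (\rank _); apply/matrixP => i j; rewrite !mxE.
Qed.

Lemma F2_addb (a b : bool) : ((a (+) b)%:R = a%:R + b%:R :> 'F_2)%R.
Proof. by apply: val_inj; case: a; case: b. Qed.

Lemma F2_andb (a b : bool) : ((a && b)%:R = a%:R * b%:R :> 'F_2)%R.
Proof. by apply: val_inj; case: a; case: b. Qed.

Lemma row_bmx_comb F H a s1 s2 b1 b2 :
    (forall c, F a c = (s1 && H b1 c) (+) (s2 && H b2 c)) ->
  row (enum_rank a) (bmx F) = (s1%:R *: row (enum_rank b1) (bmx H) +
     s2%:R *: row (enum_rank b2) (bmx H))%R.
Proof.
move=> FH; apply/rowP => j.
by rewrite !mxE !enum_rankK FH F2_addb !F2_andb.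
Qed.

Lemma rk_row_comb F H :
    (forall a, exists s1 s2 b1 b2,
       forall c, F a c = (s1 && H b1 c) (+) (s2 && H b2 c)) ->
  rk F <= rk H.
Proof.
move=> FH; apply/mxrankS/row_subP => i; rewrite -[i]enum_valK.
have [s1 [s2 [b1 [b2 /row_bmx_comb ->]]]] := FH (enum_val i).
by apply: addmx_sub; apply: scalemx_sub; apply: row_sub.
Qed.

Lemma rk_row1 F H :
    (forall a, exists s b, forall c, F a c = s && H b c) -> rk F <= rk H.
Proof.
move=> FH; apply: rk_row_comb => a; have [s [b E]] := FH a.
by exists s, false, b, b => c; rewrite E addbF.
Qed.

Lemma rk_col1 F H :
    (forall c, exists s b, forall a, F a c = s && H a b) -> rk F <= rk H.
Proof.
by move=> FH; rewrite -(rk_tr F) -(rk_tr H); apply: rk_row1.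
Qed.

Lemma rk_add F H : rk (fun a c => F a c (+) H a c) <= rk F + rk H.
Proof.
rewrite /rk; apply: leq_trans (mxrank_add _ _).
rewrite (_ : bmx _ = (bmx F + bmx H)%R) //.
by apply/matrixP => i j; rewrite !mxE F2_addb.
Qed.

Lemma rk_rank1 (f g : pred U) : rk (fun a c => f a && g c) <= 1.
Proof.
rewrite /rk (_ : bmx _ = ((\col_i (f (enum_val i))%:R) *m
   (\row_j (g (enum_val j))%:R) : 'M['F_2]_#|U|)%R).
  exact: mulmx_max_rank.
by apply/matrixP => i j; rewrite !mxE big_ord1 !mxE F2_andb.
Qed.

(* Wedderburn's rank-one reduction at the nonzero entry (y, z). *)
Lemma rk_pivot F y z : F y z ->
  rk F = (rk (fun a c => F a c (+) (F a z && F y c))).+1.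
Proof.
move=> Fyz; set H := fun a c => _.
apply/eqP; rewrite eqn_leq; apply/andP; split.
  rewrite -addn1 (@eq_rk F (fun a c => H a c (+) (F a z && F y c))).
    by apply: leq_trans (rk_add _ _) _; rewrite leq_add2l rk_rank1.
  by move=> a c; rewrite /H -addbA addbb addbF.
pose r : 'rV['F_2]_#|U| := row (enum_rank y) (bmx F).
(* Column [z] of [H] vanishes, whereas row [y] of [F] is nonzero there; so this row is independent
   of the rows of [H]. *)
have rH0 : (bmx H :&: r)%MS = 0%R.
  apply/eqP/rowV0P => v; rewrite sub_capmx => /andP[/submxP[w vw] /sub_rVP[t vt]].
  have vz0 : v 0%R (enum_rank z) = 0%R.
    rewrite vw mxE big1 // => i _; rewrite !mxE enum_rankK /H Fyz andbT addbb.
    by rewrite mulr0.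
  move: vz0; rewrite vt !mxE !enum_rankK Fyz mulr1 => ->.
  by rewrite scale0r.
have rr : \rank r = 1.
  rewrite rank_rV; case: eqP => // /rowP/(_ (enum_rank z)).
  by rewrite !mxE !enum_rankK Fyz => /eqP; rewrite oner_eq0.
rewrite /rk -addn1 -[X in _ + X]rr -(mxrank_disjoint_sum rH0).
apply/mxrankS; rewrite addsmx_sub row_sub andbT.
apply/row_subP => i; rewrite -[i]enum_valK.
rewrite (@row_bmx_comb H F _ true (F (enum_val i) z) (enum_val i) y).
  by apply: addmx_sub; apply: scalemx_sub; apply: row_sub.
by move=> c; rewrite /H /=.
Qed.

(** A submatrix is encoded as the full matrix over [U] with all other entries masked to zero, so
    that ranks over different index sets are compared within one matrix type. *)
Definition rkc F P Q : nat := rk (fun a c => [&& a \in P, c \in Q & F a c]).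

Lemma rkc_tr F P Q : rkc F P Q = rkc (fun a c => F c a) Q P.
Proof.
by rewrite /rkc -rk_tr; apply: eq_rk => a c; rewrite andbCA.
Qed.

Lemma rkc_sub F P Q P' Q' :
  P \subset P' -> Q \subset Q' -> rkc F P Q <= rkc F P' Q'.
Proof.
move=> /subsetP sP /subsetP sQ; apply: (@leq_trans (rkc F P Q')).
  apply: rk_col1 => c; exists (c \in Q), c => a.
  by case: (boolP (c \in Q)) => [/sQ ->|]; rewrite /= ?andbF.
apply: rk_row1 => a; exists (a \in P), a => c.
by case: (boolP (a \in P)) => [/sP ->|]; rewrite /= ?andbF.
Qed.

Lemma eq_rkc F H P Q : (forall a c, a \in P -> c \in Q -> F a c = H a c) ->
  rkc F P Q = rkc H P Q.
Proof.
move=> FH; apply: eq_rk => a c.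
by case: (boolP (a \in P)) => //= aP; case: (boolP (c \in Q)) => //= cQ; apply: FH.
Qed.

Lemma rkc0l F Q : rkc F set0 Q = 0.
Proof.
apply/eqP; rewrite /rkc /rk mxrank_eq0; apply/eqP/matrixP => i j.
by rewrite !mxE in_set0.
Qed.

Lemma rkc0r F P : rkc F P set0 = 0.
Proof. by rewrite rkc_tr rkc0l. Qed.

Lemma rkc_addl F u P Q : rkc F (u |: P) Q <= (rkc F P Q).+1.
Proof.
rewrite -addn1.
apply: leq_trans (_ : rkc F P Q + rk (fun a c => (a == u) && ((u \notin P) && (c \in Q) && F u c)) <= _); last first.
  by rewrite leq_add2l rk_rank1.
apply: leq_trans (rk_add _ _).
rewrite leq_eqVlt; apply/orP; left; apply/eqP/eq_rk => a c.
rewrite in_setU1; case: (eqVneq a u) => [->|_] /=.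
  by case: (u \in P); rewrite /= ?addbF.
by rewrite addbF.
Qed.

Lemma rkc_addr F u P Q : rkc F P (u |: Q) <= (rkc F P Q).+1.
Proof. by rewrite rkc_tr (rkc_tr _ P Q); apply: rkc_addl. Qed.

Lemma cutrk_rkc G X : cutrk G X = rkc (adj G) X (verts G :\: X).
Proof.
rewrite /cutrk /rkc /rk; set M := cut_matrix G X; set B := bmx _.
(* [E] and [E'] embed the two index sets into [U], so that [B] is [E *m M *m E']; conversely [M] is
   a submatrix of [B]. *)
pose E : 'M['F_2]_(#|U|, #|X|) := (\matrix_(i, k) (enum_val i == enum_val k)%:R)%R.
pose E' : 'M['F_2]_(#|verts G :\: X|, #|U|) :=
  (\matrix_(k, j) (enum_val k == enum_val j)%:R)%R.
apply/eqP; rewrite eqn_leq; apply/andP; split.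
  have -> : M = ((mxsub (fun k => enum_rank (enum_val k))
                   (fun k => enum_rank (enum_val k)) B))%R.
    by apply/matrixP => i j; rewrite !mxE !enum_rankK !enum_valP.
  rewrite mxsubrc; apply: leq_trans (mxrankS _) _; first exact: rowsub_sub.
  by rewrite -mxrank_tr trmx_mxsub -[X in _ <= X]mxrank_tr; apply/mxrankS/rowsub_sub.
suff -> : B = (E *m M *m E')%R.
  by apply: leq_trans (mxrankM_maxl _ _) (mxrankM_maxr _ _).
apply/matrixP => i j; rewrite !mxE.
case: (boolP (enum_val j \in verts G :\: X)) => [jQ|jQ]; last first.
  rewrite andbF big1 // => k _; rewrite !mxE.
  case: eqP => [e|_]; last by rewrite mulr0.
  by case/negP: jQ; rewrite -e enum_valP.
rewrite (bigD1 (enum_rank_in jQ (enum_val j))) //= big1; last first.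
  move=> k kj; rewrite !mxE; case: eqP => [e|_]; last by rewrite mulr0.
  by case/eqP: kj; apply: enum_val_inj; rewrite enum_rankK_in.
rewrite !mxE enum_rankK_in // eqxx mulr1 addr0.
case: (boolP (enum_val i \in X)) => [iX|iX] /=; last first.
  rewrite big1 // => k _; rewrite !mxE.
  case: eqP => [e|_]; last by rewrite mul0r.
  by case/negP: iX; rewrite e enum_valP.
rewrite (bigD1 (enum_rank_in iX (enum_val i))) //= big1; last first.
  move=> k kj; rewrite !mxE; case: eqP => [e|_]; last by rewrite mul0r.
  by case/eqP: kj; apply: enum_val_inj; rewrite enum_rankK_in.
by rewrite !mxE !enum_rankK_in // eqxx mul1r addr0.
Qed.

Lemma cutrk0 G : cutrk G set0 = 0.
Proof. by rewrite cutrk_rkc rkc0l. Qed.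

Lemma cutrkT G : cutrk G (verts G) = 0.
Proof. by rewrite cutrk_rkc setDv rkc0r. Qed.

(** Quantifying over all prefixes is harmless since the empty and the full one have cut-rank 0; it
    also covers graphs with at most one vertex, where [lrw] is 0 by convention. *)
Lemma lrw_leP G k :
  reflect (exists s : seq U, layout G s /\ forall i, cutrk G [set:: take i s] <= k)
          (lrw G <= k).
Proof.
have lay_sz s : layout G s -> size s = #|verts G|.
  by case/andP=> us /eqP <-; rewrite cardsE; apply/esym/card_uniqP.
have widthP s : layout G s ->
    (layout_width G s <= k) <-> forall i, cutrk G [set:: take i s] <= k.
  move=> ls; split=> [w i|w]; last first.
    rewrite /layout_width; apply: (big_ind (fun x => x <= k)) => //.
    by move=> x y; rewrite geq_max => -> ->.
  case: (posnP i) => [->|i0].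
    by rewrite take0 (_ : [set:: [::]] = set0) ?cutrk0 //; apply/setP => z; rewrite !inE.
  case: (ltnP i (size s)) => is_.
    apply: leq_trans w; rewrite /layout_width.
    rewrite (bigD1_seq i) ?leq_maxl ?iota_uniq //.
    by rewrite mem_index_iota i0.
  by rewrite take_oversize //; case/andP: ls => _ /eqP ->; rewrite cutrkT.
have lenum : layout G (enum (verts G)).
  by rewrite /layout enum_uniq; apply/eqP/setP => z; rewrite inE mem_enum.
have lenum' : layout G (enum_tuple (verts G)) by [].
rewrite /lrw; case: ifP => [small|_].
  apply: (iffP idP) => // _; exists (enum (verts G)); split=> //.
  apply/widthP => //; rewrite /layout_width big_geq ?leq0n //.
  by rewrite (lay_sz _ lenum).
case: arg_minnP => // s ls smin; apply: (iffP idP).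
  by move=> w; exists s; split=> //; apply/widthP.
case=> s' [ls' /(widthP _ ls') w]; apply: leq_trans w.
have /eqP sz := lay_sz _ ls'.
exact: (smin (Tuple sz)).
Qed.

End BooleanRank.

(** * Alternating walks in marked graphs *)

Section GraphBasics.
Variable U : finType.
Implicit Types (x y a b : U) (V X : {set U}) (r : rel U) (G : graph U).

Lemma set2_inj x y a b : [set x; y] = [set a; b] ->
  (x = a /\ y = b) \/ (x = b /\ y = a).
Proof.
move=> E; have := set21 x y; have := set22 x y; rewrite E !inE.
have := set21 a b; have := set22 a b; rewrite -E !inE.
do 4!case/orP=> /eqP ?; subst; tauto.
Qed.

Lemma set2C x y : [set x; y] = [set y; x].
Proof. exact: setUC. Qed.

Lemma adjC G x y : adj G x y = adj G y x.
Proof. by rewrite /adj set2C. Qed.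

Lemma adjP G x y : adj G x y -> [/\ x \in verts G, y \in verts G & x != y].
Proof.
move=> xy; have /forall_inP/(_ [set x; y] xy)/andP[] := edges_wf G.
rewrite subUset !sub1set => c2 /andP[-> ->]; split=> //.
by apply: contraTneq c2 => ->; rewrite setUid cards1.
Qed.

Lemma adj_irr G x : adj G x x = false.
Proof. by apply/negP => /adjP[_ _ /eqP]. Qed.

Lemma edge_adj G e : e \in edges G -> exists x y, e = [set x; y] /\ adj G x y.
Proof.
move=> eG; have /forall_inP/(_ e eG)/andP[/cards2P[x [y [_ E]]] _] := edges_wf G.
by exists x, y; rewrite /adj -E.
Qed.

Lemma adj_graph_of V r x y : adj (graph_of V r) x y =
  [&& x \in V, y \in V, x != y & r x y || r y x].
Proof.
apply/imsetP/and4P => [[[a b]]|[xV yV xy]].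
  rewrite inE /= => /and4P[aV bV ab rab] /set2_inj[[-> ->]|[-> ->]].
    by split=> //; rewrite rab.
  by split=> //; [rewrite eq_sym | rewrite rab orbT].
case/orP=> rxy; [exists (x, y) | exists (y, x)] => //=.
- by rewrite inE /= xV yV xy.
- by rewrite inE /= xV yV eq_sym xy.
- exact: set2C.
Qed.

Lemma adj_induced G X x y : adj (induced G X) x y = [&& x \in X, y \in X & adj G x y].
Proof.
rewrite adj_graph_of (adjC G y) orbb !inE.
case: (boolP (adj G x y)) => [/adjP[-> -> ->]|]; by rewrite ?andbT ?andbF.
Qed.

Lemma adj_local_compl G z x y : adj (local_compl G z) x y =
  (x != y) && (adj G x y (+) (adj G z x && adj G z y)).
Proof.
rewrite adj_graph_of (adjC G y) [adj G z y && _]andbC orbb.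
case: (boolP (adj G x y)) => [/adjP[-> -> _] //|].
case: (boolP (adj G z x)) => [/adjP[_ -> _]|]; last by rewrite !andbF.
by case: (boolP (adj G z y)) => [/adjP[_ -> _]|]; rewrite //= !andbF.
Qed.

Lemma connectedP G :
  reflect {in verts G &, forall x y, connect (adj G) x y} (connected G).
Proof.
apply: (iffP forall_inP) => [H x y xG yG|H x xG].
  by have /forall_inP/(_ _ yG) := H _ xG.
by apply/forall_inP => y yG; apply: H.
Qed.

Lemma connect_verts r (V : {set U}) x y : (forall a b, r a b -> (a \in V) && (b \in V)) ->
  connect r x y -> x \in V -> y \in V.
Proof.
move=> rV /connectP[p]; elim: p x => [|d p IH] x /= => [_ -> //|/andP[xd dp] yE xV].
by apply: (IH d) => //; case/andP: (rV _ _ xd).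
Qed.

End GraphBasics.

Section Marked.
Variable U : finType.
Implicit Types (x y v w : U) (B T X Y S : {set U}) (D : mgraph U).

(* Two steps of an alternating path: for unmarked x, the vertex w represents x iff
   connect (hop D) w x.  In a marked graph with cut-edges as marked edges such
   walks are automatically paths. *)
Definition hop D : rel U := fun v w => [exists u, madj D v u && uadj D u w].

(** Alternating walks whose first and last edges are unmarked. Between unmarked vertices this is
    adjacency in the recomposed graph, see [recompose_allP]. *)
Definition linked D : rel U := fun a b => [exists w, uadj D a w && connect (hop D) w b].

(* The marked edge xy is the only edge leaving S, i.e. it is a cut-edge. *)
Definition side D x y S : Prop :=
  [/\ x \in S, y \notin S &
      forall a b, adj D a b -> a \in S -> b \notin S -> a = x /\ b = y].

Record wf D : Prop := Wf {
  wf_edges : {subset marked D <= edges D};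
  wf_matching : forall x y z, madj D x y -> madj D x z -> y = z;
  wf_side : forall x y, madj D x y -> exists S, side D x y S }.

Definition bag D x : {set U} := [set y | connect (uadj D) x y].

Lemma madjC D x y : madj D x y = madj D y x.
Proof. by rewrite /madj adjC set2C. Qed.

Lemma uadjC D x y : uadj D x y = uadj D y x.
Proof. by rewrite /uadj adjC set2C. Qed.

Lemma uadj_irr D x : uadj D x x = false.
Proof. by rewrite /uadj adj_irr. Qed.

Lemma madj_adj D x y : madj D x y -> adj D x y.
Proof. by case/andP. Qed.

Lemma uadj_adj D x y : uadj D x y -> adj D x y.
Proof. by case/andP. Qed.

Lemma madj_uadj D x y : madj D x y -> uadj D x y = false.
Proof. by rewrite /madj /uadj => /andP[_ ->]; rewrite andbF. Qed.

Lemma adj_mu D x y : adj D x y = madj D x y || uadj D x y.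
Proof. by rewrite /madj /uadj -andb_orr orbN andbT. Qed.

Lemma connect_uadjC D : connect_sym (uadj D).
Proof. by apply: sym_connect_sym => x y; rewrite uadjC. Qed.

Lemma unmarkedN D x y : unmarked_vertex D x -> madj D x y = false.
Proof. by case/andP=> _ /existsPn/(_ y)/negbTE. Qed.

Lemma unmarked_verts D x : unmarked_vertex D x -> x \in verts D.
Proof. by case/andP. Qed.

Lemma hopE D v u w : wf D -> madj D v u -> hop D v w = uadj D u w.
Proof.
move=> wfD vu; apply/existsP/idP => [[u' /andP[vu' u'w]]|uw].
  by rewrite (wf_matching wfD vu vu').
by exists u; rewrite vu.
Qed.

Lemma hop_unmarked D x y : unmarked_vertex D x -> hop D x y = false.
Proof. by move=> ux; apply/existsP => -[u]; rewrite (unmarkedN _ ux). Qed.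

Lemma connect_hop_unmarked D x y : unmarked_vertex D x -> connect (hop D) x y -> y = x.
Proof.
move=> ux /connectP[[|d p]] /=; first by [].
by rewrite (hop_unmarked _ ux).
Qed.

Section Side.
Variables (D : mgraph U) (wfD : wf D).

Lemma side_uadj x y S a b : madj D x y -> side D x y S -> uadj D a b ->
  (a \in S) = (b \in S).
Proof.
move=> xy [xS yS cr] ab; apply/idP/idP => inS; apply: contraT => ninS.
  case: (cr a b (uadj_adj ab) inS ninS) => ax bY; move: ab.
  by rewrite ax bY (madj_uadj xy).
rewrite uadjC in ab.
case: (cr b a (uadj_adj ab) inS ninS) => bx ay; move: ab.
by rewrite ay bx (madj_uadj xy).
Qed.

Lemma side_bag x y S a b : madj D x y -> side D x y S -> connect (uadj D) a b ->
  (a \in S) = (b \in S).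
Proof.
move=> xy sS; apply: closed_connect => u v uv.
exact: (side_uadj xy sS uv).
Qed.

Lemma madj_bag x y : madj D x y -> connect (uadj D) x y -> False.
Proof.
move=> xy cxy; have [S sS] := wf_side wfD xy.
by have := side_bag xy sS cxy; case: sS => -> /negbTE ->.
Qed.

(** Sides nest along a hop: [m] shares the bag of [d] and hence is not in [S'], so no edge can leave
    [S :&: S'] through [m]. *)
Lemma sideI w m d md S S' : madj D w m -> uadj D m d -> madj D d md ->
  side D m w S -> side D md d S' -> side D md d (S :&: S').
Proof.
move=> wm ud dmd sS sS'; have mw : madj D m w by rewrite madjC.
have mdd : madj D md d by rewrite madjC.
have dS : d \in S by rewrite -(side_uadj mw sS ud); case: sS.
have mS' : m \notin S' by rewrite (side_uadj mdd sS' ud); case: sS'.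
case: sS sS' => [mS wS cr] [mdS' dS' cr']; split.
- rewrite inE mdS' andbT; apply: contraT => nS.
  have [dm _] := cr _ _ (madj_adj dmd) dS nS.
  by rewrite dm uadj_irr in ud.
- by rewrite inE (negbTE dS') andbF.
move=> a b ab; rewrite inE => /andP[aS aS'].
rewrite inE negb_and orbC; case: (boolP (b \in S')) => [bS'|bS' _]; last exact: cr'.
move=> /= bS; have [am _] := cr _ _ ab aS bS.
by rewrite -am aS' in mS'.
Qed.

(** By [sideI] each further hop stays inside the side of the previous marked edge, so a hop walk
    never comes back across its first one. *)
Lemma hop_path_side w m p S : madj D w m -> side D m w S ->
  path (hop D) w p -> {subset p <= S}.
Proof.
elim: p w m S => [|d p IH] w m S wm sS //= /andP[wd dp].
have mw : madj D m w by rewrite madjC.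
have md : uadj D m d by rewrite -(hopE _ wfD wm).
have dS : d \in S by rewrite -(side_uadj mw sS md); case: sS.
move=> z; rewrite inE => /orP[/eqP -> //|zp].
case: p dp zp IH => // e p dp zp IH.
have /existsP[md' /andP[dmd _]] : hop D d e by case/andP: dp.
have mdd : madj D md' d by rewrite madjC.
have [S' sS'] := wf_side wfD mdd.
have := IH _ _ _ dmd (sideI wm md dmd sS sS') dp z zp.
by rewrite inE => /andP[].
Qed.

Lemma behind w m x S : madj D w m -> side D m w S -> connect (hop D) w x ->
  x != w -> x \in S.
Proof.
move=> wm sS /connectP[p pp ->]; case: p pp => [|d p] pp /=; first by rewrite eqxx.
by move=> _; apply: (hop_path_side wm sS pp); rewrite mem_last.
Qed.

(** If [w] and [w'] were different marked vertices of one bag, [x] would lie behind both marked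
    edges; but the side of [w] minus that of [w'] is again a side, and [behind] puts [x] into it. *)
Lemma rep_uniq w w' x : connect (uadj D) w w' -> unmarked_vertex D x ->
  connect (hop D) w x -> connect (hop D) w' x -> w = w'.
Proof.
have main u v m S : connect (uadj D) u v -> madj D v m -> side D m v S ->
    u \in S -> False.
  move=> uv vm [mS vS cr]; have mv : madj D m v by rewrite madjC.
  by rewrite (side_bag mv (And3 mS vS cr) uv) (negbTE vS).
move=> ww' ux wx w'x.
have marked_or v : connect (hop D) v x -> v = x \/ v != x /\ exists m, madj D v m.
  case/connectP=> [[|d p]] /=; first by move=> _ ->; left.
  move=> /andP[/existsP[m /andP[vm _]] _] _; right; split; last by exists m.
  by apply: contraTneq vm => ->; rewrite unmarkedN.
have [wx'|[wx' [m wm]]] := marked_or _ wx; have [w'x'|[w'x' [m' wm']]] := marked_or _ w'x.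
- by rewrite wx' w'x'.
- have mw' : madj D m' w' by rewrite madjC.
  have [S sS] := wf_side wfD mw'.
  case: (main w w' m' S ww' wm' sS); rewrite wx'.
  by apply: (behind wm' sS w'x); rewrite eq_sym.
- have mw : madj D m w by rewrite madjC.
  have [S sS] := wf_side wfD mw.
  case: (main w' w m S) => //; first by rewrite connect_uadjC.
  by rewrite w'x'; apply: (behind wm sS wx); rewrite eq_sym.
apply/eqP; apply: contraT => neq.
have mw : madj D m w by rewrite madjC.
have mw' : madj D m' w' by rewrite madjC.
have [S sS] := wf_side wfD mw; have [S' sS'] := wf_side wfD mw'.
have xS' : x \in S' by apply: (behind wm' sS' w'x); rewrite eq_sym.
suff sSS : side D m w (S :\: S').
  have : x \in S :\: S' by apply: (behind wm sSS wx); rewrite eq_sym.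
  by rewrite inE xS'.
have wS' : w \notin S' by apply/negP => /(main _ _ _ _ ww' wm' sS').
have w'S : w' \notin S.
  by apply/negP => /(main _ _ _ _ _ wm sS); rewrite connect_uadjC; apply.
case: sS sS' => mS wS cr [mS' wS'' cr']; split.
- rewrite inE mS andbT; apply/negP => mS'2.
  have [mm' ww2] := cr' _ _ (madj_adj mw) mS'2 wS'.
  by rewrite ww2 eqxx in neq.
- by rewrite inE (negbTE wS) andbF.
move=> a b ab; rewrite inE => /andP[aS' aS]; rewrite inE.
case: (boolP (b \in S)) => [bS|bS _]; last exact: cr.
rewrite andbT negbK => bS'.
have [bm' aw'] : b = m' /\ a = w' by apply: cr' => //; rewrite adjC.
by rewrite aw' (negbTE w'S) in aS.
Qed.

Lemma alternating_hop p v : ~~ odd (size p) -> alternating D true v p ->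
  connect (hop D) v (last v p).
Proof.
elim: {p}(size p) {-2}p (leqnn (size p)) v => [|n IH] [|a [|b p]] //= sz v.
rewrite negbK => od /and3P[va ab bp].
apply: connect_trans (connect1 _) (IH p _ b od bp); last exact: ltnW.
by apply/existsP; exists a; rewrite va.
Qed.

(** The last clause strengthens the induction: the rest of the path stays behind its next marked
    edge, which yields that no vertex is repeated. *)
Lemma hop_alternating v p : path (hop D) v p -> exists q,
  [/\ ~~ odd (size q), uniq (v :: q), last v q = last v p, alternating D true v q &
      forall m S, madj D v m -> side D m v S -> {subset q <= S}].
Proof.
elim: p v => [|d p IH] v /=; first by move=> _; exists [::].
case/andP=> /existsP[m /andP[vm md]] /IH[q [od uq lq aq sq]].
exists [:: m, d & q]; have mv : madj D m v by rewrite madjC.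
have sub S : side D m v S -> {subset [:: m, d & q] <= S}.
  move=> sS z; have mS : m \in S by case: sS.
  have dS : d \in S by rewrite -(side_uadj mv sS md).
  rewrite !inE => /or3P[/eqP -> //|/eqP -> //|zq].
  case: q aq zq {od uq lq} sq => // e q /= /andP[de _] zq sq.
  have ed : madj D e d by rewrite madjC.
  have [S' sS'] := wf_side wfD ed.
  have := sq _ _ de (sideI vm md de sS sS') z zq.
  by rewrite inE => /andP[].
split=> //=; first by rewrite negbK.
- have [S sS] := wf_side wfD mv.
  apply/andP; split.
    by apply/negP => /(sub S sS); case: sS => _ /negbTE ->.
  rewrite /= in uq; rewrite uq andbT inE negb_or.
  apply/andP; split; first by apply: contraTneq md => ->; rewrite uadj_irr.
  case: q aq {od lq sub uq} sq => // e q /= /andP[de _] sq.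
  have ed : madj D e d by rewrite madjC.
  have [S' sS'] := wf_side wfD ed; apply/negP => /(sq _ _ de sS').
  by rewrite (side_uadj ed sS' md); case: sS' => _ /negbTE ->.
- by rewrite vm md.
move=> m' S vm'; rewrite -(wf_matching wfD vm vm'); exact: sub.
Qed.

(** A hop walk already is a path without repetition, hence shorter than [#|U|], as the bounded
    quantifier in [represents] demands. *)
Lemma representsE w x : represents D w x = unmarked_vertex D x && connect (hop D) w x.
Proof.
rewrite /represents; case: (unmarked_vertex D x) => //=.
apply/orP/idP.
  case=> [/eqP -> //|/existsP[n /existsP[p /and4P[od _ /eqP <- al]]]].
  by apply: alternating_hop => //; rewrite size_tuple.
case/connectP=> p /hop_alternating[q [od uq lq aq _]] ->; right.
have szq : size q < #|U|.
  by have := max_card (mem (w :: q)); rewrite (card_uniqP uq).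
apply/existsP; exists (Ordinal szq); apply/existsP; exists (in_tuple q) => /=.
by rewrite od lq eqxx aq andbT; move: uq => /= ->.
Qed.

End Side.
End Marked.

(** * Recomposition *)

Section Pivot.
Variables (U : finType) (G : graph U) (x y : U).
Hypothesis xy : adj G x y.

Lemma adj_pivot a b : a \notin [set x; y] -> b \notin [set x; y] -> a != b ->
  adj (pivot G x y) a b =
  adj G a b (+) (adj G x a && adj G y b) (+) (adj G y a && adj G x b).
Proof.
rewrite !inE !negb_or => /andP[ax ay] /andP[bx by_] ab; have [_ _ nxy] := adjP xy.
have yx : adj G y x by rewrite adjC.
rewrite /pivot !adj_local_compl !adj_irr yx xy ab (eq_sym y x) (eq_sym y a).
rewrite (eq_sym y b) (eq_sym x a) (eq_sym x b) nxy ax ay bx by_ /=.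
by case: (adj G a b); case: (adj G x a); case: (adj G x b); case: (adj G y a); case: (adj G y b).
Qed.

(** Pivoting exchanges the neighborhoods of the two ends. In a limb at the center of a star, [y]
    thereby inherits the neighbors of the deleted marker. *)
Lemma adj_pivotr c : c \notin [set x; y] -> adj (pivot G x y) y c = adj G x c.
Proof.
rewrite !inE !negb_or => /andP[cx cy]; have [_ _ nxy] := adjP xy.
have yx : adj G y x by rewrite adjC.
rewrite /pivot !adj_local_compl !adj_irr yx xy (eq_sym y x) (eq_sym y c).
rewrite (eq_sym x c) nxy cx cy /= ?eqxx /=.
by case: (adj G x c); case: (adj G y c).
Qed.

End Pivot.

Section Recompose.
Variable U : finType.
Implicit Types (x y v w a b : U) (B T X Y S : {set U}) (D : mgraph U).

(* Used in both directions: D' is the recomposition of D along xy, or D is obtained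
   from D' by one refinement step. *)
Definition recomposes D x y D' : Prop :=
  [/\ madj D x y, verts D' = verts D :\: [set x; y],
      forall a b, madj D' a b =
        [&& a \notin [set x; y], b \notin [set x; y] & madj D a b] &
      forall a b, uadj D' a b =
        [&& a \notin [set x; y], b \notin [set x; y] &
            [|| uadj D a b, uadj D a x && uadj D y b | uadj D a y && uadj D x b]]].

Lemma recomposesC D x y D' : recomposes D x y D' -> recomposes D y x D'.
Proof.
case=> xy V M E; split; rewrite 1?madjC 1?[[set y; x]]set2C //.
by move=> a b; rewrite E; congr [&& _, _ & _ || _]; rewrite orbC.
Qed.

Lemma side_sym D x y S : side D x y S -> side D y x (~: S).
Proof.
case=> xS yS cr; split; rewrite ?inE ?xS ?yS //.
move=> a b ab; rewrite !inE negbK => aS bS.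
by case: (cr b a) => //; rewrite adjC.
Qed.

Lemma set2N x y a : (a \notin [set x; y]) = (a != x) && (a != y).
Proof. by rewrite !inE negb_or. Qed.


Section RecWf.
Variables (D D' : mgraph U) (x y : U) (wfD : wf D) (rD : recomposes D x y D').

Let xy : madj D x y. Proof. by case: rD. Qed.
Let yx : madj D y x. Proof. by rewrite madjC. Qed.

Lemma madj_end a b : madj D a b -> (a \in [set x; y]) = (b \in [set x; y]).
Proof.
move=> ab; have ba : madj D b a by rewrite madjC.
apply/set2P/set2P; case=> e; subst.
- by right; rewrite (wf_matching wfD ab xy).
- by left; rewrite (wf_matching wfD ab yx).
- by right; rewrite (wf_matching wfD ba xy).
- by left; rewrite (wf_matching wfD ba yx).
Qed.

Lemma unmarked_recomposes a : unmarked_vertex D' a = unmarked_vertex D a.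
Proof.
have [_ V M _] := rD; rewrite /unmarked_vertex V inE.
case: (boolP (a \in [set x; y])) => [axy|axy] /=.
  apply/esym/negbTE; rewrite negb_and negbK; apply/orP; right; apply/existsP.
  case/set2P: axy => ->; first by exists y.
  by exists x; rewrite madjC.
congr (_ && ~~ _); apply: eq_existsb => b; rewrite M axy /=.
by case: (boolP (madj D a b)) => [/madj_end <-|]; rewrite ?andbF ?axy.
Qed.

Lemma unmarked_notin a : unmarked_vertex D a -> a \notin [set x; y].
Proof.
move=> ua; apply/negP => /set2P[] e; rewrite e in ua; first by have := xy; rewrite (unmarkedN _ ua).
by have := yx; rewrite (unmarkedN _ ua).
Qed.

(** A side of another marked edge contains both of [x], [y] or neither, so the unmarked edges
    created across [xy] do not leave it. *)
Lemma wf_recomposes : {subset marked D' <= edges D'} -> wf D'.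
Proof.
have [_ V M E] := rD.
move=> sub; split=> //.
  move=> a b c; rewrite !M => /and3P[_ _ ab] /and3P[_ _]; exact: wf_matching ab.
move=> a b; rewrite M => /and3P[axy bxy ab].
have [S sS] := wf_side wfD ab; exists S; case: (sS) => aS bS cr; split=> // c d.
have abC c0 d0 : uadj D c0 d0 -> (c0 \in S) = (d0 \in S) by exact: side_uadj ab sS.
have xyS : x \in S -> y \notin S -> False.
  move=> xS yS; have [xa _] := cr _ _ (madj_adj xy) xS yS.
  by rewrite -xa !inE eqxx in axy.
have yxS : y \in S -> x \notin S -> False.
  move=> yS xS; have [ya _] := cr _ _ (madj_adj yx) yS xS.
  by rewrite -ya !inE eqxx orbT in axy.
rewrite adj_mu M E => /orP[/and3P[_ _ cd]|/and3P[_ _ /or3P[cd|/andP[cx yd]|/andP[cx yd]]]].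
- exact: cr (madj_adj cd).
- exact: cr (uadj_adj cd).
- by rewrite (abC _ _ cx) -(abC _ _ yd) => xS yS; case: xyS.
- by rewrite (abC _ _ cx) -(abC _ _ yd) => xS yS; case: yxS.
Qed.

Lemma hopx d : hop D x d = uadj D y d.
Proof. exact: hopE. Qed.

Lemma hopy d : hop D y d = uadj D x d.
Proof. exact: hopE. Qed.

Lemma uadj_xyF : uadj D x y = false. Proof. exact: madj_uadj. Qed.
Lemma uadj_yxF : uadj D y x = false. Proof. exact: madj_uadj. Qed.

Lemma hop_end_notin v w : v \in [set x; y] -> hop D v w -> w \notin [set x; y].
Proof.
move=> + + ; rewrite set2N => /set2P[]->; rewrite ?hopx ?hopy => h; apply/andP; split;
 by apply: contraTneq h => ->; rewrite ?uadj_irr ?uadj_xyF ?uadj_yxF.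
Qed.

(** A hop over an unmarked edge created across [xy] is two hops of [D], the first of which ends in
    [x] or [y]; conversely two such consecutive hops merge into one. *)
Lemma connect_hop_recomposes v w : v \notin [set x; y] -> w \notin [set x; y] ->
  connect (hop D') v w = connect (hop D) v w.
Proof.
have [_ V M E] := rD.
move=> vxy wxy; apply/idP/idP.
  apply: connect_sub => a b /existsP[u /andP[]]; rewrite M E.
  case/and3P=> axy uxy au /and3P[_ bxy /or3P[ub|/andP[ux yb]|/andP[uy xb]]].
  - by apply: connect1; apply/existsP; exists u; rewrite au.
  - apply: (@connect_trans _ _ x); apply: connect1; last by rewrite hopx.
    by apply/existsP; exists u; rewrite au.
  - apply: (@connect_trans _ _ y); apply: connect1; last by rewrite hopy.
    by apply/existsP; exists u; rewrite au.
case/connectP => p; elim: {p}(size p) {-2}p (leqnn (size p)) v vxy => [|n IH] [|d p] //=.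
- by move=> _ v _ _ ->.
- by move=> _ v _ _ ->.
rewrite ltnS => sz v vxy /andP[vd dp] wl.
have /existsP[u /andP[vu ud]] := vd.
have uxy : u \notin [set x; y] by rewrite -(madj_end vu).
case: (boolP (d \in [set x; y])) => dxy; last first.
  apply: connect_trans (connect1 _) (IH p sz d dxy dp wl).
  by apply/existsP; exists u; rewrite M E vxy uxy dxy vu ud.
case: p sz dp wl => [|e p] /= sz; first by move=> _ e; rewrite e dxy in wxy.
case/andP=> de ep wl; have exy := hop_end_notin dxy de.
apply: connect_trans (connect1 _) (IH p (ltnW sz) e exy ep wl).
apply/existsP; exists u; rewrite M E vxy uxy exy vu /=.
by case/set2P: dxy ud de => ->; rewrite ?hopx ?hopy => -> ->; rewrite ?orbT.
Qed.

Lemma connect_hop_first v w : connect (hop D) v w -> v != w ->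
  exists2 d, hop D v d & connect (hop D) d w.
Proof.
case/connectP=> -[|d p] /=; first by move=> _ ->; rewrite eqxx.
by case/andP=> vd dp wl _; exists d => //; apply/connectP; exists p.
Qed.

Lemma linked_recomposes a b : a \notin [set x; y] -> b \notin [set x; y] ->
  linked D' a b = linked D a b.
Proof.
have [_ V M E] := rD.
move=> axy bxy; apply/existsP/existsP => -[w /andP[aw wb]].
  have wxy : w \notin [set x; y] by move: aw; rewrite E => /and3P[].
  rewrite connect_hop_recomposes // in wb.
  move: aw; rewrite E axy wxy /= => /or3P[aw|/andP[ax yw]|/andP[ay xw]].
  - by exists w; rewrite aw.
  - by exists x; rewrite ax; apply: connect_trans (connect1 _) wb; rewrite hopx.
  - by exists y; rewrite ay; apply: connect_trans (connect1 _) wb; rewrite hopy.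
case: (boolP (w \in [set x; y])) => wxy; last first.
  by exists w; rewrite connect_hop_recomposes // wb andbT E axy wxy aw.
have nwb : w != b by apply: contraNneq bxy => <-.
have [d wd db] := connect_hop_first wb nwb.
have dxy := hop_end_notin wxy wd.
exists d; rewrite connect_hop_recomposes // db andbT E axy dxy /=.
by case/set2P: wxy wd aw => ->; rewrite ?hopx ?hopy => -> ->; rewrite ?orbT.
Qed.

End RecWf.

(** As [xy] is a cut-edge, the other neighbors of [x] and those of [y] lie on different sides with
    no edge between them. Hence the pivot adds exactly all pairs between the two neighborhoods and
    removes nothing outside [xy]. *)
Lemma recomposeP D x y : wf D -> madj D x y ->
  recomposes D x y (recompose D x y) /\ wf (recompose D x y).
Proof.
move=> wfD xy; have yx : madj D y x by rewrite madjC.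
set R := recompose D x y.
have [S sS] := wf_side wfD xy; have [xS yS cr] := sS.
have axy := madj_adj xy.
have crN a b : a \notin [set x; y] -> b \notin [set x; y] ->
    adj D x a -> adj D y b -> (a \in S) && (b \notin S) && ~~ adj D a b.
  rewrite !set2N => /andP[ax ay] /andP[bx by_] xa yb.
  have aS : a \in S.
    by apply: contraT => aS; case: (cr _ _ xa xS aS) => _ e; rewrite e eqxx in ay.
  have bS : b \notin S.
    apply/negP => bS; rewrite adjC in yb; case: (cr _ _ yb bS yS) => e _.
    by rewrite e eqxx in bx.
  rewrite aS bS /=; apply/negP => ab; case: (cr _ _ ab aS bS) => e _.
  by rewrite e eqxx in ax.
have ux a : a \notin [set x; y] -> adj D x a = uadj D x a.
  rewrite set2N adj_mu => /andP[ax ay]; case: (boolP (madj D x a)) => //= xa.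
  by rewrite (wf_matching wfD xa xy) eqxx in ay.
have uy a : a \notin [set x; y] -> adj D y a = uadj D y a.
  rewrite set2N adj_mu => /andP[ax ay]; case: (boolP (madj D y a)) => //= xa.
  by rewrite (wf_matching wfD xa yx) eqxx in ax.
have adjR a b : adj R a b = [&& a \notin [set x; y], b \notin [set x; y] &
    [|| adj D a b, uadj D x a && uadj D y b | uadj D y a && uadj D x b]].
  rewrite adj_induced !in_setC.
  case: (boolP (a \in [set x; y])) => //= nax; case: (boolP (b \in [set x; y])) => //= nbx.
  case: (eqVneq a b) => [<-|ab].
    rewrite !adj_irr /=; apply/esym/negbTE; rewrite -!ux // -!uy // [X in _ || X]andbC orbb.
    by apply/negP => /andP[xa ya]; have := crN _ _ nax nax xa ya; case: (a \in S).
  rewrite adj_pivot // -!ux // -!uy //.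
  have c1 := crN _ _ nax nbx; have c2 := crN _ _ nbx nax; rewrite (adjC D b a) in c2.
  case: (adj D x a) c1 c2 => c1 c2; case: (adj D y b) c1 c2 => c1 c2.
  - have /andP[/andP[aS bS] /negbTE ->] := c1 isT isT.
    by case: (adj D x b) c2 (crN b b) => //= c2 cb; rewrite ?andbF //;
       case: (adj D y a) c2 => // /(_ isT isT); rewrite aS !andbF.
  - case: (adj D x b) c2 => c2; rewrite ?andbF ?orbF ?addbF //.
    case: (adj D y a) c2 => [/(_ isT isT)/andP[_ /negbTE ->] //|_]; by rewrite /= !addbF orbF.
  - case: (adj D x b) c2 => c2; rewrite ?andbF ?orbF ?addbF //.
    case: (adj D y a) c2 => [/(_ isT isT)/andP[_ /negbTE ->] //|_]; by rewrite /= !addbF orbF.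
  - case: (adj D x b) c2 => c2; rewrite ?andbF ?orbF ?addbF //.
    case: (adj D y a) c2 => [/(_ isT isT)/andP[_ /negbTE ->] //|_]; by rewrite /= !addbF orbF.
have mR a b : [set a; b] \in marked R =
    [&& a \notin [set x; y], b \notin [set x; y] & madj D a b].
  rewrite inE subUset !sub1set; apply/andP/and3P.
    case=> ab /andP[]; rewrite !in_setI !in_setC => /andP[_ ->] /andP[_ ->]; split=> //.
    by rewrite /madj ab andbT; apply: wf_edges.
  case=> nax nbx ab; have [aV bV _] := adjP (madj_adj ab).
  rewrite !in_setI !in_setC nax nbx aV bV; split=> //.
  by case/andP: ab.
have rR : recomposes D x y R.
  split=> // [|a b|a b].
  - by apply/setP => z; rewrite !inE andbC.
  - rewrite {1}/madj mR adjR; case: (a \in _) => //=; case: (b \in _) => //=.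
    by rewrite adj_mu; case: (madj D a b); rewrite ?andbF.
  rewrite {1}/uadj mR adjR; case: (boolP (a \in _)) => //= nax; case: (boolP (b \in _)) => //= nbx.
  rewrite adj_mu (uadjC D a x) (uadjC D a y).
  case: (boolP (madj D a b)) => [ab|] /=; last by rewrite andbT.
  rewrite (madj_uadj ab) /=; apply/esym/negbTE; rewrite -!ux // -!uy // negb_or.
  apply/andP; split; apply/andP => -[c1 c2].
    by have := crN _ _ nax nbx c1 c2; rewrite (madj_adj ab) andbF.
  by have := crN _ _ nbx nax c2 c1; rewrite adjC (madj_adj ab) andbF.
split=> //; apply: (wf_recomposes wfD rR) => e eR.
have eD : e \in marked D by move: eR; rewrite inE => /andP[].
have [a [b [eab _]]] := edge_adj (wf_edges wfD eD); subst e.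
have := mR a b; rewrite eR => /esym/and3P[nax nbx abm].
by have := adjR a b; rewrite nax nbx (madj_adj abm) /= /adj => ->.
Qed.

Lemma no_madj_hop D : (forall a b, madj D a b = false) ->
  forall a b, connect (hop D) a b = (a == b).
Proof.
move=> nm a b; apply/idP/eqP => [|->]; last exact: connect0.
case/connectP=> -[|d p] //= /andP[/existsP[u /andP[]]]; by rewrite nm.
Qed.

Lemma no_madj_linked D : (forall a b, madj D a b = false) ->
  forall a b, linked D a b = adj D a b.
Proof.
move=> nm a b; apply/existsP/idP => [[w /andP[]]|ab].
  by rewrite no_madj_hop // => aw /eqP <-; apply: uadj_adj.
by exists b; rewrite connect0 andbT; move: ab; rewrite adj_mu nm.
Qed.

(** Every recomposition preserves linkedness, and once no marked edge is left linkedness is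
    adjacency. The fold meets every ordered pair and never creates a marked edge. *)
Lemma recompose_allP D : wf D ->
  verts (recompose_all D) = [set a | unmarked_vertex D a] /\
  {in unmarked_vertex D &, forall a b, adj (recompose_all D) a b = linked D a b}.
Proof.
move=> wfD; rewrite /recompose_all.
set f := fun _ _ => _.
suff main : forall s D0, wf D0 ->
    [/\ wf (foldl f D0 s), unmarked_vertex (foldl f D0 s) =1 unmarked_vertex D0,
       {in unmarked_vertex D0 &, linked (foldl f D0 s) =2 linked D0},
       (forall a b, madj (foldl f D0 s) a b -> madj D0 a b) &
       (forall p, p \in s -> madj (foldl f D0 s) p.1 p.2 = false)].
  have [wfE uE lE mE nE] := main (enum {: U * U}) D wfD.
  have nm a b : madj (foldl f D (enum {: U * U})) a b = false.
    by apply: (nE (a, b)); rewrite mem_enum.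
  split=> [|a b ua ub]; last by rewrite -no_madj_linked // lE.
  apply/setP => z; rewrite inE -uE /unmarked_vertex.
  case: (z \in _) => //=; apply/esym/existsPn => b; by rewrite nm.
elim=> [|[x y] s IH] D0 wf0; first by split.
rewrite /= {1}/f; rewrite /f /=; case: ifP => xy.
  have [rR wfR] := recomposeP wf0 xy; have [wfE uE lE mE nE] := IH _ wfR.
  have uR := unmarked_recomposes wf0 rR.
  have mR a b : madj (recompose D0 x y) a b -> madj D0 a b.
    by case: rR => _ _ -> _ /and3P[].
  split=> //.
  - by move=> a; rewrite uE uR.
  - move=> a b ua ub; rewrite lE; try by rewrite /in_mem /= uR.
    by rewrite (linked_recomposes wf0 rR) //; exact: (unmarked_notin rR).
  - by move=> a b /mE/mR.
  - move=> p; rewrite inE => /orP[/eqP -> /=|]; last exact: nE.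
    apply/negP => /mE; case: rR => _ _ -> _; by rewrite !inE eqxx.
have [wfE uE lE mE nE] := IH _ wf0.
split=> // p; rewrite inE => /orP[/eqP -> /=|]; last exact: nE.
by apply/negP => /mE; rewrite xy.
Qed.

End Recompose.

(** * Local complementation *)

Section LocalComplement.
Variable U : finType.
Implicit Types (x y v w a b : U) (B T X Y S : {set U}) (D : mgraph U).

Lemma adj_bags D a b : adj (graph_of (verts D) (uadj D)) a b = uadj D a b.
Proof.
rewrite adj_graph_of (uadjC D b) orbb.
by case: (boolP (uadj D a b)) => [/uadj_adj/adjP[-> -> ->]|]; rewrite ?andbF.
Qed.

Lemma adj_bag_graph D B a b :
  adj (bag_graph D B) a b = [&& a \in B, b \in B & uadj D a b].
Proof.
rewrite adj_graph_of (uadjC D b) orbb !inE.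
by case: (boolP (uadj D a b)) => [/uadj_adj/adjP[-> -> ->]|]; rewrite ?andbF ?andbT.
Qed.

Lemma bag_verts D x : x \in verts D -> bag D x \subset verts D.
Proof.
move=> xV; apply/subsetP => y; rewrite inE => xy.
by apply: (connect_verts _ xy xV) => a b /uadj_adj/adjP[-> ->].
Qed.

Lemma bagsP D B : reflect (exists2 x, x \in verts D & B = bag D x) (B \in bags D).
Proof.
have E x : x \in verts D -> component_of (graph_of (verts D) (uadj D)) x = bag D x.
  move=> xV; apply/setP => y; rewrite !inE (eq_connect (@adj_bags D)) /=.
  apply: andb_idl => xy; by have /subsetP := bag_verts xV; apply; rewrite inE.
by apply: (iffP imsetP) => -[x xV ->]; exists x => //; rewrite E.
Qed.

Lemma bag_refl D x : x \in bag D x.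
Proof. by rewrite inE connect0. Qed.

Lemma bag_eq D x y : y \in bag D x -> bag D y = bag D x.
Proof.
rewrite inE => xy; apply/setP => z; rewrite !inE.
by rewrite (same_connect (@connect_uadjC _ D) xy).
Qed.

Lemma uadj_bag D x y : uadj D x y -> y \in bag D x.
Proof. by move=> xy; rewrite inE connect1. Qed.

(* The pairs complemented by D * x. *)
Definition flip D x a b :=
  [exists w, [&& connect (hop D) w x, uadj D w a & uadj D w b]].

Lemma flipP D x a b :
  reflect (exists w, [&& connect (hop D) w x, uadj D w a & uadj D w b]) (flip D x a b).
Proof. exact: existsP. Qed.

Lemma flipC D x a b : flip D x a b = flip D x b a.
Proof. by apply: eq_existsb => w; rewrite [uadj D w a && _]andbC. Qed.

Section Wf.
Variables (D : mgraph U) (x : U) (wfD : wf D) (ux : unmarked_vertex D x).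

Let Dx := mlocal_compl D x.

(** By [rep_uniq] the representative picked in a bag is the only one, so [flip] describes the
    complemented pairs without mentioning bags. *)
Lemma adj_mlocal a b :
  adj Dx a b = madj D a b || ((a != b) && (uadj D a b (+) flip D x a b)).
Proof.
set F := fun a b => uadj D a b (+) flip D x a b.
suff E c d : c != d -> [exists B in bags D,
     if [pick w in B | represents D w x] is Some w
     then adj (local_compl (bag_graph D B) w) c d
     else adj (bag_graph D B) c d] = F c d.
  rewrite adj_graph_of; case: (eqVneq a b) => [<-|ab].
    by rewrite !andbF orbF; apply/esym/negP => /madj_adj; rewrite adj_irr.
  rewrite !E //; last by rewrite eq_sym.
  have -> : F b a = F a b by rewrite /F uadjC flipC.
  rewrite (madjC D b) orbb /=.
  case: (boolP (madj D a b)) => [/madj_adj/adjP[-> -> _] //|_] /=.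
  suff : F a b -> (a \in verts D) && (b \in verts D).
    by rewrite andbA => /andb_idl ->.
  rewrite /F; case: (boolP (uadj D a b)) => [/uadj_adj/adjP[-> -> _] //|_] /= /existsP[w].
  by case/and3P=> _ /uadj_adj/adjP[_ -> _] /uadj_adj/adjP[_ -> _].
move=> cd.
have K z : (if [pick w in bag D z | represents D w x] is Some w
     then adj (local_compl (bag_graph D (bag D z)) w) c d
     else adj (bag_graph D (bag D z)) c d) = [&& c \in bag D z, d \in bag D z & F c d].
  case: pickP => [w /andP[wB rw]|nrep].
    rewrite adj_local_compl cd !adj_bag_graph wB /=.
    case: (boolP (c \in bag D z)) => //= cB; case: (boolP (d \in bag D z)) => //= dB;
      rewrite ?andbF // /F.
    suff -> : flip D x c d = uadj D w c && uadj D w d by [].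
    apply/flipP/andP => [[w' /and3P[w'x w'c w'd]]|[wc wd]].
      suff <- : w' = w by [].
      move: rw wB cB; rewrite !inE representsE // => /andP[_ wx] zw zc.
      apply: (rep_uniq wfD _ ux w'x wx); apply: (connect_trans (connect1 w'c)).
      by apply: (@connect_trans _ _ z) => //; rewrite connect_uadjC.
    by exists w; rewrite wc wd !andbT; move: rw; rewrite representsE // => /andP[].
  rewrite adj_bag_graph /F; case: (boolP (c \in bag D z)) => //= cB.
  case: (boolP (d \in bag D z)) => //= dB.
  suff -> : flip D x c d = false by rewrite addbF.
  case: flipP => // -[w /and3P[wx wc wd]]; exfalso.
  have := nrep w; rewrite representsE // ux wx andbT => /negP; apply.
  by rewrite -(bag_eq cB) uadj_bag // uadjC.
apply/existsP/idP => [[B /andP[/bagsP[z zV ->{B}]]]|Fcd].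
  by rewrite K => /and3P[].
exists (bag D c); rewrite K Fcd andbT bag_refl /=.
move: Fcd; rewrite /F; case: (boolP (uadj D c d)) => [cd' _|_ /flipP[w /and3P[_ wc wd]]].
  rewrite uadj_bag // andbT; apply/bagsP; exists c => //.
  by case/adjP: (uadj_adj cd').
rewrite (bag_eq (uadj_bag wc)) uadj_bag // andbT; apply/bagsP; exists w => //.
by case/adjP: (uadj_adj wc).
Qed.

Lemma marked_madj a b : ([set a; b] \in marked D) = madj D a b.
Proof.
by apply/idP/andP => [ab|[] //]; split=> //; apply: (wf_edges wfD).
Qed.

Lemma madj_mlocal a b : madj Dx a b = madj D a b.
Proof.
rewrite {1}/madj adj_mlocal (marked_madj a b).
by case: (madj D a b); rewrite ?andbF.
Qed.

Lemma flip_bag a b : flip D x a b -> connect (uadj D) a b.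
Proof.
case/flipP=> w /and3P[_ wa wb].
by apply: (connect_trans (y := w)); apply: connect1; rewrite // uadjC.
Qed.

Lemma uadj_mlocal a b : uadj Dx a b = (a != b) && (uadj D a b (+) flip D x a b).
Proof.
rewrite {1}/uadj adj_mlocal (marked_madj a b).
case: (boolP (madj D a b)) => ab /=; last by rewrite andbT.
rewrite (madj_uadj ab) /=; apply/esym/negbTE; rewrite negb_and orbC.
by apply/orP; left; apply/negP => /flip_bag; apply: madj_bag wfD _ _ ab.
Qed.

Lemma wf_mlocal : wf Dx.
Proof.
split=> [e eM|a b c|a b]; rewrite ?madj_mlocal.
- have [a [b [E ab]]] := edge_adj (wf_edges wfD eM).
  have : madj Dx a b by rewrite madj_mlocal -marked_madj -E.
  by move/madj_adj; rewrite /adj E.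
- exact: wf_matching.
move=> ab; have [S [aS bS cr]] := wf_side wfD ab; exists S; split=> // c d.
rewrite adj_mu madj_mlocal uadj_mlocal => /orP[/madj_adj|/andP[_]]; first exact: cr.
move=> F cS dS; suff /(side_bag ab (And3 aS bS cr)) : connect (uadj D) c d.
  by rewrite cS (negbTE dS).
move: F; case: (boolP (uadj D c d)) => [/connect1 //|_]; exact: flip_bag.
Qed.

Lemma unmarked_mlocal a : unmarked_vertex Dx a = unmarked_vertex D a.
Proof. by congr (_ && ~~ _); apply: eq_existsb => b; rewrite madj_mlocal. Qed.

End Wf.

Section Commute.
Variables (D D' : mgraph U) (x : U) (wfD : wf D) (wfD' : wf D').
Hypothesis ux : unmarked_vertex D x.

Section Case.
Variables (u v : U) (S : {set U}).
Hypotheses (rD : recomposes D u v D') (sS : side D u v S).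

Let uv : madj D u v. Proof. by case: rD. Qed.
Let vu : madj D v u. Proof. by rewrite madjC. Qed.
Let E a b : a \notin [set u; v] -> b \notin [set u; v] -> uadj D' a b =
  [|| uadj D a b, uadj D a u && uadj D v b | uadj D a v && uadj D u b].
Proof. by move=> au bu; case: rD => _ _ _ ->; rewrite au bu. Qed.
Let sE a b : uadj D a b -> (a \in S) = (b \in S).
Proof. exact: side_uadj uv sS. Qed.
Let uS : u \in S. Proof. by case: sS. Qed.
Let vS : v \in S = false. Proof. by case: sS => _ /negbTE. Qed.
Let xN : x \notin [set u; v]. Proof. exact: (unmarked_notin rD). Qed.

Let uadj_sF a b : a \in S -> b \notin S -> uadj D a b = false.
Proof. by move=> aS bS; apply: contraNF bS => /sE <-. Qed.
Let uadj_sF' a b : a \in S -> b \notin S -> uadj D b a = false.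
Proof. by rewrite uadjC; apply: uadj_sF. Qed.

Let E1 a b : a \notin [set u; v] -> b \notin [set u; v] -> a \in S -> b \in S ->
  uadj D' a b = uadj D a b.
Proof.
move=> aN bN aS bS; rewrite E // (@uadj_sF' b v) ?vS // (@uadj_sF a v) ?vS //.
by rewrite andbF !orbF.
Qed.

Let E2 a b : a \notin [set u; v] -> b \notin [set u; v] -> a \in S -> b \notin S ->
  uadj D' a b = uadj D a u && uadj D v b.
Proof.
move=> aN bN aS bS; rewrite E // (uadj_sF aS bS) (@uadj_sF a v) ?vS //.
by rewrite orbF.
Qed.

Let rep_end w : connect (hop D) w x -> w \in [set u; v] ->
  exists d, [/\ hop D w d, connect (hop D) d x & d \notin [set u; v]].
Proof.
move=> wx wN; have nwx : w != x by apply: contraNneq xN => <-.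
have [d wd dx] := connect_hop_first wx nwx.
by exists d; split=> //; apply: (hop_end_notin wfD rD wN wd).
Qed.

(** A representative beyond the marked edge acts on this side through [u], which represents [x] in
    [D] by one more hop; conversely, if [u] does so, its next hop is a representative in [D']. *)
Lemma flip_same a b : a \notin [set u; v] -> b \notin [set u; v] ->
  a \in S -> b \in S -> flip D' x a b = flip D x a b.
Proof.
move=> aN bN aS bS; apply/flipP/flipP => -[w /and3P[wx wa wb]].
  have wN : w \notin [set u; v] by case: rD => _ _ _ e; move: wa; rewrite e => /and3P[].
  rewrite (connect_hop_recomposes wfD rD) // in wx.
  case: (boolP (w \in S)) => wS.
    by exists w; move: wa wb; rewrite !E1 // wx => -> ->.
  move: wa wb; rewrite ![uadj D' w _]uadjC !E2 // => /andP[au vw] /andP[bu _].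
  exists u; rewrite ![uadj D u _]uadjC au bu !andbT.
  by apply: connect_trans (connect1 _) wx; rewrite (hopx wfD rD).
have wS : w \in S by rewrite (sE wa).
case: (boolP (w \in [set u; v])) => wN; last first.
  by exists w; rewrite (connect_hop_recomposes wfD rD) // !E1 // wx wa.
have wu : w = u by case/set2P: wN => // wv; rewrite wv vS in wS.
subst w; have [d [ud dx dN]] := rep_end wx wN.
rewrite (hopx wfD rD) in ud; have dS : d \notin S by rewrite -(sE ud) vS.
exists d; rewrite (connect_hop_recomposes wfD rD) // dx.
by rewrite ![uadj D' d _]uadjC !E2 // ![uadj D _ u]uadjC wa wb ud.
Qed.

Lemma flip_cross a b : a \notin [set u; v] -> b \notin [set u; v] ->
  a \in S -> b \notin S -> flip D' x a b =
  flip D x a u && uadj D v b || uadj D a u && flip D x v b.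
Proof.
move=> aN bN aS bS; apply/flipP/orP => [[w /and3P[wx wa wb]]|].
  have wN : w \notin [set u; v] by case: rD => _ _ _ e; move: wa; rewrite e => /and3P[].
  rewrite (connect_hop_recomposes wfD rD) // in wx.
  case: (boolP (w \in S)) => wS.
    left; move: wa wb; rewrite E1 // E2 // => wa /andP[wu ->]; rewrite andbT.
    by apply/flipP; exists w; rewrite wx wa.
  right; move: wa wb; rewrite uadjC E2 // => /andP[-> vw].
  rewrite E // (uadj_sF' uS wS) (uadj_sF uS bS) andbF !orbF => wb.
  by apply/flipP; exists w; rewrite wx uadjC vw.
case=> [/andP[/flipP[w /and3P[wx wa wu]] vb]|/andP[au /flipP[w /and3P[wx wv wb]]]].
  have wS : w \in S by rewrite (sE wa).
  have wN : w \notin [set u; v].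
    rewrite set2N; apply/andP; split; first by apply: contraTneq wu => ->; rewrite uadj_irr.
    by apply: contraTneq wS => ->; rewrite vS.
  by exists w; rewrite (connect_hop_recomposes wfD rD) // wx E1 // E2 // wa wu.
have wS : w \notin S by rewrite (sE wb).
have wN : w \notin [set u; v].
  rewrite set2N; apply/andP; split; first by apply: contraNneq wS => ->.
  by apply: contraTneq wv => ->; rewrite uadj_irr.
exists w; rewrite (connect_hop_recomposes wfD rD) // wx uadjC E2 // au uadjC wv.
by rewrite E // wb.
Qed.

(** The first condition has a representative of [x] adjacent to [u], the second makes [u] itself
    one, in the same bag. So the disjunction in [flip_cross] is exclusive and agrees with the sum in
    [mlocal_compl]. *)
Lemma flip_excl a b : flip D x a u -> flip D x v b -> False.
Proof.
case/flipP=> w /and3P[wx _ wu] /flipP[w' /and3P[w'x w'v _]].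
have ux' : connect (hop D) u x.
  by apply: connect_trans (connect1 _) w'x; rewrite (hopx wfD rD) uadjC.
have := rep_uniq wfD (connect1 wu) ux wx ux'; move=> e.
by rewrite e uadj_irr in wu.
Qed.

Let Dx := mlocal_compl D x.

Lemma side_mlocal : side Dx u v S.
Proof.
case: sS => uS' vS' cr; split=> // c d.
rewrite adj_mu madj_mlocal // uadj_mlocal // => /orP[/madj_adj|/andP[_]]; first exact: cr.
move=> F cS dS; suff /(side_bag uv sS) : connect (uadj D) c d.
  by rewrite cS (negbTE dS).
move: F; case: (boolP (uadj D c d)) => [/connect1 //|_]; exact: flip_bag.
Qed.

Lemma uadj_commute a b : a \notin [set u; v] -> b \notin [set u; v] -> a \in S ->
  uadj (mlocal_compl D' x) a b =
  [|| uadj Dx a b, uadj Dx a u && uadj Dx v b | uadj Dx a v && uadj Dx u b].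
Proof.
move=> aN bN aS.
have ux' : unmarked_vertex D' x by rewrite (unmarked_recomposes wfD rD).
have uvx : madj Dx u v by rewrite madj_mlocal.
have sx c d : uadj Dx c d -> (c \in S) = (d \in S).
  exact: side_uadj uvx side_mlocal.
rewrite uadj_mlocal //; case: (boolP (b \in S)) => bS.
  have -> : uadj Dx v b = false by apply/negP => /sx; rewrite vS bS.
  have -> : uadj Dx a v = false by apply/negP => /sx; rewrite vS aS.
  by rewrite andbF !orbF uadj_mlocal // E1 // flip_same.
have -> : uadj Dx a b = false by apply/negP => /sx; rewrite aS (negbTE bS).
have -> : uadj Dx a v = false by apply/negP => /sx; rewrite vS aS.
have ab : a != b by apply: contraNneq bS => <-.
move: (aN) (bN); rewrite !set2N => /andP[au av] /andP[bu bv].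
rewrite orbF ab /= !uadj_mlocal // au (eq_sym v) bv /= E2 // flip_cross //.
case: (boolP (flip D x a u)) => [f1|_]; case: (boolP (flip D x v b)) => [f2|_] /=.
- by case: (flip_excl f1 f2).
all: by case: (uadj D a u); case: (uadj D v b).
Qed.

End Case.

(** Local complementation commutes with recomposing a marked edge; pairs starting on the other side
    of [uv] follow by exchanging [u] and [v]. *)
Lemma recomposes_mlocal u v : recomposes D u v D' ->
  recomposes (mlocal_compl D x) u v (mlocal_compl D' x).
Proof.
move=> rD; have [uv V M E] := rD.
have ux' : unmarked_vertex D' x by rewrite (unmarked_recomposes wfD rD).
split=> // [|a b|a b]; rewrite ?madj_mlocal //.
have rD' := recomposesC rD.
case: (boolP (a \in [set u; v])) => [aN|aN] /=.
  rewrite uadj_mlocal // E aN /=; apply/negP => /andP[_ /flipP[w /and3P[_ wa _]]].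
  by move: wa; rewrite E aN andbF.
case: (boolP (b \in [set u; v])) => [bN|bN] /=.
  rewrite uadj_mlocal // E bN andbF /=; apply/negP => /andP[_ /flipP[w /and3P[_ _ wb]]].
  by move: wb; rewrite E bN andbF.
have [S sS] := wf_side wfD uv.
case: (boolP (a \in S)) => aS; first exact: (uadj_commute rD sS).
have aS' : a \in ~: S by rewrite inE.
rewrite (uadj_commute rD' (side_sym sS)) 1?set2C //.
by congr (_ || _); rewrite orbC.
Qed.

End Commute.

(** Recomposing one marked edge changes neither side of the equation, so induction leads to a graph
    without marked edges, where [x] is its only representative and the formula is that of local
    complementation. *)
Lemma linked_mlocal D x a b : wf D -> unmarked_vertex D x ->
  unmarked_vertex D a -> unmarked_vertex D b -> a != b ->
  linked (mlocal_compl D x) a b = linked D a b (+) (linked D x a && linked D x b).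
Proof.
elim: {D}#|verts D| {-2}D (leqnn #|verts D|) => [|n IH] D sz wfD ux ua ub ab.
  have xV := unmarked_verts ux.
  by move: sz; rewrite leqn0 => /eqP/cards0_eq e; rewrite e inE in xV.
case: (boolP [exists u, exists v, madj D u v]) => [/existsP[u /existsP[v uv]]|nm].
  have [rD wfR] := recomposeP wfD uv; set R := recompose D u v in rD wfR.
  have rDx := recomposes_mlocal wfD wfR ux rD.
  have uR := unmarked_recomposes wfD rD.
  have uN c : unmarked_vertex D c -> c \notin [set u; v] by apply: unmarked_notin rD _.
  rewrite -(linked_recomposes (wf_mlocal wfD ux) rDx) ?uN //.
  rewrite -!(linked_recomposes wfD rD) ?uN //; apply: IH; rewrite ?uR //.
  rewrite -ltnS; apply: leq_trans sz; apply: proper_card; case: rD => _ -> _ _.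
  have [uV _ _] := adjP (madj_adj uv).
  by rewrite properEneq subsetDl andbT; apply: contraTneq uV => <-; rewrite !inE eqxx.
have {}nm u v : madj D u v = false.
  by apply: contraNF nm => uv; apply/existsP; exists u; apply/existsP; exists v.
have nmx u v : madj (mlocal_compl D x) u v = false by rewrite madj_mlocal.
have au c d : adj D c d = uadj D c d by rewrite adj_mu nm.
rewrite !no_madj_linked // adj_mlocal // nm ab /= !au; congr (_ (+) _).
apply/flipP/andP => [[w]|[xa xb]].
  by rewrite no_madj_hop // => /and3P[/eqP -> -> ->].
by exists x; rewrite no_madj_hop // eqxx xa.
Qed.

End LocalComplement.

(** * Refinement *)

Section Branches.
Variable U : finType.
Implicit Types (x y v w a b c d m : U) (B T X Y S : {set U}) (D : mgraph U).

Definition nobag D B : rel U :=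
  fun a c => adj D a c && ~~ [&& uadj D a c, a \in B & c \in B].

(* The part of D hanging at the vertex b of its bag, including b itself. *)
Definition branch D b : {set U} := [set c | connect (nobag D (bag D b)) b c].

Lemma nobagC D B a c : nobag D B a c = nobag D B c a.
Proof. by rewrite /nobag adjC uadjC [(a \in B) && _]andbC. Qed.

Lemma branch_refl D b : b \in branch D b.
Proof. by rewrite inE connect0. Qed.

Section Wf.
Variables (D : mgraph U) (wfD : wf D).

(** The set [b |: S] is closed under edges outside the bag of [b]: the only edge leaving [S] ends in
    [b], and the only such edge at [b] is its marked edge. *)
Lemma branch_sub_side b m S : madj D b m -> side D m b S -> branch D b \subset b |: S.
Proof.
move=> bm sS; have mb : madj D m b by rewrite madjC.
apply/subsetP => c; rewrite inE => bc.
suff cl : closed (nobag D (bag D b)) (b |: S).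
  by rewrite -(closed_connect cl bc) setU11.
apply: intro_closed; first by apply: sym_connect_sym => u v; rewrite nobagC.
move=> u v /andP[uv nb] /setU1P[ub|uS].
  subst u; move: uv; rewrite adj_mu => /orP[bv|bv].
    by rewrite (wf_matching wfD bv bm); case: sS => mS _ _; rewrite !inE mS orbT.
  by rewrite bv bag_refl (uadj_bag bv) in nb.
case: (boolP (v \in S)) => vS; first by rewrite setU1r.
by case: sS => _ _ /(_ _ _ uv uS vS)[_ ->]; rewrite setU11.
Qed.

Lemma branch_bag b c : c \in bag D b -> c \in branch D b -> c = b.
Proof.
rewrite [in X in X -> _]inE => bc cW.
case: (boolP [exists m, madj D b m]) => [/existsP[m bm]|nm].
  have mb : madj D m b by rewrite madjC.
  have [S sS] := wf_side wfD mb.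
  have /subsetP/(_ c cW)/setU1P[//|] := branch_sub_side bm sS.
  by rewrite -(side_bag mb sS bc); case: sS => _ /negbTE ->.
move: cW; rewrite inE => /connectP[[|d p]] //= /andP[/andP[bd nb] _] _.
move: bd; rewrite adj_mu => /orP[bd|bd]; first by case/existsP: nm; exists d.
by rewrite bd bag_refl (uadj_bag bd) in nb.
Qed.

Lemma branch_uniq b b' c : b' \in bag D b -> c \in branch D b -> c \in branch D b' ->
  b = b'.
Proof.
move=> bb'; rewrite inE => bc; rewrite inE (bag_eq bb') => b'c.
apply/esym/branch_bag => //; rewrite inE; apply: connect_trans bc _.
by rewrite (@sym_connect_sym _ (nobag D (bag D b))) // => u v; rewrite nobagC.
Qed.

Lemma branch_step b c d : c \in branch D b -> adj D c d ->
  ~~ [&& uadj D c d, c \in bag D b & d \in bag D b] -> d \in branch D b.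
Proof.
move=> bc cd nb; rewrite inE in bc.
by rewrite inE; apply: connect_trans bc (connect1 _); rewrite /nobag cd.
Qed.

Lemma branch_verts b : b \in verts D -> branch D b \subset verts D.
Proof.
move=> bV; apply/subsetP => c; rewrite inE => bc.
by apply: (connect_verts _ bc bV) => u v /andP[/adjP[-> ->]].
Qed.

End Wf.
End Branches.

Section Refinement.
Variable U : finType.
Implicit Types (x y v w a b c d : U) (B T X Y S : {set U}) (D : mgraph U) (G : graph U).

(** What the rest of the proof retains of a split decomposition. The last clause provides the second
    and third positions of a bag that the rank formula needs. *)
Record decomposes G D : Prop := Decomposes {
  dec_wf : wf D;
  dec_verts : verts G = [set a | unmarked_vertex D a];
  dec_adj : {in unmarked_vertex D &, forall a b, adj G a b = linked D a b};
  dec_connected : {in verts D &, forall a b, connect (adj D) a b};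
  dec_bag : forall x y, madj D x y -> 2 < #|bag D x| }.

(** * One refinement step *)

Section Step.
Variables (D D1 : mgraph U) (z x' y' : U) (X Y X' Y' : {set U}).
Hypotheses (wfD : wf D) (zV : z \in verts D).
Let B := bag D z.
Hypotheses (XY : X :|: Y = B) (dXY : [disjoint X & Y]) (X2 : 1 < #|X|) (Y2 : 1 < #|Y|).
Hypotheses (X'X : X' \subset X) (Y'Y : Y' \subset Y) (X'0 : X' != set0) (Y'0 : Y' != set0).
Hypothesis cross : forall x y, x \in X -> y \in Y -> uadj D x y = (x \in X') && (y \in Y').
Hypotheses (x'V : x' \notin verts D) (y'V : y' \notin verts D) (x'y' : x' != y').
Hypothesis V1 : verts D1 = verts D :|: [set x'; y'].
Hypothesis M1 : forall a b, madj D1 a b =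
  [|| madj D a b, (a == x') && (b == y') | (a == y') && (b == x')].
Hypothesis E1 : forall a b, uadj D1 a b =
  [|| uadj D a b && ~~ (((a \in X) && (b \in Y)) || ((a \in Y) && (b \in X))),
      (a == x') && (b \in X'), (b == x') && (a \in X'),
      (a == y') && (b \in Y') | (b == y') && (a \in Y')].
Hypothesis mk1 : {subset marked D1 <= edges D1}.

Let sX : {subset X <= B}. Proof. by move=> a aX; rewrite -XY inE aX. Qed.
Let sY : {subset Y <= B}. Proof. by move=> a aX; rewrite -XY inE aX orbT. Qed.
Let BV : {subset B <= verts D}. Proof. by apply/subsetP/bag_verts. Qed.
Let sX' : {subset X' <= X}. Proof. exact/subsetP. Qed.
Let sY' : {subset Y' <= Y}. Proof. exact/subsetP. Qed.
Let XnY a : a \in X -> a \in Y -> False.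
Proof. by move=> aX aY; rewrite (disjointFr dXY aX) in aY. Qed.

Let old_neq a : a \in verts D -> (a == x') = false /\ (a == y') = false.
Proof.
by move=> aV; split; [apply: contraNF x'V | apply: contraNF y'V] => /eqP <-.
Qed.

Let madj1 : madj D1 x' y'.
Proof. by rewrite M1 !eqxx orbT. Qed.

Let nx c : uadj D x' c = false.
Proof. by apply: contraNF x'V => /uadj_adj/adjP[]. Qed.
Let ny c : uadj D y' c = false.
Proof. by apply: contraNF y'V => /uadj_adj/adjP[]. Qed.

Let Eold a b : a \in verts D -> b \in verts D -> uadj D1 a b =
  uadj D a b && ~~ (((a \in X) && (b \in Y)) || ((a \in Y) && (b \in X))).
Proof.
move=> /old_neq[ax ay] /old_neq[bx by_].
by rewrite E1 ax ay bx by_ /= !orbF.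
Qed.

Let Ex a : uadj D1 a x' = (a \in X').
Proof.
rewrite E1 eqxx (uadjC D a x') nx (negbTE x'y') /=.
have -> : (x' \in X') = false by apply: contraNF x'V => /sX'/sX/BV.
have -> : (x' \in Y') = false by apply: contraNF x'V => /sY'/sY/BV.
by rewrite !andbF /= orbF.
Qed.

Let Ey a : uadj D1 a y' = (a \in Y').
Proof.
rewrite E1 eqxx (uadjC D a y') ny (eq_sym y') (negbTE x'y') /=.
have -> : (y' \in X') = false by apply: contraNF y'V => /sX'/sX/BV.
have -> : (y' \in Y') = false by apply: contraNF y'V => /sY'/sY/BV.
by rewrite !andbF.
Qed.

(** Refinement is undone by recomposing the new marked edge; thus the facts on recomposition show
    that a step preserves linkedness and unmarked vertices. *)
Lemma refine_recomposes : recomposes D1 x' y' D.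
Proof.
have oldN a : a \in verts D -> a \notin [set x'; y'].
  by move=> /old_neq[e1 e2]; rewrite set2N e1 e2.
split=> // [|a b|a b].
- apply/setP => a; rewrite V1 !inE; case: (boolP (a \in verts D)) => [/old_neq[-> ->] //|_].
  by case: (a == x'); case: (a == y').
- rewrite M1; case: (boolP (madj D a b)) => [/madj_adj/adjP[aV bV _]|_].
    by rewrite !oldN.
  by rewrite !set2N; case: (eqVneq a x') => //= _; case: (eqVneq a y') => //= _; rewrite andbF.
have out c d : c \notin verts D -> c \notin [set x'; y'] -> uadj D1 c d = false.
  move=> cV; rewrite set2N => /andP[/negbTE n1 /negbTE n2].
  have -> : uadj D1 c d = uadj D c d &&
      ~~ (((c \in X) && (d \in Y)) || ((c \in Y) && (d \in X))).
    have cX' : (c \in X') = false by apply: contraNF cV => /sX'/sX/BV.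
    have cY' : (c \in Y') = false by apply: contraNF cV => /sY'/sY/BV.
    by rewrite E1 n1 n2 cX' cY' !andbF !orbF.
  by apply: contraNF cV => /andP[/uadj_adj/adjP[]].
case: (boolP (a \in verts D)) => aV; last first.
  rewrite (_ : uadj D a b = false); last by apply: contraNF aV => /uadj_adj/adjP[].
  by case: (boolP (a \in _)) => //= aN; rewrite !(out a) ?andbF.
case: (boolP (b \in verts D)) => bV; last first.
  rewrite (_ : uadj D a b = false); last by apply: contraNF bV => /uadj_adj/adjP[].
  case: (boolP (b \in _)) => bN; rewrite ?andbF //.
  by rewrite (uadjC D1 a b) (uadjC D1 y' b) (uadjC D1 x' b) !(out b) ?andbF.
rewrite Ex Ey (uadjC D1 y') (uadjC D1 x') Ex Ey.
rewrite !oldN //= Eold //.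
case: (boolP ((a \in X) && (b \in Y))) => [/andP[aX bY]|n1] /=.
  rewrite andbF cross // (_ : (a \in Y') = false) ?orbF //.
  by apply/negP => /sY'; exact: XnY.
case: (boolP ((a \in Y) && (b \in X))) => [/andP[aY bX]|n2] /=.
  rewrite andbF uadjC cross // (_ : (a \in X') = false) /= 1?andbC //.
  by apply/negP => /sX' aX; exact: (XnY aX).
rewrite andbT (_ : (a \in X') && (b \in Y') = false); last first.
  by apply: contraNF n1 => /andP[/sX' -> /sY' ->].
rewrite (_ : (a \in Y') && (b \in X') = false) ?orbF //.
by apply: contraNF n2 => /andP[/sY' -> /sX' ->].
Qed.

Let adj_x' d : adj D1 x' d = (d == y') || (d \in X').
Proof.
rewrite adj_mu (uadjC D1 x') Ex M1 eqxx (negbTE x'y') /= orbF.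
by rewrite (_ : madj D x' d = false) //; apply: contraNF x'V => /madj_adj/adjP[].
Qed.

Let adj_y' d : adj D1 y' d = (d == x') || (d \in Y').
Proof.
rewrite adj_mu (uadjC D1 y') Ey M1 eqxx (eq_sym y') (negbTE x'y') /=.
by rewrite (_ : madj D y' d = false) //; apply: contraNF y'V => /madj_adj/adjP[].
Qed.

Let adj_old c d : c \in verts D -> d \in verts D -> adj D1 c d =
  madj D c d || uadj D c d && ~~ (((c \in X) && (d \in Y)) || ((c \in Y) && (d \in X))).
Proof. by move=> cV dV; have [cx cy] := old_neq cV; rewrite adj_mu M1 cx cy orbF Eold. Qed.

Let verts1 c : c \in verts D1 -> [\/ c \in verts D, c = x' | c = y'].
Proof.
rewrite V1 !inE => /orP[|/orP[]/eqP]; first by constructor 1.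
  by constructor 2.
by constructor 3.
Qed.

Let bagB b : b \in B -> bag D b = B.
Proof. exact: bag_eq. Qed.

(** The side of the new edge consists of [x'] and the old branches at [X]; edges between [X] and [Y]
    inside the bag, which would cross it, are gone. *)
Lemma side_new : side D1 x' y' (x' |: \bigcup_(b in X) branch D b).
Proof.
have brV b : b \in X -> {subset branch D b <= verts D}.
  by move=> bX; apply/subsetP/branch_verts/BV/sX.
split.
- exact: setU11.
- rewrite !inE eq_sym negb_or x'y' /=; apply/bigcupP => -[b bX /(brV b bX)].
  by rewrite (negbTE y'V).
move=> c d cd; rewrite !inE => /orP[/eqP cx|/bigcupP[b bX cb]].
  subst c; move: cd; rewrite adj_x' => /orP[/eqP -> //|dX'].
  rewrite negb_or => /andP[_ /bigcupP[]]; exists d; first exact: sX'.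
  exact: branch_refl.
have cV := brV b bX c cb; rewrite negb_or => /andP[dx dS].
have bB := sX bX.
have cB : c \in B -> c = b.
  by move=> cB; apply: (branch_bag wfD) => //; rewrite bagB.
have [dV|dx'|dy'] : [\/ d \in verts D, d = x' | d = y'] by apply: verts1; case/adjP: cd.
- case/negP: dS; move: cd; rewrite adj_old // => cd.
  case: (boolP [&& uadj D c d, c \in bag D b & d \in bag D b]) => [/and3P[uc]|nb].
    rewrite bagB // => /cB cb' dB; subst c; apply/bigcupP.
    move: dB; rewrite -XY => /setUP[dX|dY]; first by exists d => //; apply: branch_refl.
    move: cd; rewrite bX dY /= andbF orbF => /madj_uadj.
    by rewrite uc.
  apply/bigcupP; exists b => //; apply: (branch_step cb) => //.
  by rewrite adj_mu; case/orP: cd => [->//|/andP[-> _]]; rewrite orbT.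
- by rewrite dx' eqxx in dx.
subst d; move: cd; rewrite adjC adj_y' => /orP[/eqP cx|/sY' cY].
  by rewrite cx (negbTE x'V) in cV.
by case: (XnY bX); rewrite -(cB (sY cY)).
Qed.

(** An old side contains the whole split bag or nothing of it; both new markers are put on the side
    of that bag. *)
Lemma side_old a b S : madj D a b -> side D a b S -> exists S', side D1 a b S'.
Proof.
move=> ab sS; pose sg c := if c \in verts D then c \in S else z \in S.
have sB c : c \in B -> (c \in S) = (z \in S).
  by rewrite inE => zc; rewrite (side_bag ab sS zc).
have [aV bV _] := adjP (madj_adj ab).
have [aS bS cr] := sS.
exists [set c | sg c]; split; rewrite ?inE /sg ?aV ?bV //.
move=> c d cd; rewrite !inE.
have [cV1 dV1 _] := adjP cd.
have zx d' : d' \in X' -> (if d' \in verts D then d' \in S else z \in S) = (z \in S).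
  by move=> /sX'/sX dB; rewrite (BV dB) sB.
have zy d' : d' \in Y' -> (if d' \in verts D then d' \in S else z \in S) = (z \in S).
  by move=> /sY'/sY dB; rewrite (BV dB) sB.
have [cV|cx|cy] := verts1 cV1; last first.
- subst c; rewrite (negbTE y'V); move: cd; rewrite adj_y' => /orP[/eqP ->|/zy ->].
    by rewrite (negbTE x'V) => ->.
  by move=> ->.
- subst c; rewrite (negbTE x'V); move: cd; rewrite adj_x' => /orP[/eqP ->|/zx ->].
    by rewrite (negbTE y'V) => ->.
  by move=> ->.
have [cx cy] := old_neq cV.
have [dV|dx|dy] := verts1 dV1.
- rewrite cV dV; apply: cr; rewrite adj_mu; move: cd; rewrite adj_old //.
  by case/orP=> [->//|/andP[-> _]]; rewrite orbT.
- subst d; move: cd; rewrite adjC adj_x' cy /= => /zx ->.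
  by rewrite (negbTE x'V) => ->.
subst d; move: cd; rewrite adjC adj_y' cx /= => /zy ->.
by rewrite (negbTE y'V) => ->.
Qed.

Lemma wf_refine : wf D1.
Proof.
have mV a b : madj D a b -> a \in verts D by move/madj_adj/adjP=> [].
have nm b : madj D x' b = false by apply: contraNF x'V; apply: mV.
have nm' b : madj D y' b = false by apply: contraNF y'V; apply: mV.
split=> // [a b c|a b].
  rewrite !M1 => /or3P[ab|/andP[/eqP-> /eqP->]|/andP[/eqP-> /eqP->]].
  - have [ax ay] := old_neq (mV _ _ ab); rewrite ax ay !orbF.
    exact: wf_matching wfD _ _ _ ab.
  - by rewrite nm eqxx (negbTE x'y') orbF => /eqP ->.
  by rewrite nm' eqxx (eq_sym y') (negbTE x'y') => /eqP ->.
rewrite M1 => /or3P[ab|/andP[/eqP-> /eqP->]|/andP[/eqP-> /eqP->]].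
- by have [S sS] := wf_side wfD ab; apply: side_old ab sS.
- by eexists; apply: side_new.
by eexists; apply: side_sym side_new.
Qed.

(** A removed edge joins [X'] to [Y'] and is replaced by the detour through [x'] and [y']. *)
Lemma connected_refine : {in verts D &, forall a b, connect (adj D) a b} ->
  {in verts D1 &, forall a b, connect (adj D1) a b}.
Proof.
move=> cD; have symD1 : connect_sym (adj D1) by apply: sym_connect_sym => a b; rewrite adjC.
have X'1 b : b \in X' -> connect (adj D1) x' b.
  by move=> bX; rewrite connect1 // adj_x' bX orbT.
have Y'1 b : b \in Y' -> connect (adj D1) y' b.
  by move=> bX; rewrite connect1 // adj_y' bX orbT.
have xy1 : connect (adj D1) x' y' by rewrite connect1 // adj_x' eqxx.
have cross1 a b : a \in X' -> b \in Y' -> connect (adj D1) a b.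
  move=> aX bY; apply: connect_trans (connect_trans xy1 (Y'1 b bY)).
  by rewrite symD1 X'1.
have sub a b : connect (adj D) a b -> connect (adj D1) a b.
  apply: connect_sub => {}a {}b ab; have [aV bV _] := adjP ab.
  case: (boolP (adj D1 a b)) => [/connect1 //|]; rewrite adj_old //.
  move: ab; rewrite adj_mu negb_or; case: (madj D a b) => //= ab; rewrite ab /= negbK.
  case/orP=> /andP[aX bX].
    by move: ab; rewrite cross // => /andP[aX' bX']; apply: cross1.
  by move: ab; rewrite uadjC cross // => /andP[aX' bX']; rewrite symD1; apply: cross1.
have [u uX'] := set0Pn _ X'0; have uV : u \in verts D by apply/BV/sX/sX'.
have tou a : a \in verts D1 -> connect (adj D1) a u.
  move/verts1 => [aV|->|->]; first by apply: sub; apply: cD.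
    exact: X'1.
  by apply: connect_trans (X'1 u uX'); rewrite symD1.
by move=> a b aV bV; apply: connect_trans (tou a aV) _; rewrite symD1 tou.
Qed.

(** A walk inside the old bag from a vertex of [X] to [Y] first leaves [X] from a vertex of [X'], a
    neighbor of [x']. So [X] and [x'] lie in one new bag, with at least three vertices; likewise [Y]
    and [y']. Other bags lose no edge. *)
Lemma bag_refine : (forall a b, madj D a b -> 2 < #|bag D a|) ->
  forall a b, madj D1 a b -> 2 < #|bag D1 a|.
Proof.
move=> bD.
have conn (W W' : {set U}) w c : W :|: W' = B -> 1 < #|W'| ->
    {in W, forall d, d \in W' = false} ->
    {in W &, forall d e, uadj D d e -> uadj D1 d e} ->
    (forall d e, d \in W -> e \in W' -> uadj D d e -> uadj D1 d w) ->
    c \in W -> connect (uadj D1) c w.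
  move=> WW /ltnW/card_gt0P[v vW'] dW inW outW cW.
  have WB d : d \in W -> d \in B by rewrite -WW inE => ->.
  have vB : v \in B by rewrite -WW inE vW' orbT.
  have : connect (uadj D) c v by rewrite -(bagB (WB _ cW)) inE in vB.
  case/connectP=> p; elim: p c cW => [|d p IH] c cW /=.
    by move=> _ e; rewrite e (dW _ cW) in vW'.
  case/andP=> cd dp pl; have : d \in B by rewrite -(bagB (WB _ cW)) uadj_bag.
  rewrite -WW => /setUP[dW'|dW']; last by apply: connect1; apply: outW cd.
  exact: connect_trans (connect1 (inW _ _ cW dW' cd)) (IH d dW' dp pl).
have XF : {in X, forall d, d \in Y = false} by move=> d dX; apply/negP; exact: XnY dX.
have YF : {in Y, forall d, d \in X = false} by move=> d dY; apply/negP => /XnY; apply.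
have cX c : c \in X -> connect (uadj D1) c x'.
  apply: (conn X Y) => // d e dX; first by move=> eX de; rewrite Eold ?BV ?sX // de !XF // andbF.
  by move=> eY; rewrite cross // Ex => /andP[].
have cY c : c \in Y -> connect (uadj D1) c y'.
  apply: (conn Y X) => //; first by rewrite setUC.
    by move=> d e dY eY de; rewrite Eold ?BV ?sY // de !YF // andbF.
  by move=> d e dY eX; rewrite uadjC cross // Ey => /andP[].
have symB1 : connect_sym (uadj D1) by apply: connect_uadjC.
have bX : 2 < #|bag D1 x'|.
  apply: (@leq_trans #|x' |: X|).
    by rewrite cardsU1 (_ : x' \notin X) //; apply: contra x'V => /sX/BV.
  by apply/subset_leq_card/subsetP => c /setU1P[->|cX']; rewrite inE // symB1 cX.
have bY : 2 < #|bag D1 y'|.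
  apply: (@leq_trans #|y' |: Y|).
    by rewrite cardsU1 (_ : y' \notin Y) //; apply: contra y'V => /sY/BV.
  by apply/subset_leq_card/subsetP => c /setU1P[->|cX']; rewrite inE // symB1 cY.
move=> a b; rewrite M1 => /or3P[ab|/andP[/eqP-> _]|/andP[/eqP-> _]] //.
case: (boolP (a \in B)) => [|aB].
  rewrite -XY => /setUP[aX|aY].
    by rewrite (@bag_eq _ D1 x') // inE symB1 cX.
  by rewrite (@bag_eq _ D1 y') // inE symB1 cY.
apply: leq_trans (bD a b ab) _; apply/subset_leq_card/subsetP => c.
have aV : a \in verts D by case/adjP: (madj_adj ab).
rewrite !inE => /connectP[p]; elim: p a aB aV {ab} => [|d p IH] a aB aV /=; first by move=> _ ->.
case/andP=> ad dp cl.
have dB : d \notin B.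
  by apply: contra aB => dB; rewrite -(bagB dB) uadj_bag // uadjC.
have dV : d \in verts D by case/adjP: (uadj_adj ad).
apply: connect_trans (connect1 _) (IH d dB dV dp cl).
rewrite Eold // ad /=; apply: contra aB => /orP[]/andP[]; first by move=> /sX.
by move=> /sY.
Qed.

End Step.

(** Translates the edge sets of [replace_bag] and [simple_decomposition] into the adjacency
    equations [M1] and [E1] on which the preceding section is built. *)
Lemma refine_stepP D D1 : wf D -> refine_step D D1 ->
  exists x' y',
  [/\ recomposes D1 x' y' D, wf D1,
     {in verts D &, forall a b, connect (adj D) a b} ->
       {in verts D1 &, forall a b, connect (adj D1) a b} &
     (forall a b, madj D a b -> 2 < #|bag D a|) ->
       forall a b, madj D1 a b -> 2 < #|bag D1 a| ].
Proof.
move=> wfD [B [X [Y [X' [Y' [x' [y']]]]]]] [/bagsP[z zV BE] [[XY dXY X2 Y2]]].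
move=> [X'X Y'Y X'0 Y'0 cr] [x'V y'V x'y'] D1E.
have BV : B \subset verts D by rewrite BE bag_verts.
have vB : verts (bag_graph D B) = B by apply/setIidPr.
rewrite vB in XY.
have sX : {subset X <= B} by move=> a aX; rewrite -XY inE aX.
have sY : {subset Y <= B} by move=> a aX; rewrite -XY inE aX orbT.
have cross x y : x \in X -> y \in Y -> uadj D x y = (x \in X') && (y \in Y').
  by move=> xX yY; rewrite -cr // adj_bag_graph sX // sY.
have V1 : verts D1 = verts D :|: [set x'; y'].
  by rewrite D1E /= setIC (setIidPl BV) setUA (setUidPl BV).
pose S := simple_decomposition (bag_graph D B) X Y X' Y' x' y'.
have sX' : {subset X' <= X} by apply/subsetP.
have sY' : {subset Y' <= Y} by apply/subsetP.
have BV' : {subset B <= verts D} by apply/subsetP.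
have adjS a b : adj S a b =
    [|| uadj D a b && (((a \in X) && (b \in X)) || ((a \in Y) && (b \in Y))),
        (a == x') && (b == y'), (a == y') && (b == x'),
        (a == x') && (b \in X'), (b == x') && (a \in X'),
        (a == y') && (b \in Y') | (b == y') && (a \in Y')].
  have nB c : c \in B -> (c == x') = false /\ (c == y') = false.
    by move=> /BV' cV; split; [apply: contraNF x'V | apply: contraNF y'V] => /eqP <-.
  rewrite adj_graph_of vB; apply/and4P/idP => [[_ _ _]|].
    rewrite !adj_bag_graph (uadjC D b a).
    case/orP=> /or4P[/and3P[aX bX /and3P[_ _ ab]]|/and3P[aX bX /and3P[_ _ ab]]|/andP[ax bY]|/orP[]/andP[ax bX]];
    by rewrite ?ab ?ax ?aX ?bX ?bY ?orbT.
  have bB c : c \in B -> c \in B :|: [set x'; y'] by move=> cB; rewrite inE cB.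
  have bx : x' \in B :|: [set x'; y'] by rewrite !inE eqxx orbT.
  have by_ : y' \in B :|: [set x'; y'] by rewrite !inE eqxx !orbT.
  case/or4P=> [/andP[ab /orP[/andP[aX bX]|/andP[aY bY]]]|/andP[/eqP-> /eqP->]|/andP[/eqP-> /eqP->]|].
  - have [_ _ nab] := adjP (uadj_adj ab).
    by rewrite !bB ?sX // nab adj_bag_graph aX bX !sX // ab.
  - have [_ _ nab] := adjP (uadj_adj ab).
    by rewrite !bB ?sY // nab adj_bag_graph aY bY !sY // ab !orbT.
  - by rewrite bx by_ x'y' !eqxx !orbT.
  - by rewrite bx by_ eq_sym x'y' !eqxx !orbT.
  case/or4P=> /andP[/eqP-> cX].
  - have cB := sX _ (sX' _ cX); have [cx _] := nB _ cB.
    by rewrite bx bB // eq_sym cx cX eqxx !orbT.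
  - have cB := sX _ (sX' _ cX); have [cx _] := nB _ cB.
    by rewrite bx bB // cx cX eqxx !orbT.
  - have cB := sY _ (sY' _ cX); have [_ cx] := nB _ cB.
    by rewrite by_ bB // eq_sym cx cX eqxx !orbT.
  - have cB := sY _ (sY' _ cX); have [_ cx] := nB _ cB.
    by rewrite by_ bB // cx cX eqxx !orbT.
have adj1 a b : adj D1 a b = (adj D a b && ~~ [&& a \in B, b \in B & uadj D a b]) || adj S a b.
  rewrite D1E adj_graph_of (set2C b a) orbb [[set a; b] \in _ :|: _]in_setU in_setD -/S.
  rewrite -[[set a; b] \in edges (bag_graph D B)]/(adj (bag_graph D B) a b).
  rewrite -[[set a; b] \in edges S]/(adj S a b) -[[set a; b] \in edges D]/(adj D a b).
  rewrite adj_bag_graph [~~ _ && adj D a b]andbC; apply/idP/idP=> [/and4P[_ _ _] //|h].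
  have [/andP[aV1 bV1] ab] : (a \in verts D :|: verts S) && (b \in verts D :|: verts S) /\ a != b.
    case/orP: h => [/andP[/adjP[aV bV ab] _]|/adjP[aV bV ab]].
      by rewrite !inE aV bV.
    by rewrite !(in_setU, aV, bV) !orbT.
  by rewrite aV1 bV1 ab h.
have set2E a b : ([set a; b] == [set x'; y']) =
    ((a == x') && (b == y')) || ((a == y') && (b == x')).
  apply/eqP/orP => [/set2_inj[[-> ->]|[-> ->]]|[/andP[/eqP-> /eqP->]|/andP[/eqP-> /eqP->]]] //.
  - by left; rewrite !eqxx.
  - by right; rewrite !eqxx.
  exact: set2C.
have mk a b : ([set a; b] \in marked D1) =
    madj D a b || (((a == x') && (b == y')) || ((a == y') && (b == x'))).
  by rewrite D1E !inE marked_madj // set2E.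
have M1 a b : madj D1 a b =
    [|| madj D a b, (a == x') && (b == y') | (a == y') && (b == x')].
  rewrite {1}/madj mk adj1 adjS; case: (boolP (madj D a b)) => [ab|_] /=.
    by rewrite (madj_adj ab) (madj_uadj ab) !andbF.
  case: ((a == x') && (b == y')); first by rewrite !orbT.
  by case: ((a == y') && (b == x')); rewrite ?andbF //= !orbT.
exists x', y'; have XnY a : a \in X -> (a \in Y) = false.
  by move=> aX; rewrite (disjointFr dXY aX).
have E1 a b : uadj D1 a b =
  [|| uadj D a b && ~~ (((a \in X) && (b \in Y)) || ((a \in Y) && (b \in X))),
      (a == x') && (b \in X'), (b == x') && (a \in X'),
      (a == y') && (b \in Y') | (b == y') && (a \in Y')].
  set sp := [|| (a == x') && (b \in X'), (b == x') && (a \in X'),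
      (a == y') && (b \in Y') | (b == y') && (a \in Y')].
  have nV c d : uadj D c d -> (c == x') = false /\ (c == y') = false.
    move=> /uadj_adj/adjP[cV _ _].
    by split; [apply: contraNF x'V | apply: contraNF y'V] => /eqP <-.
  rewrite {1}/uadj mk adj1 adjS -/sp; case: (boolP (uadj D a b)) => ab.
    rewrite (uadj_adj ab) (_ : madj D a b = false); last first.
      by apply/negbTE; apply: contraTN ab => /madj_uadj ->.
    have [ax ay] := nV _ _ ab; have [bx by_] : (b == x') = false /\ (b == y') = false.
      by apply: (nV b a); rewrite uadjC.
    rewrite /sp ax ay bx by_ /= -XY !inE.
    case: (boolP (a \in X)) => [/XnY -> |_]; case: (boolP (b \in X)) => [/XnY -> |_] //=;
    by rewrite ?andbT ?andbF ?orbF ?orbT //; case: (a \in Y); case: (b \in Y).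
  rewrite !andbF andbT /= adj_mu (negbTE ab) orbF.
  case: (boolP sp) => [|_]; last first.
    by rewrite !orbF; do 2![case: (madj D a b) => //=]; do 2![case: (_ || _)].
  rewrite !orbT /= /sp => h; apply/norP.
  have nV' c : c \in verts D -> (c == x') = false /\ (c == y') = false.
    by move=> cV; split; [apply: contraNF x'V | apply: contraNF y'V] => /eqP <-.
  have nx c : madj D x' c = false by apply: contraNF x'V => /madj_adj/adjP[].
  have ny c : madj D y' c = false by apply: contraNF y'V => /madj_adj/adjP[].
  case/or4P: h => /andP[/eqP-> cX];
    [have cB := sX _ (sX' _ cX)|have cB := sX _ (sX' _ cX)
    |have cB := sY _ (sY' _ cX)|have cB := sY _ (sY' _ cX)];
    have [-> ->] := nV' _ (BV' _ cB);
    by rewrite ?(madjC D a) ?nx ?ny ?andbF.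
have mk1 : {subset marked D1 <= edges D1}.
  move=> e; rewrite D1E => /setUP[eD|/set1P ->]; rewrite -D1E.
    have [a [b [eab _]]] := edge_adj (wf_edges wfD eD).
    have : madj D1 a b by rewrite M1 -marked_madj // -eab eD.
    by move/madj_adj; rewrite /adj -eab.
  have : madj D1 x' y' by rewrite M1 !eqxx orbT.
  by move/madj_adj.
rewrite BE in XY.
split.
- exact: (@refine_recomposes D D1 z x' y' X Y X' Y').
- exact: (@wf_refine D D1 z x' y' X Y X' Y').
- exact: (@connected_refine D D1 z x' y' X Y X' Y').
- exact: (@bag_refine D D1 z x' y' X Y X' Y').
Qed.

Lemma split_decompositionP G D : connected G -> split_decomposition G D -> decomposes G D.
Proof.
move=> /connectedP cG; elim=> [|D1 D2 _ dD1 step].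
  have nm a b : madj (MGraph G set0) a b = false by rewrite /madj inE andbF.
  split=> //.
  - split=> [e|a b c|a b]; rewrite ?inE ?nm //.
  - apply/setP => a; rewrite inE /unmarked_vertex /= (_ : [exists y, _] = false) ?andbT //.
    by apply/existsP => -[y]; rewrite nm.
  - by move=> a b _ _; rewrite no_madj_linked.
  - by move=> a b; rewrite nm.
case: dD1 => wfD1 vD1 aD1 cD1 bD1.
have [x' [y' [rD wfD2 cD2 bD2]]] := refine_stepP wfD1 step.
have uE := unmarked_recomposes wfD2 rD.
split=> //.
- by rewrite vD1; apply/setP => a; rewrite !inE uE.
- move=> a b ua ub; rewrite aD1 ?(linked_recomposes wfD2 rD) //; try exact: (unmarked_notin rD).
    by rewrite /in_mem /= uE.
  by rewrite /in_mem /= uE.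
- exact: cD2.
exact: bD2.
Qed.

End Refinement.

(** * Branches at a bag *)

Section BranchFacts.
Variable U : finType.
Implicit Types (x y v w a b c d m : U) (B T X Y S : {set U}).

(** The vertices of the decomposed graph that hang at the position [b]; [b] alone if [b] is
    unmarked. *)
Definition leaves (D : mgraph U) b : {set U} := [set x in branch D b | unmarked_vertex D x].

(** The vertices represented by [b]: the only leaves of [b] with neighbors outside, see
    [linked_exit]. *)
Definition reps (D : mgraph U) b : {set U} :=
  [set x | unmarked_vertex D x && connect (hop D) b x].

Variables (D : mgraph U) (wfD : wf D).
Hypothesis cD : {in verts D &, forall a b, connect (adj D) a b}.
Hypothesis bD : forall x y, madj D x y -> 2 < #|bag D x|.

Lemma in_leaves b x : (x \in leaves D b) = (x \in branch D b) && unmarked_vertex D x.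
Proof. by rewrite /leaves in_set. Qed.

Lemma in_reps b x : (x \in reps D b) = unmarked_vertex D x && connect (hop D) b x.
Proof. by rewrite /reps in_set. Qed.

(** Along a path from [z], only an edge inside the bag changes the branch, and it ends in a vertex
    of the bag, which lies in its own branch. *)
Lemma bag_branch_cover z x : z \in verts D -> x \in verts D ->
  exists2 b, b \in bag D z & x \in branch D b.
Proof.
move=> zV xV; have := cD zV xV; case/connectP=> p.
elim/last_ind: p x xV => [|p d IH] x xV /=.
  by move=> _ ->; exists z; rewrite ?bag_refl ?branch_refl.
rewrite rcons_path last_rcons => /andP[zp pd] ->{x xV}.
have [lV _ _] := adjP pd.
have [b bB lb] := IH _ lV zp erefl.
case: (boolP [&& uadj D (last z p) d, last z p \in bag D b & d \in bag D b]) => [/and3P[_ _ dB]|nb].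
  by exists d; rewrite ?branch_refl // -(bag_eq bB).
by exists b => //; apply: branch_step lb pd nb.
Qed.

Lemma branch_unmarked b c : unmarked_vertex D b -> c \in branch D b -> c = b.
Proof.
move=> ub; rewrite inE => /connectP[[|d p]] //= /andP[/andP[bd nb] _] _.
move: bd; rewrite adj_mu (unmarkedN _ ub) /= => bd.
by rewrite bd bag_refl (uadj_bag bd) in nb.
Qed.

Lemma notin_branch_bag b c : c \in branch D b -> c != b -> c \notin bag D b.
Proof. by move=> cb; apply: contra => cB; rewrite (branch_bag wfD cB cb). Qed.

Lemma branch_next b c d : c \in branch D b -> c != b -> adj D c d -> d \in branch D b.
Proof.
move=> cb ncb cd; apply: (branch_step cb cd).
by rewrite (negbTE (notin_branch_bag cb ncb)) andbF.
Qed.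

Lemma branch_uadj b c d : c \in branch D b -> c != b -> uadj D c d -> d \in branch D b :\ b.
Proof.
move=> cb ncb cd; rewrite in_setD1 (branch_next cb ncb (uadj_adj cd)) andbT.
apply: contra (notin_branch_bag cb ncb) => /eqP db.
by rewrite -db uadj_bag // uadjC.
Qed.

Section Marked.
Variables (b m : U) (bm : madj D b m).

Let mb : madj D m b. Proof. by rewrite madjC. Qed.
Let nmb : m != b. Proof. by case/adjP: (madj_adj mb). Qed.

Lemma mate_branch : m \in branch D b :\ b.
Proof.
rewrite !inE nmb; apply: connect1; rewrite /nobag (madj_adj bm).
by rewrite (madj_uadj bm).
Qed.

Lemma mate_notin_bag : m \notin bag D b.
Proof. by rewrite inE; apply/negP => /(madj_bag wfD bm). Qed.

(** An explicit side in place of the existential one of [wf_side]. *)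
Lemma side_branch : side D m b (branch D b :\ b).
Proof.
split; first exact: mate_branch.
  by rewrite !inE eqxx.
move=> c d cd /setD1P[ncb cb]; have db := branch_next cb ncb cd.
rewrite !in_setD1 db andbT negbK => /eqP dE; split=> //; subst d.
move: cd; rewrite adj_mu => /orP[cm|/uadj_bag bc].
  by apply: (wf_matching wfD) bm; rewrite madjC.
have /negP := notin_branch_bag cb ncb; case.
by rewrite (bag_eq bc) bag_refl.
Qed.

Lemma sub_branch_mate d : uadj D m d -> branch D d \subset branch D b :\ b.
Proof.
move=> md.
have dS : d \in branch D b :\ b by rewrite -(side_uadj mb side_branch md) mate_branch.
case: (boolP (unmarked_vertex D d)) => [ud|].
  by apply/subsetP => c /(branch_unmarked ud) ->.
rewrite negb_and (_ : d \in verts D) ?negbK; last by case/adjP: (uadj_adj md).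
case/existsP=> e de; have ed : madj D e d by rewrite madjC.
have [S sS] := wf_side wfD ed.
have sI := sideI bm md de side_branch sS.
apply: subset_trans (branch_sub_side wfD de sI) _.
by rewrite subUset sub1set dS subsetIl.
Qed.

(** On a path from [x] to [m], the side beyond [m] can only be entered over the edge [bm]. Before
    that the path avoids the bag of [m], so it stays in the branch of [m]. *)
Lemma branch_opposite x : x \in verts D -> (x \in branch D b :\ b) = false ->
  x \in branch D m.
Proof.
have [_ bS cr] := side_branch; have bagS c : c \in bag D m -> c \in branch D b :\ b.
  by rewrite [in X in X -> _]inE => mc; rewrite -(side_bag mb side_branch mc) mate_branch.
move=> xV xS; have mV : m \in verts D by case/adjP: (madj_adj mb).
have symn : connect_sym (nobag D (bag D m)).
  by apply: sym_connect_sym => u v; rewrite nobagC.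
rewrite inE symn; have /connectP[p] := cD xV mV.
elim: p x xV xS => [|d p IH] x xV xS /=.
  by move=> _ e; rewrite -e mate_branch in xS.
case/andP=> xd dp pl; have dV : d \in verts D by case/adjP: xd.
case dS: (d \in branch D b :\ b).
  have dx : adj D d x by rewrite adjC.
  have [_ ->] := cr _ _ dx dS (negbT xS).
  apply: connect1; rewrite /nobag (madj_adj bm) (madj_uadj bm) //.
apply: connect_trans (connect1 _) (IH d dV dS dp pl).
rewrite /nobag xd; apply/negP => /and3P[_ /bagS xS' _].
by rewrite xS' in xS.
Qed.

Lemma leaves_mate : leaves D m = [set x | unmarked_vertex D x] :\: leaves D b.
Proof.
have um x : unmarked_vertex D x -> (x != b) * (x != m).
  by move=> ux; split; apply: contraTneq ux => ->; rewrite /unmarked_vertex negb_and negbK;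
   apply/orP; right; apply/existsP; eexists; [apply: bm | apply: mb].
apply/setP => x; rewrite in_setD !in_leaves in_set.
case ux: (unmarked_vertex D x); rewrite ?andbF // !andbT.
have [xb xm] := um _ ux; apply/idP/idP => [xM|xB].
  have sC := side_sym side_branch.
  have /subsetP/(_ x xM) := branch_sub_side wfD mb sC.
  by rewrite in_setU1 (negbTE xm) in_setC in_setD1 xb.
by apply: branch_opposite; rewrite ?(unmarked_verts ux) // in_setD1 (negbTE xB) andbF.
Qed.

Lemma reps_mate x : (x \in reps D m) = [exists c, uadj D b c && (x \in reps D c)].
Proof.
rewrite inE; case: (boolP (unmarked_vertex D x)) => ux /=; last first.
  by apply/esym/existsP => -[c]; rewrite inE (negbTE ux) andbF.
apply/idP/existsP => [mx|[c /andP[bc]]].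
  have nmx : m != x by apply: contraTneq ux => <-; apply/negP => um; have := unmarkedN b um; rewrite mb.
  have [c mc cx] := connect_hop_first mx nmx.
  by exists c; rewrite -(hopE _ wfD mb) mc inE ux.
rewrite inE ux /= => cx; apply: connect_trans (connect1 _) cx.
by rewrite (hopE _ wfD mb).
Qed.

(** Links the components of [D] minus a bag, over which the theorem quantifies, to branches; all
    later work is done with branches. *)
Lemma component_branch :
  component_of (mdel D (bag D b)) m = branch D b :\ b.
Proof.
set B := bag D b.
have adjE c d : adj (mdel D B) c d = [&& c \notin B, d \notin B & adj D c d].
  by rewrite adj_induced !in_setC.
apply/setP => y; rewrite inE; apply/andP/idP => [[_ /connectP[p pp yl]]|].
  suff main q c : c \in branch D b :\ b -> path (adj (mdel D B)) c q ->
      last c q \in branch D b :\ b by rewrite yl; apply: main pp; apply: mate_branch.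
  elim: q c => [//|d q IH] c /= /setD1P[ncb cb] /andP[cd dq]; apply: IH dq.
  move: cd; rewrite adjE => /and3P[cB dB cd].
  rewrite in_setD1 (branch_next cb ncb cd) andbT.
  by apply: contraNneq dB => ->; apply: bag_refl.
case/setD1P=> nyb yb.
have yB := notin_branch_bag yb nyb.
have yV : y \in verts D.
  by have [bV _ _] := adjP (madj_adj bm); apply: (subsetP (branch_verts bV)) yb.
split; first by rewrite in_setI in_setC yB yV.
move: yb; rewrite inE => /connectP[p pp yl].
(* A path without repetition leaves [b] over the marked edge, the only non-bag edge at [b], and
   never meets [b] or its bag again. *)
case: (shortenP pp) yl => q qq uq _ yl {pp p}.
case: q qq uq yl => [|d q] /=; first by move=> _ _ e; rewrite e eqxx in nyb.
case/andP=> /andP[bd nbd] dq /andP[bdq udq] yl.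
have dm : d = m.
  move: bd; rewrite adj_mu => /orP[bd|bd]; first exact: (wf_matching wfD bd bm).
  by rewrite bd bag_refl (uadj_bag bd) in nbd.
rewrite yl -{1}dm.
have db : d \in branch D b by rewrite dm; case/setD1P: mate_branch.
apply/connectP; exists q => //.
elim: q d {bd nbd dm udq yl yV yB nyb y} db dq bdq => //= e q IH d db.
case/andP=> /andP[de _] eq; rewrite !in_cons !negb_or => /and3P[bnd bne bq].
have nd : d != b by rewrite eq_sym.
have ne : e != b by rewrite eq_sym.
have eb := branch_next db nd de.
rewrite IH // ?in_cons ?negb_or ?bne // adjE de.
by rewrite !notin_branch_bag.
Qed.

End Marked.

Lemma leaves_unmarked x : unmarked_vertex D x -> leaves D x = [set x].
Proof.
move=> ux; apply/setP => y; rewrite in_leaves in_set1; apply/andP/eqP => [[yb _]|->].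
  exact: (branch_unmarked ux).
by rewrite branch_refl.
Qed.

Lemma hop_branch b x : connect (hop D) b x -> x \in branch D b.
Proof.
case: (eqVneq x b) => [->|nxb] bx; first by rewrite branch_refl.
have nbx : b != x by rewrite eq_sym.
have [d /existsP[m /andP[bm _]] _] := connect_hop_first bx nbx.
by have := behind wfD bm (side_branch bm) bx nxb => /setD1P[].
Qed.

Lemma reps_leaves b : reps D b \subset leaves D b.
Proof.
apply/subsetP => x; rewrite in_leaves in_reps => /andP[ux /hop_branch ->].
by [].
Qed.

(** Hop across the marked edge: the mate has an unmarked neighbor [d] because its bag has further
    vertices, and the branch of [d] is smaller. *)
Lemma reps_neq0 b : b \in verts D -> exists x, x \in reps D b.
Proof.
elim: {b}#|branch D b| {-2}b (leqnn #|branch D b|) => [|n IH] b sz bV.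
  by have := branch_refl D b; move: sz; rewrite leqn0 => /eqP/cards0_eq ->; rewrite inE.
case: (boolP (unmarked_vertex D b)) => [ub|]; first by exists b; rewrite inE ub connect0.
rewrite negb_and bV negbK => /existsP[m bm].
have mb : madj D m b by rewrite madjC.
have [d md] : exists d, uadj D m d.
  have [y yB nym] : exists2 y, y \in bag D m & y != m.
    have /card_gt0P[y] : 0 < #|bag D m :\ m|.
      by have := bD mb; rewrite (cardsD1 m) bag_refl => /ltnW.
    by case/setD1P=> nym yB; exists y.
  move: yB; rewrite inE => /connectP[[|d p]] /=; first by move=> _ e; rewrite e eqxx in nym.
  by case/andP=> md _ _; exists d.
have [||x] := IH d.
- rewrite -ltnS; apply: leq_trans sz; apply: leq_ltn_trans (subset_leq_card (sub_branch_mate bm md)) _.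
  by rewrite [X in _ < X](cardsD1 b) branch_refl.
- by case/adjP: (uadj_adj md).
rewrite in_reps => /andP[ux dx]; exists x; rewrite in_reps ux /=.
by apply: connect_trans (connect1 _) dx; rewrite (hopE _ wfD bm).
Qed.

Lemma linked_hop b d y : linked D b y -> hop D b d -> linked D d y.
Proof.
case/existsP=> w /andP[bw wy] /existsP[m /andP[bm md]].
have mb : madj D m b by rewrite madjC.
apply/existsP; exists m; rewrite uadjC md; apply: connect_trans (connect1 _) wy.
by rewrite (hopE _ wfD mb).
Qed.

Lemma linked_connect b x y : linked D b y -> connect (hop D) b x -> linked D x y.
Proof.
move=> lb /connectP[p]; elim: p b lb => [|d p IH] b lb /=; first by move=> _ ->.
by case/andP=> bd dp xl; apply: IH dp xl; apply: linked_hop lb bd.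
Qed.

(** A link leaving a branch passes through [b]. Read backwards from there, its initial part is a hop
    walk from [b] to [a]. *)
Lemma linked_exit b a y : a \in branch D b -> y \notin branch D b -> linked D a y ->
  connect (hop D) b a /\ linked D b y.
Proof.
move=> ab yb /existsP[w /andP[aw /connectP[p]]].
elim: p a w ab aw => [|d p IH] a w ab aw /= => [_ yw|/andP[/existsP[n /andP[wn nd]] dp] yl].
  case: (eqVneq a b) => [eab|nab]; first last.
    by have /setD1P[_ wb] := branch_uadj ab nab aw; rewrite yw wb in yb.
  by split; [rewrite eab connect0 | apply/existsP; exists w; rewrite -eab aw yw connect0].
case: (eqVneq a b) => [eab|nab].
  rewrite eab in aw *; split; first exact: connect0.
  apply/existsP; exists w; rewrite aw; apply/connectP; exists (d :: p) => //=.
  by rewrite dp andbT; apply/existsP; exists n; rewrite wn.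
have /setD1P[nwb wb] := branch_uadj ab nab aw.
have nb := branch_next wb nwb (madj_adj wn).
have [bn lb] := IH n d nb nd dp yl; split=> //.
apply: connect_trans bn (connect1 _); apply/existsP; exists w.
by rewrite madjC wn uadjC.
Qed.

(** A link between two branches leaves one at [b], uses a single edge of the bag and enters the
    other at [b']. This is the rank-one pattern behind all rank estimates. *)
Lemma linked_branches z b b' x y : b \in bag D z -> b' \in bag D z -> b != b' ->
  x \in leaves D b -> y \in leaves D b' ->
  linked D x y = [&& x \in reps D b, y \in reps D b' & uadj D b b'].
Proof.
move=> bB bB' nbb; rewrite !in_leaves !in_reps => /andP[xb ux] /andP[yb uy]; rewrite ux uy /=.
have b'b : b' \in bag D b by rewrite (bag_eq bB).
have ybN : y \notin branch D b.
  by apply: contraNN nbb => yb2; rewrite (branch_uniq wfD b'b yb2 yb).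
apply/idP/and3P => [/(linked_exit xb ybN)[bx /existsP[w /andP[bw wy]]]|[bx b'y bb']].
  suff <- : w = b' by [].
  have wB : w \in bag D b' by rewrite (bag_eq b'b) uadj_bag.
  by rewrite (branch_uniq wfD wB yb (hop_branch wy)).
apply: linked_connect bx; apply/existsP; exists b'.
by rewrite bb'.
Qed.

End BranchFacts.

(** * Limbs *)

Section Minduced.
Variable U : finType.
Implicit Types (x y v w a b c d m : U) (B T X Y S : {set U}) (D : mgraph U).

Lemma adj_minduced D X a c : adj (minduced D X) a c = [&& a \in X, c \in X & adj D a c].
Proof. exact: adj_induced. Qed.

Lemma mk_minduced D X a c : adj (minduced D X) a c ->
  ([set a; c] \in marked (minduced D X)) = ([set a; c] \in marked D).
Proof.
rewrite adj_minduced => /and3P[aX cX /adjP[aV cV _]].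
by rewrite inE subUset !sub1set !in_setI aX cX aV cV /= andbT.
Qed.

Lemma madj_minduced D X a c : madj (minduced D X) a c = [&& a \in X, c \in X & madj D a c].
Proof.
rewrite {1}/madj; case: (boolP (adj _ a c)) => [h|/negbTE h] /=.
  by move: (h); rewrite mk_minduced // adj_minduced /madj => /and3P[-> -> ->].
move: h; rewrite adj_minduced /madj; case: (a \in X) => //=; case: (c \in X) => //= ->.
by [].
Qed.

Lemma uadj_minduced D X a c : uadj (minduced D X) a c = [&& a \in X, c \in X & uadj D a c].
Proof.
rewrite {1}/uadj; case: (boolP (adj _ a c)) => [h|/negbTE h] /=.
  by move: (h); rewrite mk_minduced // adj_minduced /uadj => /and3P[-> -> ->].
move: h; rewrite adj_minduced /uadj; case: (a \in X) => //=; case: (c \in X) => //= ->.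
by [].
Qed.

Lemma wf_minduced D X : wf D -> wf (minduced D X).
Proof.
move=> wfD; split=> [e eM|a c d|a c].
- move: (eM); rewrite inE => /andP[eD eX].
  have [a [c [E ac]]] := edge_adj (wf_edges wfD eD); subst e.
  move: eX; rewrite subUset !sub1set !in_setI => /andP[/andP[_ aX] /andP[_ cX]].
  by rewrite -[_ \in _]/(adj (minduced D X) a c) adj_minduced aX cX ac.
- rewrite !madj_minduced => /and3P[_ _ ac] /and3P[_ _]; exact: wf_matching wfD _ _ _ ac.
rewrite madj_minduced => /and3P[_ _ /(wf_side wfD)[S [aS cS cr]]].
exists S; split=> // d e; rewrite adj_minduced => /and3P[_ _]; exact: cr.
Qed.

Section DeleteUnmarked.
Variables (D : mgraph U) (v : U) (uv : unmarked_vertex D v).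

Let Dv := mdel D [set v].

Let vN a : madj D a v = false.
Proof. by rewrite madjC unmarkedN. Qed.

Lemma madj_del a c : madj Dv a c = madj D a c.
Proof.
rewrite madj_minduced !in_setC !in_set1; case: (eqVneq a v) => [->|_] /=; first by rewrite unmarkedN.
by case: (eqVneq c v) => [->|_] /=; first by rewrite vN.
Qed.

Lemma uadj_del a c : uadj Dv a c = [&& a != v, c != v & uadj D a c].
Proof. by rewrite uadj_minduced !in_setC !in_set1. Qed.

Lemma unmarked_del a : unmarked_vertex Dv a = (a != v) && unmarked_vertex D a.
Proof.
rewrite /unmarked_vertex /= !in_setI in_setC in_set1 -andbA andbCA; congr [&& _, _ & ~~ _].
by apply: eq_existsb => c; rewrite madj_del.
Qed.

Lemma hop_del w c : w != v -> c != v -> connect (hop Dv) w c = connect (hop D) w c.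
Proof.
move=> wv cv; apply/idP/idP.
  apply: connect_sub => {wv cv}w {}c /existsP[n]; rewrite madj_del uadj_del.
  by case/andP=> wn /and3P[_ _ nc]; rewrite connect1 //; apply/existsP; exists n; rewrite wn.
case/connectP=> p; elim: p w wv => [|d p IH] w wv /=; first by move=> _ ->.
case/andP=> /existsP[n /andP[wn nd]] dp cl.
have dv : d != v.
  apply: contraNneq cv => e; move: dp cl; rewrite e; case: p {IH} => [|f p] /=; first by move=> _ ->.
  by rewrite hop_unmarked.
apply: connect_trans (connect1 _) (IH d dv dp cl); apply/existsP; exists n.
rewrite madj_del wn uadj_del nd dv !andbT; apply: contraTneq wn => ->.
by rewrite vN.
Qed.

(** No hop starts at an unmarked vertex, so links between other vertices never pass through it. *)
Lemma linked_del a c : a != v -> c != v -> linked Dv a c = linked D a c.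
Proof.
move=> av cv; apply/existsP/existsP => -[w /andP[aw wc]].
  move: aw; rewrite uadj_del => /and3P[_ wv aw]; exists w.
  by rewrite aw -hop_del.
have wv : w != v by apply: contraNneq cv => e; move: wc; rewrite e => /(connect_hop_unmarked uv) ->.
by exists w; rewrite uadj_del av wv aw hop_del.
Qed.

End DeleteUnmarked.
End Minduced.

Section Limb.
Variable U : finType.
Variables (D : mgraph U) (wfD : wf D).
Hypothesis cD : {in verts D &, forall a b, connect (adj D) a b}.
Hypothesis bD : forall x y, madj D x y -> 2 < #|bag D x|.
Variables (b m : U) (bm : madj D b m).

Let mb : madj D m b. Proof. by rewrite madjC. Qed.
Let C := branch D b :\ b.
Let T := minduced D C.

Let wfT : wf T. Proof. exact: wf_minduced. Qed.

Let mC : m \in C. Proof. exact: mate_branch. Qed.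
Let bV : b \in verts D. Proof. by case/adjP: (madj_adj bm). Qed.

Let CV : {subset C <= verts D}.
Proof. by move=> x /setD1P[_]; apply: (subsetP (branch_verts bV)). Qed.

(** Cutting off the branch removes the marked edge at [m], which thereby becomes an additional
    unmarked vertex. *)
Let unmarked_branch a : unmarked_vertex T a = (a \in C) && (unmarked_vertex D a || (a == m)).
Proof.
rewrite {1}/unmarked_vertex /= in_setI.
case: (boolP (a \in C)) => [aC|]; last by rewrite !andbF.
rewrite (CV aC) /= /unmarked_vertex (CV aC) /=.
apply/existsPn/orP => [nT|[/existsPn nD c|/eqP -> c]].
- case: (eqVneq a m) => [_|nam]; [by right | left].
  apply/existsPn => c; apply/negP => ac; have /negP := nT c; apply.
  rewrite madj_minduced aC ac in_setD1 andbT /=.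
  have /setD1P[nab ab] := aC.
  rewrite (branch_next wfD ab nab (madj_adj ac)) andbT; apply: contraNneq nam => cb.
  by apply/eqP/(wf_matching wfD (x := b)) => //; rewrite madjC -cb.
- by apply: contra (nD c); rewrite madj_minduced => /and3P[].
rewrite madj_minduced; apply/negP => /and3P[_ cC mc].
by move: cC; rewrite (wf_matching wfD mc mb) setD11.
Qed.

Let leaf_unm a : a \in leaves D b -> [/\ a \in C, unmarked_vertex D a, unmarked_vertex T a & a != m].
Proof.
rewrite in_leaves => /andP[ab ua].
have nab : a != b by apply: contraTneq ua => ->; apply/negP => ub; have := unmarkedN m ub; rewrite bm.
have nam : a != m by apply: contraTneq ua => ->; apply/negP => ub; have := unmarkedN b ub; rewrite mb.
have aC : a \in C by rewrite in_setD1 nab.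
by rewrite unmarked_branch aC ua.
Qed.

(** A hop from [m] leads over [b] into another branch, from which no leaf of [b] is reached; so a
    hop walk ending in a leaf of [b] avoids [m] and stays inside [C]. *)
Let hop_branchT w y : w \in C -> y \in leaves D b -> connect (hop T) w y = connect (hop D) w y.
Proof.
move=> wC yL; have [yC uy _ ym] := leaf_unm yL; apply/idP/idP.
  apply: connect_sub => {wC} {}w c /existsP[n]; rewrite madj_minduced uadj_minduced.
  case/andP=> /and3P[_ _ wn] /and3P[_ _ nc]; rewrite connect1 //.
  by apply/existsP; exists n; rewrite wn.
have nm : connect (hop D) m y = false.
  apply/negP => my; have nmy : m != y by rewrite eq_sym.
  have [c mc cy] := connect_hop_first my nmy.
  rewrite (hopE _ wfD mb) in mc.
  have := branch_uniq wfD (uadj_bag mc) (c := y); case/setD1P: yC => _ yb.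
  by move=> /(_ yb (hop_branch wfD cy)) e; rewrite e uadj_irr in mc.
case/connectP=> p; elim: p w wC => [|d p IH] w wC /=; first by move=> _ ->.
move=> /andP[wd dp] yl.
have nwm : w != m.
  apply: contraFneq nm => <-; apply/connectP; exists (d :: p) => //=.
  by rewrite wd.
have /existsP[n /andP[wn nd]] := wd.
have nC : n \in C.
  have /setD1P[nwb wb] := wC; rewrite in_setD1 (branch_next wfD wb nwb (madj_adj wn)) andbT.
  apply: contraNneq nwm => nb; apply/eqP/(wf_matching wfD (x := b)) => //.
  by rewrite -nb madjC.
have dC : d \in C by have /setD1P[nnb nb] := nC; apply: (branch_uadj wfD nb nnb nd).
apply: connect_trans (connect1 _) (IH d dC dp yl); apply/existsP; exists n.
by rewrite madj_minduced uadj_minduced wC nC dC wn.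
Qed.

Let linked_branchT a y : a \in C -> y \in leaves D b -> linked T a y = linked D a y.
Proof.
move=> aC yL; apply/existsP/existsP => -[w /andP[aw wy]].
  move: aw; rewrite uadj_minduced => /and3P[_ wC aw]; exists w.
  by rewrite aw -hop_branchT.
have wC : w \in C by have /setD1P[nab ab] := aC; apply: (branch_uadj wfD ab nab aw).
by exists w; rewrite uadj_minduced aC wC aw hop_branchT.
Qed.

Let linked_mate y : y \in leaves D b -> linked T m y = (y \in reps D b).
Proof.
move=> yL; have [_ uy _ _] := leaf_unm yL; rewrite linked_branchT // in_reps uy /=.
have nby : b != y by apply: contraTneq uy => <-; apply/negP => ub; have := unmarkedN m ub; rewrite bm.
apply/existsP/idP => [[w /andP[mw wy]]|by_].
  by apply: connect_trans (connect1 _) wy; rewrite (hopE _ wfD bm).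
have [d bd dy] := connect_hop_first by_ nby.
by exists d; rewrite -(hopE _ wfD bm) bd.
Qed.

Let um : unmarked_vertex T m.
Proof. by rewrite unmarked_branch mC eqxx orbT. Qed.

Lemma limbE y : y \in C -> limb D (bag D b) y =
  let H := bag_graph D (bag D b) in
  mdel (if complete H then mlocal_compl T m else
        if star_at H b then mpivot T m y else T) [set m].
Proof.
move=> yC /=; rewrite /limb.
have -> : component_of (mdel D (bag D b)) y = C.
  rewrite /C -(component_branch wfD bm); apply/setP => z; rewrite !inE.
  have : y \in component_of (mdel D (bag D b)) m by rewrite (component_branch wfD bm).
  rewrite inE => /andP[_ my]; congr (_ && _); apply/esym/same_connect => //.
  by apply: sym_connect_sym => u v; rewrite adjC.
rewrite -/T; case: pickP => [[v w] /= /and3P[vC wB vw]|]; last first.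
  by move/(_ (m, b)); rewrite /= mC bag_refl mb.
have wC : w \notin C.
  by rewrite in_setD1; apply/negP => /andP[nwb /(branch_bag wfD wB) e]; rewrite e eqxx in nwb.
have [_ _ cr] := side_branch wfD bm.
have [-> ->] := cr _ _ (madj_adj vw) vC wC.
by case: ifP => // _; case: ifP.
Qed.

(** Common end of the three limb types: [X] is the branch after its local operation, from which [m]
    is deleted before recomposing. *)
Let limb_of X (wfX : wf X) (uX : unmarked_vertex X =1 unmarked_vertex T) :
  verts (recompose_all (mdel X [set m])) = leaves D b /\
  {in leaves D b &, forall a c, adj (recompose_all (mdel X [set m])) a c = linked X a c}.
Proof.
have umX : unmarked_vertex X m by rewrite uX um.
have [V E] := recompose_allP (wf_minduced (~: [set m]) wfX).
split=> [|a c aL cL].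
  rewrite V; apply/setP => a; rewrite in_set unmarked_del // uX unmarked_branch in_leaves.
  case: (eqVneq a m) => [->|nam] /=.
    apply/esym/negP => /andP[_ ub]; have := unmarkedN b ub; by rewrite mb.
  rewrite orbF; case ua: (unmarked_vertex D a); rewrite ?andbF // !andbT /C in_setD1.
  suff -> : a != b by [].
  by apply: contraTneq ua => ->; apply/negP => ub; have := unmarkedN m ub; rewrite bm.
have [_ _ uaT nam] := leaf_unm aL; have [_ _ ucT ncm] := leaf_unm cL.
rewrite E ?linked_del //; by rewrite -[_ \in _]/(unmarked_vertex _ _) unmarked_del // uX ?nam ?ncm.
Qed.

Lemma verts_limb y : y \in leaves D b -> verts (limb_graph D (bag D b) y) = leaves D b.
Proof.
move=> yL; have [yC _ uyT _] := leaf_unm yL; rewrite /limb_graph limbE //=.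
have uTm := unmarked_mlocal wfT um; have wfTm := wf_mlocal wfT um.
case: ifP => _; first by have [-> _] := limb_of wfTm uTm.
case: ifP => _; last by have [-> _] := @limb_of T wfT (fun _ => erefl).
have uym : unmarked_vertex (mlocal_compl T m) y by rewrite uTm.
have umm : unmarked_vertex (mlocal_compl (mlocal_compl T m) y) m.
  by rewrite (unmarked_mlocal wfTm) // uTm.
have wf2 := wf_mlocal wfTm uym.
have [] // := @limb_of (mpivot T m y) (wf_mlocal wf2 umm).
by move=> a; rewrite (unmarked_mlocal wf2) // (unmarked_mlocal wfTm) // uTm.
Qed.

(** By [linked_mate] the neighbors of [m] are the representatives, so complementing at [m] toggles
    exactly the pairs of representatives. *)
Lemma adj_limb_complete y a c : y \in leaves D b -> a \in leaves D b -> c \in leaves D b ->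
  complete (bag_graph D (bag D b)) -> a != c ->
  adj (limb_graph D (bag D b) y) a c = linked D a c (+) ((a \in reps D b) && (c \in reps D b)).
Proof.
move=> yL aL cL K nac; have [yC _ _ _] := leaf_unm yL; rewrite /limb_graph limbE //= K.
have uTm := unmarked_mlocal wfT um; have wfTm := wf_mlocal wfT um.
have [_ ->] := limb_of wfTm uTm => //.
have [aC _ uaT nam] := leaf_unm aL; have [_ _ ucT ncm] := leaf_unm cL.
by rewrite linked_mlocal // linked_branchT // !linked_mate.
Qed.

Lemma adj_limb_leaf y a c : y \in leaves D b -> a \in leaves D b -> c \in leaves D b ->
  complete (bag_graph D (bag D b)) = false -> star_at (bag_graph D (bag D b)) b = false ->
  adj (limb_graph D (bag D b) y) a c = linked D a c.
Proof.
move=> yL aL cL K S; have [yC _ _ _] := leaf_unm yL; rewrite /limb_graph limbE //= K S.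
have [_ ->] := @limb_of T wfT (fun _ => erefl) => //.
by have [aC _ _ _] := leaf_unm aL; rewrite linked_branchT.
Qed.

Section Center.
Variable y : U.
Hypotheses (yR : y \in reps D b) (K : complete (bag_graph D (bag D b)) = false)
  (S : star_at (bag_graph D (bag D b)) b).

Let yL : y \in leaves D b. Proof. exact: (subsetP (reps_leaves wfD b)). Qed.
Let uy : unmarked_vertex T y. Proof. by case: (leaf_unm yL). Qed.
Let G := recompose_all T.

Let adjG a c : unmarked_vertex T a -> unmarked_vertex T c -> adj G a c = linked T a c.
Proof. by move=> ua uc; have [_ ->] := recompose_allP wfT. Qed.

Let adjGm : adj G m y.
Proof. by rewrite adjG // linked_mate. Qed.

(** Each of the three complementations in [mpivot] becomes one of the recomposed graph [G] of [T],
    by [linked_mlocal]; together they form its pivot at [my]. *)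
Let adj_center a c : a \in leaves D b -> c \in leaves D b -> a != c ->
  adj (limb_graph D (bag D b) y) a c = adj (pivot G m y) a c.
Proof.
move=> aL cL nac; have [yC _ _ _] := leaf_unm yL; rewrite /limb_graph limbE //= K S.
set T1 := mlocal_compl T m; set T2 := mlocal_compl T1 y.
have u1 : unmarked_vertex T1 =1 unmarked_vertex T := unmarked_mlocal wfT um.
have wf1 : wf T1 := wf_mlocal wfT um.
have uy1 : unmarked_vertex T1 y by rewrite u1.
have u2 : unmarked_vertex T2 =1 unmarked_vertex T.
  by move=> d; rewrite (unmarked_mlocal wf1) // u1.
have wf2 : wf T2 := wf_mlocal wf1 uy1.
have um2 : unmarked_vertex T2 m by rewrite u2.
have u3 : unmarked_vertex (mpivot T m y) =1 unmarked_vertex T.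
  by move=> d; rewrite (unmarked_mlocal wf2) // u2.
have [_ ->] := limb_of (wf_mlocal wf2 um2) u3 => //.
have [_ _ ua _] := leaf_unm aL; have [_ _ uc _] := leaf_unm cL.
have E1 d e : unmarked_vertex T d -> unmarked_vertex T e ->
    linked T1 d e = adj (local_compl G m) d e.
  (* The formula [linked_mlocal] requires distinct vertices; on the diagonal linkedness is adjacency
     of a recomposed graph, hence false. *)
  move=> ud ue; rewrite adj_local_compl; case: (eqVneq d e) => [<-|nde] /=.
    have [_ <-] := recompose_allP wf1; last 2 first.
    - by rewrite -[_ \in _]/(unmarked_vertex _ _) u1.
    - by rewrite -[_ \in _]/(unmarked_vertex _ _) u1.
    by rewrite adj_irr.
  by rewrite linked_mlocal // -!adjG.
have E2 d e : unmarked_vertex T d -> unmarked_vertex T e ->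
    linked T2 d e = adj (local_compl (local_compl G m) y) d e.
  move=> ud ue; rewrite adj_local_compl; case: (eqVneq d e) => [<-|nde] /=.
    have [_ <-] := recompose_allP wf2; last 2 first.
    - by rewrite -[_ \in _]/(unmarked_vertex _ _) u2.
    - by rewrite -[_ \in _]/(unmarked_vertex _ _) u2.
    by rewrite adj_irr.
  by rewrite linked_mlocal ?u1 // !E1.
have u2' d : unmarked_vertex T d -> unmarked_vertex T2 d by rewrite u2.
apply: etrans (linked_mlocal wf2 um2 (u2' _ ua) (u2' _ uc) nac) _.
rewrite (E2 a c ua uc) (E2 m a um ua) (E2 m c um uc).
by rewrite [RHS]adj_local_compl nac.
Qed.

Lemma adj_limb_center a c : a \in leaves D b -> c \in leaves D b -> a != c ->
  a != y -> c != y -> adj (limb_graph D (bag D b) y) a c =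
  linked D a c (+) ((a \in reps D b) && linked D y c) (+) (linked D y a && (c \in reps D b)).
Proof.
move=> aL cL nac nay ncy; rewrite adj_center //.
have [aC _ ua nam] := leaf_unm aL; have [cC _ uc ncm] := leaf_unm cL.
have [yC _ _ _] := leaf_unm yL.
rewrite adj_pivot ?set2N ?nam ?ncm //.
by rewrite !adjG // !linked_mate // !linked_branchT.
Qed.

Lemma adj_limb_centery c : c \in leaves D b -> c != y ->
  adj (limb_graph D (bag D b) y) y c = (c \in reps D b).
Proof.
move=> cL ncy; rewrite adj_center 1?eq_sym //.
have [cC _ uc ncm] := leaf_unm cL.
by rewrite adj_pivotr ?set2N ?ncm // adjG // linked_mate.
Qed.

End Center.
End Limb.

(** * Cut-rank of limbs *)

Section Stars.
Variable U : finType.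
Implicit Types (c d e : U) (H : graph U).

Lemma star_atP H c : star_at H c -> c \in verts H /\
  {in verts H &, forall d e, d != e -> adj H d e = (d == c) || (e == c)}.
Proof.
case/and3P=> /andP[_ acy] cV /forall_inP cadj.
have cN d : d \in verts H -> d != c -> adj H c d.
  by move=> dV; apply/implyP/cadj.
split=> // d e dV eV de.
case: (eqVneq d c) => [dc|dc] /=.
  by subst d; apply: cN => //; rewrite eq_sym.
case: (eqVneq e c) => [ec|ec] /=.
  by subst e; rewrite adjC cN.
(* An edge between two leaves would close the triangle [c], [d], [e], contradicting acyclicity. *)
apply/negP => ade; have us : uniq [:: c; d; e].
  by rewrite /= !inE negb_or de !(eq_sym c) dc ec.
have sz : 3 < #|U|.+1 by have := max_card (mem [:: c; d; e]); rewrite (card_uniqP us).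
have /forallP/(_ [tuple c; d; e]) := forallP acy (Ordinal sz).
rewrite us /= cN // ade adjC cN //.
Qed.

Lemma star_atI H c : c \in verts H ->
  {in verts H &, forall d e, d != e -> adj H d e = (d == c) || (e == c)} ->
  star_at H c.
Proof.
move=> cV E; have cN d : d \in verts H -> d != c -> adj H c d.
  by move=> dV dc; rewrite E // ?eqxx // eq_sym.
apply/and3P; split=> //; last by apply/forall_inP => d dV; apply/implyP/cN.
apply/andP; split.
  apply/connectedP => d e dV eV.
  have cc f : f \in verts H -> connect (adj H) c f.
    move=> fV; case: (eqVneq f c) => [->|fc]; first exact: connect0.
    by rewrite connect1 // cN.
  apply: connect_trans (cc e eV).
  by rewrite (@sym_connect_sym _ (adj H)) ?cc // => x y; rewrite adjC.
apply/forallP => n; apply/forallP => p; apply/implyP => n2.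
apply/negP => /andP[].
have adjE d e : adj H d e -> (d == c) || (e == c).
  by move=> de; have [dV eV nde] := adjP de; rewrite -E.
(* Every edge contains [c], so on a cycle [c] would have to occur twice: either [x] and [z] are both
   [c], or [y] is and so is the successor of [z]. *)
case: p n2 => -[|x [|y [|z s]]] //= /eqP <- // _.
move=> /and3P[/adjE xy /adjE yz zs]; rewrite !inE !negb_or.
case/and3P=> /and3P[nxy nxz xs] /andP[nyz ys] _.
case: (eqVneq y c) xy yz nxy nyz ys => [-> _ _ nxc ncz cs|nyc]; last first.
  by rewrite orbF => /eqP xc /eqP zc; rewrite xc zc eqxx in nxz.
case: s xs cs zs => [|w s] /= xs cs /andP[/adjE]; rewrite eq_sym (negbTE ncz) /=.
  by rewrite (negbTE nxc).
by move=> /eqP wc; rewrite wc inE eqxx in cs.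
Qed.

Definition clique (t : rel U) (B : {set U}) : Prop :=
  {in B &, forall c d, c != d -> t c d}.

Definition star_on (t : rel U) (B : {set U}) (c0 : U) : Prop :=
  c0 \in B /\ {in B &, forall c d, c != d -> t c d = (c == c0) || (d == c0)}.

Lemma card3_pick (B X : {set U}) b : 2 < #|B| -> b \in B -> X \subset B -> b \notin X ->
  exists b1 b2, [/\ b1 \in B, b2 \in B, b1 != b2, b1 != b & b2 != b] /\
    (X != set0 -> b1 \in X).
Proof.
move=> B3 bB /subsetP XB bX.
have R2 : 1 < #|B :\ b| by move: B3; rewrite (cardsD1 b) bB.
have [b1 b1R b1X] : exists2 b1, b1 \in B :\ b & X != set0 -> b1 \in X.
  case: (set_0Vmem X) => [->|[x xX]].
    have /card_gt0P[b1 b1R] : 0 < #|B :\ b| by apply: ltnW.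
    by exists b1 => //; rewrite eqxx.
  exists x => //; rewrite !inE XB // andbT; apply: contraNneq bX => <-.
  by [].
have /card_gt0P[b2] : 0 < #|B :\ b :\ b1| by move: R2; rewrite (cardsD1 b1) b1R.
case/setD1P=> b21 /setD1P[b2b b2B]; case/setD1P: b1R => b1b b1B.
by exists b1, b2; rewrite b1B b2B eq_sym b21 b1b b2b.
Qed.

(* The positions b1 and b2 represent both sides of the cut of the bag at b: rows of
   X are multiples of the row of b1, columns outside X multiples of that of b2. *)
Lemma bag_cut_pick (t : rel U) (B X : {set U}) b :
    clique t B \/ (exists c0, star_on t B c0) ->
    2 < #|B| -> b \in B -> X \subset B -> b \notin X ->
  exists b1 b2, [/\ [/\ b1 \in B, b2 \in B, b1 != b2, b1 != b & b2 != b],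
    t b b1 || t b b2, X != set0 -> b1 \in X,
    forall be, be \in X -> exists sg : bool, forall ga, ga \in B -> ga \notin X ->
      t be ga = sg && t b1 ga &
    forall ga, ga \in B -> ga \notin X -> ga != b -> exists sg : bool,
      t b ga = sg && t b b2 /\ (X != set0 -> t b1 ga = sg && t b1 b2)].
Proof.
move=> ty B3 bB XB bX; have XBs := subsetP XB.
have nX0 be : be \in X -> X != set0 by move=> h; apply/set0Pn; exists be.
have Xneq be ga : be \in X -> ga \notin X -> be != ga.
  by move=> h; apply: contraNneq => <-.
case: ty => [cl|[c0 [c0B st]]].
  have [b1 [b2 [[b1B b2B b12 b1b b2b] b1X]]] := card3_pick B3 bB XB bX.
  exists b1, b2; split=> //; first by rewrite cl // eq_sym.
    move=> be beX; exists true => ga gaB gaX /=.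
    have b1X' := b1X (nX0 be beX).
    by rewrite !cl // ?XBs // ?Xneq //.
  move=> ga gaB gaX gab; exists true; rewrite eq_sym in gab; rewrite eq_sym in b2b.
  by split=> [|X0]; rewrite !cl // ?Xneq // ?b1X.
case: (eqVneq b c0) => [bc|bc].
  subst c0; have [b1 [b2 [[b1B b2B b12 b1b b2b] b1X]]] := card3_pick B3 bB XB bX.
  exists b1, b2; split=> //; first by rewrite st ?eqxx // eq_sym.
    move=> be beX; exists true => ga gaB gaX /=; have b1X' := b1X (nX0 be beX).
    have beb : be != b by apply: Xneq.
    by rewrite !st // ?XBs // ?Xneq // (negbTE beb) (negbTE b1b).
  move=> ga gaB gaX gab; exists true.
  have bg : b != ga by rewrite eq_sym.
  have bb2 : b != b2 by rewrite eq_sym.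
  split=> [|X0]; first by rewrite !st // eqxx.
  by rewrite !st // ?Xneq ?b1X // (negbTE gab) (negbTE b2b).
(* With the center in [X], the other rows of [X] vanish outside [X]; hence [b1] must be the
   center. *)
case: (boolP (c0 \in X)) => c0X.
  have c0b : c0 != b by rewrite eq_sym.
  have /card_gt0P[b2] : 0 < #|B :\ b :\ c0|.
    by move: B3; rewrite (cardsD1 b) bB (cardsD1 c0) !inE c0b c0B.
  case/setD1P=> b2c /setD1P[b2b b2B].
  exists c0, b2; rewrite (eq_sym c0 b2); split=> //; first by rewrite st ?eqxx ?orbT // eq_sym.
    move=> be beX; exists (be == c0) => ga gaB gaX /=.
    have gc : ga != c0 by apply: contraNneq gaX => ->.
    have cg : c0 != ga by rewrite eq_sym.
    rewrite (st c0 ga) // (st be ga) // ?XBs // ?Xneq //.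
    by rewrite eqxx (negbTE gc) orbF andbT.
  have cb2 : c0 != b2 by rewrite eq_sym.
  have bb2 : b != b2 by rewrite eq_sym.
  move=> ga gaB gaX gab; exists true.
  have gc : ga != c0 by apply: contraNneq gaX => ->.
  have bg : b != ga by rewrite eq_sym.
  have cg : c0 != ga by rewrite eq_sym.
  by rewrite !st // eqxx (negbTE bc) (negbTE gc) (negbTE b2c).
(* The center is neither [b] nor in [X]: in the rows considered it is the only nonzero column
   outside [X], so [b2] must be the center. *)
have c0b : c0 != b by rewrite eq_sym.
have [b1 b1R b1X] : exists2 b1, b1 \in B :\ b :\ c0 & X != set0 -> b1 \in X.
  case: (set_0Vmem X) => [->|[x xX]].
    have /card_gt0P[b1 b1R] : 0 < #|B :\ b :\ c0|.
      by move: B3; rewrite (cardsD1 b) bB (cardsD1 c0) !inE c0b c0B.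
    by exists b1 => //; rewrite eqxx.
  by exists x => //; rewrite !inE XBs // andbT !Xneq.
case/setD1P: b1R => b1c /setD1P[b1b b1B].
exists b1, c0; split=> //; first by rewrite (st b c0) // ?eqxx ?orbT.
  move=> be beX; exists true => ga gaB gaX /=; have b1X' := b1X (nX0 be beX).
  have bec : be != c0 by apply: Xneq.
  by rewrite !st // ?XBs // ?Xneq // (negbTE bec) (negbTE b1c).
move=> ga gaB gaX gab; exists (ga == c0).
have bg : b != ga by rewrite eq_sym.
rewrite !(st b) // eqxx (negbTE bc) /= andbT; split=> // X0.
by rewrite !(st b1) // ?Xneq ?b1X // eqxx (negbTE b1c) /= andbT.
Qed.

End Stars.

(** * Limb cut-ranks as ranks of submatrices of the whole graph *)

Section LimbCut.
Variable U : finType.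
Variables (G : graph U) (D : mgraph U).
Hypotheses (G_conn : connected G) (dec : decomposes G D).
Hypothesis bag3 : forall z, z \in verts D -> 2 < #|bag D z|.
Hypothesis bag_type : forall z, z \in verts D ->
  complete (bag_graph D (bag D z)) \/ exists c, star_at (bag_graph D (bag D z)) c.
Implicit Types (b c d x y z m : U) (P Q X : {set U}).

Let wfD : wf D := dec_wf dec.
Let cD := dec_connected dec.
Let bD := dec_bag dec.

Lemma unm_verts x : unmarked_vertex D x = (x \in verts G).
Proof. by rewrite (dec_verts dec) inE. Qed.

Lemma leaf_verts b x : x \in leaves D b -> x \in verts G.
Proof. by rewrite in_leaves -unm_verts => /andP[]. Qed.

Lemma rep_leaf b x : x \in reps D b -> x \in leaves D b.
Proof. exact: (subsetP (reps_leaves wfD b)). Qed.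

Lemma adjGE x y : x \in verts G -> y \in verts G -> adj G x y = linked D x y.
Proof. by move=> xV yV; rewrite (dec_adj dec) // -[_ \in _]/(unmarked_vertex D _) unm_verts. Qed.

Lemma adj_leaves z b b' x y : b \in bag D z -> b' \in bag D z -> b != b' ->
  x \in leaves D b -> y \in leaves D b' ->
  adj G x y = [&& x \in reps D b, y \in reps D b' & uadj D b b'].
Proof.
move=> bB b'B nbb xL yL; rewrite adjGE; try exact: leaf_verts xL; try exact: leaf_verts yL.
exact: (linked_branches wfD bB b'B nbb).
Qed.

Lemma verts_bag_graph z : z \in verts D -> verts (bag_graph D (bag D z)) = bag D z.
Proof. by move=> zV; apply/setIidPr/bag_verts. Qed.

Lemma bag_completeP z : z \in verts D ->
  reflect (clique (uadj D) (bag D z)) (complete (bag_graph D (bag D z))).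
Proof.
move=> zV; apply: (iffP forall_inP) => [H c d cB dB cd|H c].
  rewrite -(verts_bag_graph zV) in cB dB.
  have /forall_inP/(_ d dB)/implyP/(_ cd) := H c cB.
  by rewrite adj_bag_graph => /and3P[].
rewrite verts_bag_graph // => cB; apply/forall_inP => d dB.
by apply/implyP => cd; rewrite adj_bag_graph cB dB H.
Qed.

Lemma bag_starP z c : z \in verts D ->
  reflect (star_on (uadj D) (bag D z) c) (star_at (bag_graph D (bag D z)) c).
Proof.
move=> zV; apply: (iffP idP) => [/star_atP|]; rewrite ?verts_bag_graph //.
  case=> cB E; split=> // d e dB eB de; rewrite -E // adj_bag_graph dB eB //.
case=> cB E; apply: star_atI; rewrite verts_bag_graph //.
by move=> d e dB eB de; rewrite adj_bag_graph dB eB E.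
Qed.

Lemma bag_shape z : z \in verts D ->
  clique (uadj D) (bag D z) \/ exists c, star_on (uadj D) (bag D z) c.
Proof.
move=> zV; case: (bag_type zV) => [/bag_completeP h|[c /bag_starP h]].
  by left; apply: h.
by right; exists c; apply: h.
Qed.

(* For a leaf b of a star the last condition says that b1 or b2 is the center. *)
Definition valid b u1 u2 : Prop := exists b1 b2,
  [/\ [/\ b1 \in bag D b, b2 \in bag D b, b1 != b2, b1 != b & b2 != b],
      u1 \in reps D b1, u2 \in reps D b2 & uadj D b b1 || uadj D b b2].

Lemma validC b u1 u2 : valid b u1 u2 -> valid b u2 u1.
Proof.
case=> b1 [b2 [[b1B b2B b12 b1b b2b] r1 r2 e]]; exists b2, b1.
by rewrite eq_sym orbC.
Qed.

Definition tau b u1 u2 P : nat := rkc (adj G) (u1 |: P) (u2 |: (leaves D b :\: P)).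

Lemma tauC b u1 u2 P : P \subset leaves D b ->
  tau b u1 u2 P = tau b u2 u1 (leaves D b :\: P).
Proof.
move=> PL; rewrite /tau rkc_tr setDDr setDv set0U (setIidPr PL).
by apply: eq_rkc => a c _ _; rewrite adjC.
Qed.

Lemma bag_verts_in b c : b \in verts D -> c \in bag D b -> c \in verts D.
Proof. by move=> bV; apply: (subsetP (bag_verts bV)). Qed.

Section LimbTau.
Variables (b m y : U) (bm : madj D b m) (yR : y \in reps D b).
Let bV : b \in verts D. Proof. by case/adjP: (madj_adj bm). Qed.
Let yL : y \in leaves D b. Proof. exact: rep_leaf. Qed.
Let H := limb_graph D (bag D b) y.

Let vH : verts H = leaves D b.
Proof. exact: (verts_limb wfD bm yL). Qed.

Let leaf_adj a c : a \in leaves D b -> c \in leaves D b -> linked D a c = adj G a c.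
Proof. by move=> aL cL; rewrite adjGE //; apply: leaf_verts; eassumption. Qed.

(** Elimination at the entry [(y, v2)]. Afterwards row [v1] is row [y] of the limb, and any other
    row [a] of [P] is its limb row up to [adj G y a] times row [v1]; so both matrices have the same
    row space. *)
Let center v1 v2 P : P \subset leaves D b -> y \in P -> v1 \notin leaves D b ->
    v2 \notin leaves D b ->
    {in leaves D b, forall c, adj G v1 c = (c \in reps D b)} ->
    {in leaves D b, forall c, adj G v2 c = (c \in reps D b)} -> adj G v1 v2 = false ->
    complete (bag_graph D (bag D b)) = false -> star_at (bag_graph D (bag D b)) b ->
  tau b v1 v2 P = (cutrk H P).+1.
Proof.
move=> PL yP n1 n2 A1 A2 A12 K S; have PLs := subsetP PL.
rewrite cutrk_rkc vH /tau; set Q := leaves D b :\: P.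
have n2Q : (v2 \in Q) = false by rewrite in_setD (negbTE n2) andbF.
have yQ : (y \in Q) = false by rewrite in_setD yP.
have QL c : c \in Q -> c \in leaves D b by case/setDP.
rewrite /rkc (@rk_pivot _ _ y v2); last first.
  by rewrite !in_setU1 yP eqxx orbT adjC A2.
congr _.+1; set F := fun a c => _; set M := fun a c => _.
have F1 c : F v1 c = (c \in Q) && (c \in reps D b).
  rewrite /F !in_setU1 !eqxx A12 /= ?andbF addbF.
  case: (eqVneq c v2) => [->|_] /=; first by rewrite A12 n2Q.
  by case: (boolP (c \in Q)) => //= /QL/A1 ->.
have yv2 : adj G y v2 by rewrite adjC A2.
have Fy c : F y c = false.
  by rewrite /F !in_setU1 eqxx yP yv2 !orbT /= addbb.
have Fa a c : a \in P -> F a c =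
    (c \in Q) && (adj G a c (+) ((a \in reps D b) && adj G y c)).
  move=> aP; rewrite /F !in_setU1 eqxx aP yP !orbT /= (adjC G a v2) A2 ?PLs //.
  case: (eqVneq c v2) => [->|_] /=.
    by rewrite n2Q (adjC G a v2) A2 ?PLs // (adjC G y v2) A2 // yR andbT addbb.
  by case: (c \in Q); rewrite ?andbF.
have Fo a c : a != v1 -> a \notin P -> F a c = false.
  by move=> /negbTE a1 /negbTE aP; rewrite /F !in_setU1 a1 aP.
have My c : M y c = (c \in Q) && (c \in reps D b).
  rewrite /M yP /=; case: (boolP (c \in Q)) => //= cQ.
  rewrite (adj_limb_centery wfD bm yR K S) ?QL //.
  by apply: contraTneq cQ => ->; rewrite yQ.
have Ma a c : a \in P -> a != y -> M a c = (c \in Q) &&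
    (adj G a c (+) ((a \in reps D b) && adj G y c) (+) (adj G y a && (c \in reps D b))).
  move=> aP ay; rewrite /M aP /=; case: (boolP (c \in Q)) => //= cQ.
  have cy : c != y by apply: contraTneq cQ => ->; rewrite yQ.
  have ac : a != c by apply: contraTneq cQ => <-; rewrite in_setD aP.
  have aL := PLs _ aP; have cL := QL _ cQ.
  by rewrite (adj_limb_center wfD bm yR K S) // !leaf_adj.
apply/eqP; rewrite eqn_leq; apply/andP; split; apply: rk_row_comb => a.
  case: (eqVneq a v1) => [->|a1].
    by exists true, false, y, y => c; rewrite F1 My addbF.
  case: (boolP (a \in P)) => aP; last first.
    by exists false, false, y, y => c; rewrite Fo.
  case: (eqVneq a y) => [->|ay].
    by exists false, false, y, y => c; rewrite Fy.
  exists true, (adj G y a), a, y => c; rewrite Fa // Ma // My /=.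
  case: (c \in Q) => //=; last by rewrite andbF.
  by rewrite -addbA addbb addbF.
case: (boolP (a \in P)) => aP; last first.
  by exists false, false, y, y => c; rewrite /M (negbTE aP).
case: (eqVneq a y) => [->|ay].
  by exists true, false, v1, v1 => c; rewrite My F1 addbF.
exists true, (adj G y a), a, v1 => c; rewrite Ma // Fa // F1 /=.
by case: (c \in Q) => //=; rewrite andbF.
Qed.

(* If u1 and u2 are adjacent, pivoting at (u1, u2) leaves the cut matrix of the
   limb; otherwise b is the center of a star and one pivots at y instead. *)
Lemma limb_tau u1 u2 P : valid b u1 u2 -> P \subset leaves D b ->
  tau b u1 u2 P = (cutrk H P).+1.
Proof.
case=> b1 [b2 [[b1B b2B b12 b1b b2b] r1 r2 vb]] PL.
have bb1 : b != b1 by rewrite eq_sym.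
have bb2 : b != b2 by rewrite eq_sym.
have l1 := rep_leaf r1; have l2 := rep_leaf r2.
have A1 c : c \in leaves D b -> adj G u1 c = (c \in reps D b) && uadj D b b1.
  by move=> cL; rewrite adjC (adj_leaves (bag_refl _ _) b1B bb1 cL l1) r1.
have A2 c : c \in leaves D b -> adj G u2 c = (c \in reps D b) && uadj D b b2.
  by move=> cL; rewrite adjC (adj_leaves (bag_refl _ _) b2B bb2 cL l2) r2.
have A12 : adj G u1 u2 = uadj D b1 b2.
  by rewrite (adj_leaves b1B b2B b12 l1 l2) r1 r2.
have notL c u : c \in bag D b -> b != c -> u \in leaves D c -> u \notin leaves D b.
  move=> cB bc; rewrite !in_leaves => /andP[uc _]; apply/negP => /andP[ub _].
  by rewrite (branch_uniq wfD cB ub uc) eqxx in bc.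
have n1 := notL _ _ b1B bb1 l1; have n2 := notL _ _ b2B bb2 l2.
have PLs := subsetP PL.
have bb := bag_refl D b; have b3 := bag3 bV.
have nclique c0 : star_on (uadj D) (bag D b) c0 -> complete (bag_graph D (bag D b)) = false.
  case=> c0B st; apply/negP => /(bag_completeP bV) cl.
  have /card_gt0P[x] : 0 < #|bag D b :\ c0| by move: b3; rewrite (cardsD1 c0) c0B => /ltnW.
  move=> xB; have /card_gt0P[z] : 0 < #|bag D b :\ c0 :\ x|.
    by move: b3; rewrite (cardsD1 c0) c0B (cardsD1 x) xB.
  case/setD1P=> zx /setD1P[zc zB]; case/setD1P: xB => xc xB.
  by have := st _ _ zB xB zx; rewrite cl // (negbTE xc) (negbTE zc).
have t1case a c (aL : a \in leaves D b) (cL : c \in leaves D b) (ac : a != c) : uadj D b1 b2 ->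
    adj H a c = adj G a c (+) (adj G a u2 && adj G u1 c).
  rewrite (adjC G a u2) A2 // A1 // -leaf_adj // => t12.
  have [cl|[c0 st]] := bag_shape bV.
    rewrite (adj_limb_complete wfD bm) //; last exact/(bag_completeP bV).
    by rewrite !cl // !andbT.
  (* Since [b1] and [b2] are adjacent, [b] is a leaf of the star, and at most one of the two
     positions is adjacent to [b]: the correction term vanishes. *)
  have bc0 : b != c0.
    by apply/eqP => e; subst c0; move: t12; case: st => _ ->; rewrite // (negbTE b1b) (negbTE b2b).
  rewrite (adj_limb_leaf wfD bm) ?(nclique _ st) //; last first.
    apply/negP => /(bag_starP b bV)[_ st2]; case: st => c0B st.
    have [x [xB xb xc]] : exists x, [/\ x \in bag D b, x != b & x != c0].
      case: (eqVneq b1 c0) => [e|n]; last by exists b1.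
      by exists b2; split=> //; rewrite -e eq_sym.
    have bx : b != x by rewrite eq_sym.
    by have := st2 _ _ bb xB bx; rewrite eqxx st // (negbTE bc0) (negbTE xc).
  case: st => _ st; rewrite !(st b) // (negbTE bc0) /=.
  case: (eqVneq b1 c0) => [e|]; last by rewrite !andbF addbF.
  by rewrite eq_sym -e (negbTE b12) !andbF addbF.
case t12: (uadj D b1 b2).
  rewrite /tau /rkc (@rk_pivot _ _ u1 u2); last by rewrite !in_setU1 !eqxx A12.
  rewrite cutrk_rkc vH; congr _.+1; apply: eq_rk => a c.
  rewrite !in_setU1 !eqxx /=.
  case: (eqVneq a u1) => [->|au] /=.
    have -> : (u1 \in P) = false by apply: contraNF n1 => /PLs.
    by rewrite A12 t12 addbb.
  case: (boolP (a \in P)) => aP //=; have aL := PLs _ aP.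
  case: (eqVneq c u2) => [->|cu] /=.
    have -> : (u2 \in leaves D b :\: P) = false by rewrite in_setD (negbTE n2) andbF.
    by rewrite A12 t12 andbT addbb.
  case: (boolP (c \in leaves D b :\: P)) => cQ; last by rewrite /= andbF.
  have /setDP[cL cP] := cQ; rewrite /= t1case //.
  by apply: contraNneq cP => <-.
have [cl|[c0 st]] := bag_shape bV; first by rewrite cl in t12.
have [c0B stE] := st.
(* Validity makes [b] adjacent to [b1] or [b2]; as these are not adjacent to each other, [b] is the
   center. *)
have bc0 : b = c0.
  move: t12 vb; rewrite !stE //; case: (eqVneq b1 c0) => //= _ ->.
  by rewrite !orbF orbb => /eqP.
subst c0; have K := nclique _ st; have S : star_at (bag_graph D (bag D b)) b.
  exact/bag_starP.
have B1 : {in leaves D b, forall c, adj G u1 c = (c \in reps D b)}.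
  by move=> c cL; rewrite A1 // stE // eqxx andbT.
have B2 : {in leaves D b, forall c, adj G u2 c = (c \in reps D b)}.
  by move=> c cL; rewrite A2 // stE // eqxx andbT.
have A12' : adj G u1 u2 = false by rewrite A12.
case: (boolP (y \in P)) => yP; first exact: center.
(* Transposing the matrix puts [y] among the rows. *)
rewrite tauC // center ?subsetDl //; last 2 first.
- by rewrite in_setD yP.
- by rewrite adjC.
congr _.+1; rewrite !cutrk_rkc vH rkc_tr setDDr setDv set0U (setIidPr PL).
by apply: eq_rkc => a c _ _; rewrite adjC.
Qed.

End LimbTau.
End LimbCut.

(** * Layouts *)

Section RankMore.
Variable U : finType.
Implicit Types (F : U -> U -> bool) (A P Q X : {set U}).

Lemma rkc_le_rk F P Q : rkc F P Q <= rk F.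
Proof.
apply: (@leq_trans (rk (fun a c => (c \in Q) && F a c))).
  by apply: rk_row1 => a; exists (a \in P), a.
by apply: rk_col1 => c; exists (c \in Q), c.
Qed.

(** Row [y] vanishes on [Q], so elimination at [(y, z)] leaves the block on [P] and [Q]
    unchanged. *)
Lemma rkc_extend F y z P Q : F y z -> {in Q, forall c, F y c = false} ->
  y \notin P -> z \notin Q -> rkc F P Q < rkc F (y |: P) (z |: Q).
Proof.
move=> yz yQ yP zQ; rewrite [X in _ < X]/rkc (@rk_pivot _ _ y z); last first.
  by rewrite !setU11 yz.
rewrite ltnS; set F' := fun a c => _.
rewrite (@eq_rkc _ F F'); first exact: rkc_le_rk.
move=> a c aP cQ; rewrite /F' !in_setU1 aP cQ !orbT /= yQ // !andbF addbF.
by [].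
Qed.

(** Rows in [A] are multiples of row [u] and columns in [B] multiples of column [v]. If [A] is
    empty, row [u] represents nothing, so the columns need not be proportional there. *)
Lemma rkc_shrink F A P B Q u v :
    (forall a, a \in A -> exists sg : bool, {in B :|: Q, forall c, F a c = sg && F u c}) ->
    (forall c, c \in B -> exists sg : bool, {in P, forall a, F a c = sg && F a v} /\
       (A != set0 -> F u c = sg && F u v)) ->
  rkc F (A :|: P) (B :|: Q) <= rkc F (u |: P) (v |: Q).
Proof.
move=> rowA colB.
have step2 (W : {set U}) : (forall c, c \in B -> exists sg : bool, {in W, forall a, F a c = sg && F a v}) ->
    rkc F W (B :|: Q) <= rkc F W (v |: Q).
  move=> h; apply: rk_col1 => c.
  case: (boolP (c \in Q)) => cQ; first by exists true, c => a; rewrite !inE cQ !orbT.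
  case: (boolP (c \in B)) => cB; last first.
    by exists false, c => a; rewrite !inE (negbTE cB) (negbTE cQ) andbF.
  have [sg E] := h c cB; exists sg, v => a; rewrite !inE cB eqxx /=.
  by case: (boolP (a \in W)) => [/E ->|]; rewrite ?andbF.
case: (eqVneq A set0) => [A0|A0].
  rewrite A0 set0U; apply: leq_trans (rkc_sub _ (subsetUr _ _) (subxx _)).
  by apply: step2 => c /colB[sg [h _]]; exists sg.
apply: (@leq_trans (rkc F (u |: P) (B :|: Q))); last first.
  apply: step2 => c /colB[sg [h hu]]; exists sg => a /setU1P[->|/h //].
  exact: hu.
apply: rk_row1 => a; case: (boolP (a \in P)) => aP.
  by exists true, a => c; rewrite in_setU in_setU1 aP !orbT.
case: (boolP (a \in A)) => aA; last first.
  by exists false, a => c; rewrite in_setU (negbTE aA) (negbTE aP).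
have [sg E] := rowA a aA; exists sg, u => c; rewrite in_setU aA setU11 /=.
by case: (boolP (c \in B :|: Q)) => [/E ->|]; rewrite ?andbF.
Qed.

End RankMore.

Section SeqSets.
Variable U : finType.
Implicit Types (s : seq U) (L : {set U}).

Lemma take_filter_ex (p : pred U) s i :
  exists j, take i (filter p s) = filter p (take j s).
Proof.
elim: s i => [|x s IH] i /=; first by exists 0.
case px: (p x); last by have [j ->] := IH i; exists j.+1; rewrite /= px.
case: i => [|i]; first by exists 0.
by have [j E] := IH i; exists j.+1; rewrite /= px E.
Qed.

Lemma set_filter s L : [set:: [seq x <- s | x \in L]] = [set:: s] :&: L.
Proof. by apply/setP => x; rewrite !inE mem_filter andbC. Qed.

Lemma set_take_sub s i : [set:: take i s] \subset [set:: s].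
Proof. by apply/subsetP => x; rewrite !inE; apply: mem_take. Qed.

Lemma set_take_mono s i j : i <= j -> [set:: take i s] \subset [set:: take j s].
Proof. by move=> ij; rewrite -(take_takel s ij) set_take_sub. Qed.

End SeqSets.

Section Layouts.
Variable U : finType.
Variables (G : graph U) (D : mgraph U).
Hypotheses (G_conn : connected G) (dec : decomposes G D).
Hypothesis bag3 : forall z, z \in verts D -> 2 < #|bag D z|.
Hypothesis bag_type : forall z, z \in verts D ->
  complete (bag_graph D (bag D z)) \/ exists c, star_at (bag_graph D (bag D z)) c.
Implicit Types (b c d x y z m : U) (A P Q X : {set U}).

Let wfD : wf D := dec_wf dec.
Let cD := dec_connected dec.
Let bD := dec_bag dec.

(** For marked [b], the value of [f_D] at the component hanging at [b]. *)
Definition limb_width b : nat := limb_lrw D (bag D b) (branch D b :\ b).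

Lemma leaves_cover z x : z \in verts D -> x \in verts G ->
  exists2 b, b \in bag D z & x \in leaves D b.
Proof.
move=> zV; rewrite -(unm_verts dec) => ux.
have [b bB xb] := bag_branch_cover cD zV (unmarked_verts ux).
by exists b => //; rewrite in_leaves xb.
Qed.

Lemma leaves_uniq z b b' x : b \in bag D z -> b' \in bag D z ->
  x \in leaves D b -> x \in leaves D b' -> b = b'.
Proof.
move=> bB b'B; rewrite !in_leaves => /andP[xb _] /andP[xb' _].
by apply: (branch_uniq wfD _ xb xb'); rewrite (bag_eq bB).
Qed.

Lemma leavesV b : leaves D b \subset verts G.
Proof. by apply/subsetP => x; apply: leaf_verts. Qed.

Lemma rep_ex b : b \in verts D -> exists x, x \in reps D b.
Proof. exact: reps_neq0. Qed.

Lemma valid_ex b : b \in verts D -> exists u1 u2, valid D b u1 u2.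
Proof.
(* With an empty [X] only the adjacency of [b] to one of the two positions matters. *)
move=> bV; have [] := bag_cut_pick (bag_shape bag_type bV) (bag3 bV) (bag_refl D b) (sub0set _).
  by rewrite inE.
move=> b1 [b2 [[b1B b2B b12 b1b b2b] e _ _ _]].
have [u1 r1] := rep_ex (bag_verts_in bV b1B); have [u2 r2] := rep_ex (bag_verts_in bV b2B).
by exists u1, u2, b1, b2.
Qed.

Lemma valid_notin b u1 u2 : valid D b u1 u2 ->
  [/\ u1 \in verts G, u2 \in verts G, u1 \notin leaves D b & u2 \notin leaves D b].
Proof.
case=> b1 [b2 [[b1B b2B b12 b1b b2b] r1 r2 e]].
have l1 := rep_leaf dec r1; have l2 := rep_leaf dec r2.
split; try exact: leaf_verts l1; try exact: leaf_verts l2.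
  by apply: contra b1b => l; rewrite (leaves_uniq b1B (bag_refl D b) l1 l).
by apply: contra b2b => l; rewrite (leaves_uniq b2B (bag_refl D b) l2 l).
Qed.

(** The vertex picked by [limb_lrw] is represented by some vertex of the bag; as it lies in the
    branch of [b], this vertex is [b]. *)
Lemma limb_width_lrw b m : madj D b m -> exists2 y, y \in reps D b &
  limb_width b = lrw (limb_graph D (bag D b) y).
Proof.
move=> bm; have [bV _ _] := adjP (madj_adj bm).
have brep w y : w \in bag D b -> y \in branch D b -> represents D w y -> y \in reps D b.
  move=> wB yb; rewrite representsE // in_reps => /andP[-> wy] /=.
  by rewrite (branch_uniq wfD wB yb (hop_branch wfD wy)).
rewrite /limb_width /limb_lrw; case: pickP => [y /= /andP[/setD1P[_ yb] /existsP[w]]|none].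
  by case/and3P=> wB _ wy; exists y => //; apply: brep wB yb wy.
have [y yR] := rep_ex bV; have := none y.
have yL := rep_leaf dec yR; move: (yL) (yR); rewrite in_leaves in_reps => /andP[yb uy] /andP[_ by_].
have nyb : y != b by apply: contraTneq uy => ->; apply/negP => ub; have := unmarkedN m ub; rewrite bm.
rewrite in_setD1 nyb yb /= => /negbT/existsPn/(_ b)/negP[].
rewrite bag_refl representsE // uy by_ andbT /=.
by rewrite /marked_vertex bV /= andbT; apply/existsP; exists m.
Qed.

Lemma limb_width_leP b m u1 u2 j : madj D b m -> valid D b u1 u2 ->
  limb_width b <= j <-> exists s, [/\ uniq s, [set:: s] = leaves D b &
             forall i, tau G D b u1 u2 [set:: take i s] <= j.+1].
Proof.
move=> bm vb; have [y yR ->] := limb_width_lrw bm.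
have vH : verts (limb_graph D (bag D b) y) = leaves D b.
  exact: (verts_limb wfD bm (rep_leaf dec yR)).
split=> [/lrw_leP[s]|[s]].
  case=> /andP[us /eqP ss] w; rewrite vH in ss; exists s; split=> // i.
  by rewrite (limb_tau dec bag3 bag_type bm yR) ?ltnS // -ss set_take_sub.
case=> us ss w; apply/lrw_leP; exists s; rewrite /layout us vH ss eqxx; split=> // i.
rewrite -ltnS -(limb_tau dec bag3 bag_type bm yR vb); first exact: w.
by rewrite -ss set_take_sub.
Qed.

(** Both values are one more than the cut-rank of the same limb. This allows changing the outer pair
    from cut to cut. *)
Lemma tauD b m u1 u2 v1 v2 P : madj D b m -> valid D b u1 u2 -> valid D b v1 v2 ->
  P \subset leaves D b -> tau G D b u1 u2 P = tau G D b v1 v2 P.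
Proof.
move=> bm vu vv PL; have [bV _ _] := adjP (madj_adj bm); have [y yR] := rep_ex bV.
by rewrite !(limb_tau dec bag3 bag_type bm yR).
Qed.

Lemma tau0 b m u1 u2 : madj D b m -> valid D b u1 u2 -> tau G D b u1 u2 set0 = 1.
Proof.
move=> bm vb; have [bV _ _] := adjP (madj_adj bm); have [y yR] := rep_ex bV.
by rewrite (limb_tau dec bag3 bag_type bm yR) ?sub0set // cutrk0.
Qed.

Lemma tauT b m u1 u2 : madj D b m -> valid D b u1 u2 -> tau G D b u1 u2 (leaves D b) = 1.
Proof.
move=> bm vb; rewrite tauC // setDv; apply: tau0 bm _.
exact: validC.
Qed.

(* With the right choice of the outer vertices, the cut matrix of the smaller limb
   is a submatrix of that of the larger one. *)
Lemma limb_width_mono b m c mc : madj D b m -> c \in bag D m -> c != m -> madj D c mc ->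
  limb_width c <= limb_width b.
Proof.
move=> bm cB cm cmc; have mb : madj D m b by rewrite madjC.
have [bV mV _] := adjP (madj_adj bm); have cV := bag_verts_in mV cB.
have bagc : bag D c = bag D m by apply: bag_eq.
have lcb : leaves D c \subset leaves D b.
  apply/subsetP => x xc; rewrite (leaves_mate wfD cD mb) in_setD in_set (unm_verts dec).
  rewrite (leaf_verts dec xc) andbT; apply: contra cm => xm.
  by rewrite (leaves_uniq cB (bag_refl D m) xc xm).
have mc' : m != c by rewrite eq_sym.
have m0 : [set m] != set0 by apply/set0Pn; exists m; rewrite inE.
(* A third position [d] next to [c] and [m]: its representative [x] is outside the limb at [c] but a
   vertex of the limb at [b]. *)
have [d [dB dm dc e]] : exists d, [/\ d \in bag D m, d != m, d != c & uadj D c m || uadj D c d].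
  have [] := bag_cut_pick (t := uadj D) (B := bag D m) (X := [set m]) (b := c).
  - exact: bag_shape.
  - exact: bag3.
  - by [].
  - by rewrite sub1set bag_refl.
  - by rewrite inE.
  move=> b1 [d [[b1B dB b1d b1c dc] e b1m _ _]]; exists d; split=> //.
    by apply: contraNneq b1d => ->; have := b1m m0; rewrite inE.
  by have := b1m m0; rewrite inE => /eqP <-.
have [x xR] := rep_ex (bag_verts_in mV dB).
have xb : x \in leaves D b.
  have xd := rep_leaf dec xR.
  rewrite (leaves_mate wfD cD mb) in_setD in_set (unm_verts dec) (leaf_verts dec xd) andbT.
  by apply: contra dm => xm; rewrite (leaves_uniq dB (bag_refl D m) xd xm).
have xc : x \notin leaves D c.
  by apply: contra dc => xc; rewrite (leaves_uniq dB cB (rep_leaf dec xR) xc).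
(* A vertex [u] represented by [m] lies outside both limbs and serves in both pairs. *)
have [u [v [uv uR]]] : exists u v, valid D b u v /\ u \in reps D m.
  have [u1 [u2 vb]] := valid_ex bV; have vb' := validC vb.
  case: (vb) => b1 [b2 [[b1B b2B b12 b1b b2b] r1 r2 /orP[e1|e2]]].
    by exists u1, u2; split=> //; rewrite (reps_mate wfD bm); apply/existsP; exists b1; rewrite e1.
  by exists u2, u1; split=> //; rewrite (reps_mate wfD bm); apply/existsP; exists b2; rewrite e2.
have vcux : valid D c u x by exists m, d; rewrite bagc bag_refl dB eq_sym dm mc' dc.
have vcxu := validC vcux.
have /(limb_width_leP _ bm uv)[s [us ss w]] := leqnn (limb_width b).
apply/(limb_width_leP _ cmc vcux); exists [seq z <- s | z \in leaves D c].
split; first exact: filter_uniq.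
  by rewrite set_filter ss (setIidPr lcb).
move=> i; have [j ->] := take_filter_ex (mem (leaves D c)) s i.
rewrite set_filter; set P := [set:: take j s]; apply: leq_trans (w j); rewrite -/P.
have sub1 : leaves D c :\: (P :&: leaves D c) \subset leaves D b :\: P.
  by apply/subsetP => z; rewrite !in_setD !in_setI => /andP[+ zc]; rewrite zc andbT => -> /=; apply: (subsetP lcb).
have PL : P :&: leaves D c \subset leaves D c by apply: subsetIr.
have Pb : P \subset leaves D b by rewrite -ss set_take_sub.
(* The vertex [x] must be a row if it lies in [P] and a column otherwise; in the first case both
   pairs are swapped. *)
case: (boolP (x \in P)) => xP.
  rewrite (tauD cmc vcux vcxu) // (tauD bm uv (validC uv)) //; apply: rkc_sub.
    by rewrite subUset sub1set !in_setU1 xP orbT /= subsetU // subsetIl orbT.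
  by rewrite setUS.
apply: rkc_sub; first by rewrite setUS // subsetIl.
rewrite subUset sub1set in_setU1 in_setD xP xb orbT /=.
by rewrite subsetU // sub1 orbT.
Qed.

Lemma cutrkC P : P \subset verts G -> cutrk G (verts G :\: P) = cutrk G P.
Proof.
move=> PV; rewrite !cutrk_rkc rkc_tr setDDr setDv set0U (setIidPr PV).
by apply: eq_rkc => a c _ _; rewrite adjC.
Qed.

Lemma diff_leaves b P : leaves D b :\: (P :&: leaves D b) \subset verts G :\: P.
Proof.
apply/subsetP => z; rewrite !in_setD in_setI => /andP[+ zb].
by rewrite zb andbT => ->; apply: (subsetP (leavesV b)).
Qed.

Lemma tau_le_cutrk_sides b u1 u2 P : u1 \in P -> u2 \in verts G -> u2 \notin P ->
  tau G D b u1 u2 (P :&: leaves D b) <= cutrk G P.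
Proof.
move=> u1P u2V u2P; rewrite cutrk_rkc; apply: rkc_sub.
  by rewrite subUset sub1set u1P subsetIl.
by rewrite subUset sub1set in_setD u2P u2V diff_leaves.
Qed.

(** At most one of the two outer vertices, in suitable order, is on the wrong side of the cut;
    removing its row or column costs at most one. *)
Lemma tau_le_cutrkS b P : b \in verts D -> exists u1 u2, valid D b u1 u2 /\
  tau G D b u1 u2 (P :&: leaves D b) <= (cutrk G P).+1.
Proof.
move=> bV; have [u1 [u2 vb]] := valid_ex bV; have [u1V u2V _ _] := valid_notin vb.
case: (boolP (u2 \in P)) => u2P.
  case: (boolP (u1 \in P)) => u1P; last first.
    exists u2, u1; split; first exact: validC.
    by apply: leqW; apply: tau_le_cutrk_sides.
  exists u1, u2; split=> //; rewrite cutrk_rkc.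
  apply: leq_trans (rkc_addr _ _ _ _) _; rewrite ltnS; apply: rkc_sub.
    by rewrite subUset sub1set u1P subsetIl.
  exact: diff_leaves.
exists u1, u2; split=> //; rewrite cutrk_rkc.
apply: leq_trans (rkc_addl _ _ _ _) _; rewrite ltnS; apply: rkc_sub.
  exact: subsetIl.
by rewrite subUset sub1set in_setD u2P u2V diff_leaves.
Qed.

Lemma edge_exit X x y : x \in X -> x \in verts G -> y \in verts G -> y \notin X ->
  exists c d, [/\ c \in X, d \notin X & adj G c d].
Proof.
move=> xX xV yV yX; have /connectP[p] := connectedP _ G_conn x y xV yV.
elim: p x xX {xV} => [|d p IH] x xX /=; first by move=> _ e; rewrite e xX in yX.
case/andP=> xd dp yl; case: (boolP (d \in X)) => dX; first exact: IH dX dp yl.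
by exists x, d.
Qed.

(* If all representatives of other positions are outside P while x is in P, then
   some edge yz inside the leaves of another position leaves P, and the row of y
   adds one to the rank. *)
Lemma tau_le_cutrk_oneside b P x : b \in verts D ->
  (forall d, d \in bag D b -> d != b -> {in reps D d, forall u, u \notin P}) ->
  x \in verts G -> x \in P -> x \notin leaves D b -> exists u1 u2, valid D b u1 u2 /\
  tau G D b u1 u2 (P :&: leaves D b) <= cutrk G P.
Proof.
move=> bV repQ xV xP xL; have [b' b'B xb'] := leaves_cover bV xV.
have b'b : b' != b by apply: contraNneq xL => <-.
have bb' : b != b' by rewrite eq_sym.
have [u0 u0R] := rep_ex (bag_verts_in bV b'B).
have u0P := repQ _ b'B b'b _ u0R.
have xX : x \in P :&: leaves D b' by rewrite inE xP.
have u0X : u0 \notin P :&: leaves D b' by rewrite inE negb_and u0P.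
have [y [z [yX zX yz]]] := edge_exit xX xV (leaf_verts dec (rep_leaf dec u0R)) u0X.
move: yX; rewrite in_setI => /andP[yP yb'].
have yR : y \notin reps D b' by apply: contraL yP; apply: repQ.
have [_ zV _] := adjP yz.
(* Being in [P], the vertex [y] is no representative, so all its neighbors hang at [b']. *)
have nadj c d : c \in bag D b -> c != b' -> d \in leaves D c -> adj G y d = false.
  move=> cB cb' dc; rewrite eq_sym in cb'.
  by rewrite (adj_leaves dec b'B cB cb' yb' dc) (negbTE yR).
have zb' : z \in leaves D b'.
  have [d dB zd] := leaves_cover bV zV; case: (eqVneq d b') => [<- //|db'].
  by rewrite (nadj d) in yz.
have zP : z \notin P by apply: contra zX => zP; rewrite inE zP.
(* The pair is ordered so that [u2] does not hang at [b'], which makes row [y] vanish at column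
   [u2]. *)
have [u1 [u2 [b2 [vb b2B b2b b2b' u2R]]]] : exists u1 u2 b2,
    [/\ valid D b u1 u2, b2 \in bag D b, b2 != b, b2 != b' & u2 \in reps D b2].
  have [u1 [u2 vb]] := valid_ex bV; have vb' := validC vb.
  case: (vb) => b1 [b2 [[b1B b2B b12 b1b b2b] r1 r2 e]].
  case: (eqVneq b2 b') => [e'|n]; last by exists u1, u2, b2.
  by exists u2, u1, b1; split=> //; rewrite -e'.
exists u1, u2; split=> //; have u2L := rep_leaf dec u2R.
have u2P := repQ _ b2B b2b _ u2R.
(* Dropping row [u1], possibly on the wrong side, loses at most one; row [y] and column [z] win it
   back. *)
apply: leq_trans (rkc_addl _ _ _ _) _; rewrite cutrk_rkc.
apply: leq_trans (rkc_extend yz _ _ _) _.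
- move=> c /setU1P[->|]; first exact: (nadj b2).
  by case/setDP=> cb _; apply: (nadj b); rewrite ?bag_refl.
- by rewrite inE yP /=; apply: contra b'b => yb; rewrite (leaves_uniq b'B (bag_refl D b) yb' yb).
- rewrite in_setU1 in_setD negb_or; apply/andP; split.
    by apply: contra b2b' => /eqP e; rewrite (leaves_uniq b2B b'B u2L) // -e.
  rewrite negb_and; apply/orP; right.
  by apply: contra b'b => zb; rewrite (leaves_uniq b'B (bag_refl D b) zb' zb).
apply: rkc_sub; first by rewrite subUset sub1set yP subsetIl.
rewrite !subUset !sub1set !in_setD zP zV u2P (leaf_verts dec u2L) /=.
exact: diff_leaves.
Qed.

(** Fix a position [c] adjacent to [b]. If some representatives of [c] and of a third position are
    separated by the cut, they form a suitable pair. Otherwise all representatives of other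
    positions are on one side, and the previous lemma applies to [P] or to its complement. *)
Lemma tau_le_cutrk b P x x' : b \in verts D -> P \subset verts G ->
  x \in P -> x \notin leaves D b -> x' \in verts G -> x' \notin P -> x' \notin leaves D b ->
  exists u1 u2, valid D b u1 u2 /\ tau G D b u1 u2 (P :&: leaves D b) <= cutrk G P.
Proof.
move=> bV PV xP xL x'V x'P x'L.
have [c [cB cb bc]] : exists c, [/\ c \in bag D b, c != b & uadj D b c].
  have [_ [_ [b1 [b2 [[b1B b2B _ b1b b2b] _ _ /orP[e|e]]]]]] := valid_ex bV.
    by exists b1.
  by exists b2.
have vcd d u v : d \in bag D b -> d != b -> d != c -> u \in reps D c -> v \in reps D d ->
    valid D b u v.
  by move=> dB db dc uc vd; exists c, d; rewrite cB dB eq_sym dc cb db bc.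
have repV d u : u \in reps D d -> u \in verts G by move/(rep_leaf dec)/(leaf_verts dec).
case: (boolP [exists u in reps D c, exists d in bag D b, exists v in reps D d,
    [&& d != b, d != c & (u \in P) != (v \in P)]]).
  case/exists_inP=> u uc /exists_inP[d dB /exists_inP[v vd /and3P[db dc]]].
  have vuv := vcd d u v dB db dc uc vd.
  case: (boolP (u \in P)) => uP; case: (boolP (v \in P)) => // vP _.
    by exists u, v; split=> //; apply: tau_le_cutrk_sides => //; apply: repV vd.
  by exists v, u; split; [apply: validC | apply: tau_le_cutrk_sides => //; apply: repV uc].
rewrite negb_exists_in => /forall_inP same.
have same' u v d : u \in reps D c -> d \in bag D b -> v \in reps D d -> d != b -> d != c ->
    (u \in P) = (v \in P).
  move=> uc dB vd db dc; apply/eqP; apply: contraNT (same u uc) => uv.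
  by apply/exists_inP; exists d => //; apply/exists_inP; exists v; rewrite // db dc.
have [u0 u0c] := rep_ex (bag_verts_in bV cB).
have [d0 [d0B d0b d0c]] : exists d, [/\ d \in bag D b, d != b & d != c].
  have b3 := bag3 bV; have /card_gt0P[d] : 0 < #|bag D b :\ b :\ c|.
    by move: b3; rewrite (cardsD1 b) bag_refl (cardsD1 c) in_setD1 cb cB.
  by case/setD1P=> dc /setD1P[db dB]; exists d.
have [v0 v0d] := rep_ex (bag_verts_in bV d0B).
have all d u : d \in bag D b -> d != b -> u \in reps D d -> (u \in P) = (u0 \in P).
  move=> dB db ud; case: (eqVneq d c) => [e|dc]; last by rewrite -(same' u0 u d).
  by subst d; rewrite (same' u v0 d0) // (same' u0 v0 d0).
case: (boolP (u0 \in P)) => u0P; last first.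
  apply: (@tau_le_cutrk_oneside b P x) => //; last exact: (subsetP PV).
  by move=> d dB db u ud; rewrite (all d).
have [] := @tau_le_cutrk_oneside b (verts G :\: P) x' bV _ x'V _ x'L.
- by move=> d dB db u ud; rewrite in_setD (all d u) // u0P.
- by rewrite in_setD x'P.
move=> u1 [u2 [vb le]]; exists u2, u1; split; first exact: validC.
rewrite tauC ?subsetIr // -(cutrkC PV); apply: leq_trans le.
rewrite leq_eqVlt; apply/orP; left; apply/eqP; congr (tau _ _ _ _ _ _).
apply/setP => z; rewrite !(in_setD, in_setI).
case: (boolP (z \in leaves D b)) => [zb|]; rewrite ?andbF // !andbT.
by rewrite (leaf_verts dec zb) andbT.
Qed.

(** * From a layout of the graph to the limbs *)

Section Forward.
Variables (k : nat) (s : seq U).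
Hypotheses (ls : layout G s) (ws : forall i, cutrk G [set:: take i s] <= k).

Let us : uniq s. Proof. by case/andP: ls. Qed.
Let ss : [set:: s] = verts G. Proof. by case/andP: ls => _ /eqP. Qed.
Let sP i : [set:: take i s] \subset verts G.
Proof. by rewrite -ss set_take_sub. Qed.

(** Otherwise the layout restricted to the leaves of [b] would be a layout of the limb of width at
    most [j]. By [tauD] the excess holds for every valid pair at once. *)
Lemma limb_width_cut b m j : madj D b m -> ~~ (limb_width b <= j) ->
  exists i, forall u1 u2, valid D b u1 u2 ->
    j.+1 < tau G D b u1 u2 ([set:: take i s] :&: leaves D b).
Proof.
move=> bm nle; have [bV _ _] := adjP (madj_adj bm); have [u1 [u2 vb]] := valid_ex bV.
have : ~~ [forall i : 'I_(size s).+1, tau G D b u1 u2 ([set:: take i s] :&: leaves D b) <= j.+1].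
  apply: contra nle => /forallP h; apply/(limb_width_leP _ bm vb).
  exists [seq x <- s | x \in leaves D b]; split; first exact: filter_uniq.
    by rewrite set_filter ss (setIidPr (leavesV b)).
  move=> i; have [i' ->] := take_filter_ex (mem (leaves D b)) s i.
  rewrite set_filter; case: (ltnP i' (size s).+1) => hi; first exact: (h (Ordinal hi)).
  rewrite take_oversize; last exact: ltnW.
  by have := h ord_max; rewrite /= take_size.
rewrite negb_forall => /existsP[i]; rewrite -ltnNge => hi; exists i => v1 v2 vv.
by rewrite (tauD bm vv vb) // subsetIr.
Qed.

Lemma limb_width_le b m : madj D b m -> limb_width b <= k.
Proof.
move=> bm; have [bV _ _] := adjP (madj_adj bm); apply: contraT => /(limb_width_cut bm)[i h].
have [u1 [u2 [vb le]]] := tau_le_cutrkS [set:: take i s] bV.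
by have := leq_trans (h u1 u2 vb) le; rewrite ltnS ltnNge ws.
Qed.

(** Take a cut whose [tau] exceeds [k]. It splits the leaves of [b], as otherwise [tau] would be 1,
    and it cannot split the vertices outside, by [tau_le_cutrk]. *)
Lemma limb_width_side b m : 0 < k -> madj D b m -> limb_width b = k ->
  exists i, let P := [set:: take i s] in
    [/\ (exists2 x, x \in leaves D b & x \in P), (exists2 x, x \in leaves D b & x \notin P) &
     {in verts G :\: leaves D b, forall x, x \in P} \/
     {in verts G :\: leaves D b, forall x, x \notin P}].
Proof.
move=> k0 bm wk; have [bV _ _] := adjP (madj_adj bm).
have [] := @limb_width_cut b m k.-1 bm; first by rewrite wk -ltnNge prednK.
move=> i; rewrite prednK // => h; exists i => /=; set P := [set:: take i s] in h *.
have [u1 [u2 vb]] := valid_ex bV; have h0 := h u1 u2 vb.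
split.
- case: (set_0Vmem (P :&: leaves D b)) => [e|[x]]; last by rewrite in_setI => /andP[xP xb]; exists x.
  by move: h0; rewrite e (tau0 bm vb) ltnS leqn0 => /eqP k00; rewrite k00 in k0.
- case: (set_0Vmem (leaves D b :\: P)) => [/eqP e|[x]]; last by rewrite in_setD => /andP[xP xb]; exists x.
  rewrite setD_eq0 in e; move: h0; rewrite (setIidPr e) (tauT bm vb) ltnS leqn0 => /eqP k00.
  by rewrite k00 in k0.
case: (boolP [forall x in verts G :\: leaves D b, x \in P]) => [/forall_inP|]; first by left.
rewrite negb_forall_in => /exists_inP[x' /setDP[x'V x'L] x'P]; right=> x /setDP[xV xL].
apply/negP => xP; have [v1 [v2 [vv le]]] := tau_le_cutrk bV (sP i) xP xL x'V x'P x'L.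
by have := leq_trans (h _ _ vv) le; rewrite ltnNge ws.
Qed.

Lemma limb_width_three z b1 b2 b3 m1 m2 m3 : 0 < k ->
  [/\ b1 \in bag D z, b2 \in bag D z & b3 \in bag D z] ->
  [/\ b1 != b2, b2 != b3 & b3 != b1] ->
  [/\ madj D b1 m1, madj D b2 m2 & madj D b3 m3] ->
  [/\ limb_width b1 = k, limb_width b2 = k & limb_width b3 = k] -> False.
Proof.
move=> k0 [B1 B2 B3] [n12 n23 n31] [M1 M2 M3] [W1 W2 W3].
have other b b' x : b \in bag D z -> b' \in bag D z -> b != b' -> x \in leaves D b ->
    x \in verts G :\: leaves D b'.
  move=> bB b'B nbb xb; rewrite in_setD (leaf_verts dec xb) andbT.
  by apply: contra nbb => xb'; rewrite (leaves_uniq bB b'B xb xb').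
have [i1 /= [in1 out1 d1]] := limb_width_side k0 M1 W1.
have [i2 /= [in2 out2 d2]] := limb_width_side k0 M2 W2.
have [i3 /= [in3 out3 d3]] := limb_width_side k0 M3 W3.
have up b b' i i' : b \in bag D z -> b' \in bag D z -> b != b' -> i <= i' ->
    (exists2 x, x \in leaves D b' & x \notin [set:: take i' s]) ->
    {in verts G :\: leaves D b, forall x, x \in [set:: take i s]} -> False.
  move=> bB b'B nbb ii [x xb xP] h; case/negP: xP.
  by apply: (subsetP (set_take_mono s ii)); apply: h; apply: other xb; rewrite // eq_sym.
have down b b' i i' : b \in bag D z -> b' \in bag D z -> b != b' -> i <= i' ->
    (exists2 x, x \in leaves D b & x \in [set:: take i s]) ->
    {in verts G :\: leaves D b', forall x, x \notin [set:: take i' s]} -> False.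
  move=> bB b'B nbb ii [x xb xP] h; have := h x (other _ _ _ bB b'B nbb xb).
  by rewrite (subsetP (set_take_mono s ii)).
(* The prefix at [j] contains a leaf of [a], caught by the earlier cut, and misses a leaf of [c],
   missed by the later one; so it does separate vertices outside the leaves of [b]. Below, every
   order of the three cuts has such a middle one. *)
have mid a b c i j l : a \in bag D z -> b \in bag D z -> c \in bag D z -> a != b -> b != c ->
    i <= j -> j <= l ->
    (exists2 x, x \in leaves D a & x \in [set:: take i s]) ->
    (exists2 x, x \in leaves D c & x \notin [set:: take l s]) ->
    {in verts G :\: leaves D b, forall x, x \in [set:: take j s]} \/
    {in verts G :\: leaves D b, forall x, x \notin [set:: take j s]} -> False.
  move=> aB bB cB ab bc ij jl ina outc [h|h]; first exact: up bB cB bc jl outc h.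
  exact: down aB bB ab ij ina h.
have n21 : b2 != b1 by rewrite eq_sym.
have n32 : b3 != b2 by rewrite eq_sym.
have n13 : b1 != b3 by rewrite eq_sym.
case/orP: (leq_total i1 i2) => h12; case/orP: (leq_total i2 i3) => h23;
  case/orP: (leq_total i1 i3) => h13.
- exact: mid B1 B2 B3 n12 n23 h12 h23 in1 out3 d2.
- exact: mid B1 B2 B3 n12 n23 h12 h23 in1 out3 d2.
- exact: mid B1 B3 B2 n13 n32 h13 h23 in1 out2 d3.
- exact: mid B3 B1 B2 n31 n12 h13 h12 in3 out2 d1.
- exact: mid B2 B1 B3 n21 n13 h12 h13 in2 out3 d1.
- exact: mid B2 B3 B1 n23 n31 h23 h13 in2 out1 d3.
- exact: mid B3 B2 B1 n32 n21 h23 h12 in3 out1 d2.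
- exact: mid B3 B2 B1 n32 n21 h23 h12 in3 out1 d2.
Qed.

End Forward.

(** * From limb widths to a layout of the graph *)

Definition branch_union X : {set U} := \bigcup_(b in X) leaves D b.

Lemma in_branch_union z X b x : X \subset bag D z -> b \in bag D z -> x \in leaves D b ->
  (x \in branch_union X) = (b \in X).
Proof.
move=> /subsetP XB bB xb; apply/bigcupP/idP => [[c cX xc]|bX]; last by exists b.
by rewrite (leaves_uniq bB (XB _ cX) xb xc).
Qed.

Lemma branch_union_bag z : z \in verts D -> branch_union (bag D z) = verts G.
Proof.
move=> zV; apply/setP => x; apply/bigcupP/idP => [[b _]|xV]; first exact: leaf_verts.
by have [b bB xb] := leaves_cover zV xV; exists b.
Qed.

Lemma branch_union_opposite b m : madj D b m ->
  branch_union (bag D b :\ b) = leaves D m.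
Proof.
move=> bm; have [bV _ _] := adjP (madj_adj bm).
apply/setP => x; rewrite (leaves_mate wfD cD bm) in_setD in_set (unm_verts dec).
apply/bigcupP/andP => [[c /setD1P[cb cB] xc]|[xb xV]].
  rewrite (leaf_verts dec xc); split=> //; apply: contra cb => xb.
  by rewrite (leaves_uniq cB (bag_refl D b) xc xb).
have [c cB xc] := leaves_cover bV xV; exists c => //; rewrite in_setD1 cB andbT.
by apply: contraNneq xb => <-.
Qed.

(** Whole branches in front of the cut contribute multiples of the row of one vertex [u1], those
    behind it multiples of the column of one vertex [u2]. Appending the leaves of [b] is thus
    measured by [tau]. *)
Lemma cutrk_union b X P : b \in verts D -> X \subset bag D b -> b \notin X ->
  P \subset leaves D b -> exists u1 u2, valid D b u1 u2 /\
  cutrk G (branch_union X :|: P) <= tau G D b u1 u2 P.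
Proof.
move=> bV XB bX PL; have XBs := subsetP XB; have PLs := subsetP PL.
have [b1 [b2 [[b1B b2B b12 b1b b2b] e b1X rowX colX]]] :=
  bag_cut_pick (bag_shape bag_type bV) (bag3 bV) (bag_refl D b) XB bX.
have [u1 r1] := rep_ex (bag_verts_in bV b1B); have [u2 r2] := rep_ex (bag_verts_in bV b2B).
have l1 := rep_leaf dec r1; have l2 := rep_leaf dec r2.
exists u1, u2; split; first by exists b1, b2.
pose X' := bag D b :\: (b |: X).
have X'B : X' \subset bag D b by apply: subsetDl.
have b2b1 := b12; rewrite eq_sym in b2b1.
have bb1 := b1b; rewrite eq_sym in bb1; have bb2 := b2b; rewrite eq_sym in bb2.
have X'E c : c \in X' -> [/\ c \in bag D b, c \notin X & c != b].
  by rewrite in_setD in_setU1 negb_or => /andP[/andP[-> ->] ->].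
have PN x : x \in P -> x \notin branch_union X.
  by move=> /PLs xb; rewrite (in_branch_union XB (bag_refl D b) xb).
have EQ : verts G :\: (branch_union X :|: P) = branch_union X' :|: (leaves D b :\: P).
  apply/setP => x; rewrite in_setD !in_setU in_setD.
  apply/andP/orP => [[]|].
    rewrite negb_or => /andP[xX xP] xV; have [c cB xc] := leaves_cover bV xV.
    rewrite (in_branch_union XB cB xc) in xX.
    rewrite (in_branch_union X'B cB xc) in_setD in_setU1 negb_or xX cB !andbT xP.
    by case: (eqVneq c b) xc => [->|] xc; [right | left].
  case=> [/bigcupP[c /X'E[cB cX cb] xc]|/andP[xP xb]]; last first.
    rewrite (in_branch_union XB (bag_refl D b) xb) (negbTE bX) xP.
    by rewrite (leaf_verts dec xb).
  rewrite (in_branch_union XB cB xc) (negbTE cX) (leaf_verts dec xc).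
  by split=> //; apply: contra cb => /PLs xb; rewrite (leaves_uniq cB (bag_refl D b) xc xb).
rewrite cutrk_rkc EQ; apply: rkc_shrink => [a /bigcupP[be beX ab]|c /bigcupP[ga gaX cb]].
  have beB := XBs _ beX; have [sg E] := rowX be beX.
  have X0 : X != set0 by apply/set0Pn; exists be.
  exists ((a \in reps D be) && sg) => c; rewrite in_setU => cc.
  have [ga [gaB gaX cga]] : exists ga, [/\ ga \in bag D b, ga \notin X & c \in leaves D ga].
    case/orP: cc => [/bigcupP[ga /X'E[gaB gaX _] cga]|/setDP[cb _]]; first by exists ga.
    by exists b; rewrite bag_refl.
  have nbg : be != ga by apply: contraNneq gaX => <-.
  have n1g : b1 != ga by apply: contraNneq gaX => <-; apply: b1X.
  rewrite (adj_leaves dec beB gaB nbg ab cga) (adj_leaves dec b1B gaB n1g l1 cga) r1 E //=.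
  by case: (_ \in _); case: (_ \in _); case: sg {E}.
have [gaB gaNX gab] := X'E _ gaX; have [sg [E1 E2]] := colX ga gaB gaNX gab.
have bga : b != ga by rewrite eq_sym.
exists ((c \in reps D ga) && sg); split=> [a aP|X0].
  have ab := PLs _ aP.
  rewrite (adj_leaves dec (bag_refl D b) gaB bga ab cb).
  rewrite (adj_leaves dec (bag_refl D b) b2B bb2 ab l2) r2 E1 /=.
  by case: (_ \in _); case: (_ \in _); case: sg {E1 E2}.
have AX0 : X != set0.
  by apply: contraNneq X0 => ->; rewrite /branch_union big_set0.
have n1g : b1 != ga by apply: contraNneq gaNX => <-; apply: b1X.
rewrite (adj_leaves dec b1B gaB n1g l1 cb) (adj_leaves dec b1B b2B b12 l1 l2) r1 r2 E2 //=.
by rewrite andbA.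
Qed.

Lemma leaves_proper b m c : madj D b m -> c \in bag D m -> c != m ->
  leaves D c \proper leaves D b.
Proof.
move=> bm cB cm; have [bV mV _] := adjP (madj_adj bm).
have mb : madj D m b by rewrite madjC.
have lcb d : d \in bag D m -> d != m -> leaves D d \subset leaves D b.
  move=> dB dm; apply/subsetP => x xd.
  rewrite (leaves_mate wfD cD mb) in_setD in_set (unm_verts dec) (leaf_verts dec xd) andbT.
  by apply: contra dm => xm; rewrite (leaves_uniq dB (bag_refl D m) xd xm).
rewrite properE lcb //=.
have /card_gt0P[d] : 0 < #|bag D m :\ m :\ c|.
  by have := bag3 mV; rewrite (cardsD1 m) bag_refl (cardsD1 c) in_setD1 cm cB.
case/setD1P=> dc /setD1P[dm dB].
have [x /(rep_leaf dec) xd] := rep_ex (bag_verts_in mV dB).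
apply/subsetPn; exists x; first exact: (subsetP (lcb d dB dm)).
by apply: contra dc => xc; rewrite (leaves_uniq dB cB xd xc).
Qed.

Section Backward.
Variables (k : nat) (k0 : 0 < k).

(** Ranks are taken in the whole of [G], so an order of [A] can be continued to a layout of [G]. *)
Definition ordered (A : {set U}) : Prop := exists s,
  [/\ uniq s, [set:: s] = A & forall i, cutrk G [set:: take i s] <= k].

(** The bound [k] on [tau] means limb width at most [k - 1] if [b] is marked; an unmarked [b] has no
    limb and is included. All valid pairs are covered since [cutrk_union] chooses the pair for each
    prefix. *)
Definition good b : Prop := exists s, [/\ uniq s, [set:: s] = leaves D b &
  forall u1 u2 i, valid D b u1 u2 -> tau G D b u1 u2 [set:: take i s] <= k].

Lemma good_unmarked b : unmarked_vertex D b -> good b.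
Proof.
move=> ub; have E := leaves_unmarked ub; exists [:: b]; split=> //.
  by rewrite E; apply/setP => x; rewrite !inE.
move=> u1 u2 i _; apply: leq_trans k0; rewrite /tau E.
have [e|e] : [set:: take i [:: b]] = set0 \/ [set:: take i [:: b]] = [set b].
- by case: i => [|i]; [left | right]; apply/setP => x; rewrite /= ?take0 !inE.
- by rewrite e; apply: leq_trans (rkc_addl _ _ _ _) _; rewrite rkc0l.
by rewrite e setDv; apply: leq_trans (rkc_addr _ _ _ _) _; rewrite rkc0r.
Qed.

Lemma good_marked b m : madj D b m -> limb_width b <= k.-1 -> good b.
Proof.
move=> bm; have [bV _ _] := adjP (madj_adj bm); have [u1 [u2 vb]] := valid_ex bV.
case/(limb_width_leP _ bm vb)=> s [us ss w]; exists s; split=> // v1 v2 i vv.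
rewrite (tauD bm vv vb) -?ss ?set_take_sub //.
by have := w i; rewrite prednK.
Qed.

Lemma ordered0 : ordered set0.
Proof.
have e : [set:: [::]] = set0 :> {set U} by apply/setP => x; rewrite !inE.
by exists [::]; split=> // i; case: i => [|i]; rewrite /= e cutrk0.
Qed.

Lemma ordered_step b X : b \in verts D -> X \subset bag D b -> b \notin X ->
  ordered (branch_union X) -> good b -> ordered (branch_union (b |: X)).
Proof.
move=> bV XB bX [s [us ss ws]] [t [ut tt wt]]; exists (s ++ t); split.
- rewrite cat_uniq us ut andbT /=; apply/hasPn => x xt; apply/negP => xs.
  have xb : x \in leaves D b by rewrite -tt inE.
  have : x \in branch_union X by rewrite -ss inE.
  by rewrite (in_branch_union XB (bag_refl D b) xb) (negbTE bX).
- rewrite /branch_union bigcup_setU big_set1 -/(branch_union X) -ss -tt.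
  by apply/setP => x; rewrite !inE mem_cat orbC.
move=> i; case: (leqP i (size s)) => hi.
  by rewrite takel_cat.
rewrite take_cat ltnNge (ltnW hi) /= (_ : [set:: _] = branch_union X :|: [set:: take (i - size s) t]).
  have PL : [set:: take (i - size s) t] \subset leaves D b by rewrite -tt set_take_sub.
  have [u1 [u2 [vb le]]] := cutrk_union bV XB bX PL.
  by apply: leq_trans le (wt _ _ _ vb).
by apply/setP => x; rewrite -ss !inE mem_cat.
Qed.

Lemma ordered_bag z X (Y : {set U}) : z \in verts D -> X \subset Y -> Y \subset bag D z ->
  ordered (branch_union X) -> (forall b, b \in Y -> b \notin X -> good b) ->
  ordered (branch_union Y).
Proof.
move=> zV; move sz: #|Y :\: X| => n; elim: n X sz => [|n IH] X sz XY YB oX gY.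
  move/eqP: sz; rewrite cards_eq0 setD_eq0 => YX.
  by have -> : Y = X by apply/eqP; rewrite eqEsubset YX XY.
have /card_gt0P[b /setDP[bY bX]] : 0 < #|Y :\: X| by rewrite sz.
have bB := subsetP YB _ bY; have bV := bag_verts_in zV bB.
apply: (IH (b |: X)) => //.
- apply/eqP; rewrite -eqSS -sz (cardsD1 b (Y :\: X)) in_setD bY bX add1n eqSS.
  by rewrite setDDl setUC.
- by rewrite subUset sub1set bY.
- apply: ordered_step => //; last exact: gY.
  by rewrite (bag_eq bB); apply: subset_trans XY YB.
by move=> c cY; rewrite in_setU1 negb_or => /andP[_]; apply: gY.
Qed.

Hypothesis width_le : forall b m, madj D b m -> limb_width b <= k.
Hypothesis width_two : forall z b1 b2 b3 m1 m2 m3,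
  [/\ b1 \in bag D z, b2 \in bag D z & b3 \in bag D z] ->
  [/\ b1 != b2, b2 != b3 & b3 != b1] ->
  [/\ madj D b1 m1, madj D b2 m2 & madj D b3 m3] ->
  [/\ limb_width b1 = k, limb_width b2 = k & limb_width b3 = k] -> False.

Lemma good_not_k b : b \in verts D -> (forall m, madj D b m -> limb_width b <> k) -> good b.
Proof.
move=> bV nk; case: (boolP (unmarked_vertex D b)) => [|]; first exact: good_unmarked.
rewrite negb_and bV negbK => /existsP[m bm]; apply: (good_marked bm).
have := width_le bm; rewrite leq_eqVlt => /orP[/eqP /(nk m bm) //|].
by rewrite -{1}(prednK k0) ltnS.
Qed.

(** The leaves of [m] are laid out, those of [b] remain. In the bag of [m], which counts as one
    position of width [k], at most one further position [c] has width [k]. The other positions are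
    appended and the walk crosses the marked edge of [c], beyond which fewer leaves remain; without
    such a [c] the bag is completed. *)
Lemma ordered_walk b m : madj D b m -> ordered (leaves D m) -> limb_width m = k ->
  ordered (verts G).
Proof.
elim: {b}#|leaves D b| {-2}b (leqnn #|leaves D b|) m => [|n IH] b sz m bm om wm.
  have [bV _ _] := adjP (madj_adj bm); have [x /(rep_leaf dec)] := rep_ex bV.
  by move: sz; rewrite leqn0 => /eqP/cards0_eq ->; rewrite inE.
have [bV mV _] := adjP (madj_adj bm); have mb : madj D m b by rewrite madjC.
have om1 : ordered (branch_union [set m]) by rewrite /branch_union big_set1.
have mB : [set m] \subset bag D m by rewrite sub1set bag_refl.
case: (boolP [exists c in bag D m, exists m', [&& c != m, madj D c m' & limb_width c == k]]).
  case/exists_inP=> c cB /existsP[m' /and3P[cm cm' /eqP wc]].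
  have m'c : madj D m' c by rewrite madjC.
  have mc : m != c by rewrite eq_sym.
  have bagc : bag D c = bag D m by apply: bag_eq.
  have sz' : #|leaves D c| <= n.
    by rewrite -ltnS; apply: leq_trans sz; apply: proper_card; apply: leaves_proper bm cB cm.
  have om' : ordered (leaves D m').
    rewrite -(branch_union_opposite cm') bagc.
    apply: (@ordered_bag m [set m] _ mV) => //.
    - by rewrite sub1set in_setD1 mc bag_refl.
    - exact: subsetDl.
    move=> d /setD1P[dc dB]; rewrite in_set1 => dm.
    apply: good_not_k; first exact: bag_verts_in mV dB.
    move=> md dmd wd; have cd : c != d by rewrite eq_sym.
    exact: (@width_two m m c d b m' md (And3 (bag_refl D m) cB dB) (And3 mc cd dm)
      (And3 mb cm' dmd) (And3 wm wc wd)).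
  have wm' : limb_width m' = k.
    (* The limb at [m'] contains the one at [m], so by monotonicity its width is again [k]. *)
    apply/eqP; rewrite eqn_leq (width_le m'c) -{1}wm /=.
    by apply: (limb_width_mono m'c _ mc mb); rewrite bagc bag_refl.
  exact: (IH c sz' m' cm' om' wm').
rewrite negb_exists_in => /forall_inP nc; rewrite -(branch_union_bag mV).
apply: (@ordered_bag m [set m]) => // c cB; rewrite in_set1 => cm.
apply: good_not_k; first exact: bag_verts_in mV cB.
move=> m' cm' wc; have /existsPn/(_ m') := nc c cB.
by rewrite cm cm' wc eqxx.
Qed.

Lemma ordered_verts : ordered (verts G).
Proof.
case: (set_0Vmem (verts D)) => [V0|[z zV]].
  suff -> : verts G = set0 by apply: ordered0.
  apply/setP => x; rewrite in_set0 -(unm_verts dec); apply/negP => /unmarked_verts.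
  by rewrite V0 inE.
pose K := [pred b | [exists m, madj D b m] && (limb_width b == k)].
case: (pickP K) => [b0 b0K|nK].
  (* A position of width [k] with fewest leaves: the positions beyond its marked edge have fewer, so
     none has width [k] and they can be laid out from the empty order. *)
  case: (arg_minnP (fun b => #|leaves D b|) b0K) => b /andP[/existsP[m bm] /eqP wb] bmin.
  have [bV mV _] := adjP (madj_adj bm); have mb : madj D m b by rewrite madjC.
  apply: (ordered_walk mb) => //.
  rewrite -(branch_union_opposite mb).
  apply: (@ordered_bag m set0) => //; try exact: sub0set; try exact: subsetDl.
    by rewrite /branch_union big_set0; apply: ordered0.
  move=> c /setD1P[cm cB] _; apply: good_not_k; first exact: bag_verts_in mV cB.
  move=> m' cm' wc; have Kc : K c.
    by rewrite /= wc eqxx andbT; apply/existsP; exists m'.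
  have := bmin c Kc; rewrite leqNgt => /negP; apply; apply: proper_card.
  exact: leaves_proper bm cB cm.
rewrite -(branch_union_bag zV); apply: (@ordered_bag z set0) => //; try exact: sub0set.
  by rewrite /branch_union big_set0; apply: ordered0.
move=> b bB _; apply: good_not_k; first exact: bag_verts_in zV bB.
move=> m bm wb; have : K b by rewrite /= wb eqxx andbT; apply/existsP; exists m.
by rewrite nK.
Qed.

End Backward.
End Layouts.

(** * Distance heredity and splits *)

Section Distance.
Variable U : finType.
Implicit Types (x y z u v w a b c d e s : U) (V X Y S : {set U}) (r : rel U) (G H : graph U).

(** The bound by [#|U|] certifies that [dist] is a true distance and not the default value of a
    failed search. *)
Lemma dist_le G x p : path (adj G) x p ->
  dist G x (last x p) <= size p /\ dist G x (last x p) < #|U|.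
Proof.
move=> pp.
have [q [qq ql uq sz]] : exists q, [/\ path (adj G) x q, last x q = last x p,
    uniq (x :: q) & size q <= size p].
  case: (shortenP pp) => q qq uq sub; exists q; split=> //.
  by apply: (uniq_leq_size _ sub); case/andP: uq.
have qU : size q < #|U| by have := max_card (mem (x :: q)); rewrite (card_uniqP uq).
have le : dist G x (last x p) <= size q.
  rewrite leqNgt; apply/negP => lt; have := before_find 0 lt.
  rewrite nth_iota ?add0n //= => /negbT/existsPn/(_ (in_tuple q)).
  by rewrite qq ql eqxx.
by split; [apply: leq_trans le sz | apply: leq_ltn_trans le qU].
Qed.

Lemma dist_path G x y : dist G x y < #|U| ->
  exists p, [/\ path (adj G) x p, last x p = y & size p = dist G x y].
Proof.
move=> h; have hs : has (fun n => [exists p : n.-tuple U, path (adj G) x p && (last x p == y)])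
  (iota 0 #|U|) by rewrite has_find size_iota.
have := nth_find 0 hs; rewrite -[find _ _]/(dist G x y) nth_iota // add0n.
case/existsP=> p /andP[pp /eqP pl]; exists p; split=> //.
by rewrite size_tuple.
Qed.

Definition restrict r X : rel U := fun a b => [&& a \in X, b \in X & r a b].

(* Distance heredity for relations, in terms of walks, so that it can be carried
   from G to a bag of D along an embedding. *)
Definition walk_hereditary r V : Prop := forall X, X \subset V ->
  {in X &, forall x y, connect (restrict r X) x y} ->
  forall x p, x \in X -> last x p \in X -> path r x p ->
  exists q, [/\ path (restrict r X) x q, last x q = last x p & size q <= size p].

Lemma distance_hereditary_walk G : distance_hereditary G -> walk_hereditary (adj G) (verts G).
Proof.
move=> dh X XV cX x p xX yX pp.
have vX : verts (induced G X) = X by apply/setIidPr.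
have aX : adj (induced G X) =2 restrict (adj G) X by move=> a b; rewrite adj_induced.
have cI : connected (induced G X).
  by apply/connectedP => a b; rewrite vX (eq_connect aX); apply: cX.
have [le lt] := dist_le pp.
have dE := dh X XV cI x _ xX yX; rewrite -dE in lt.
have [q [qq ql qs]] := dist_path lt; exists q; split=> //.
  by rewrite -(eq_path aX).
by rewrite qs dE.
Qed.

Lemma path_restrict r X x p : path r x p -> {subset x :: p <= X} ->
  path (restrict r X) x p.
Proof.
elim: p x => //= d p IH x /andP[xd dp] sub.
rewrite /restrict xd !sub ?inE ?eqxx ?orbT //=; apply: IH => // z zp.
by apply: sub; rewrite inE zp orbT.
Qed.

Lemma path_restrict_sub r X x p : path (restrict r X) x p -> {subset p <= X}.
Proof.
elim: p x => //= d p IH x /andP[/and3P[_ dX _] dp] z.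
by rewrite inE => /orP[/eqP -> //|]; apply: IH dp z.
Qed.

Lemma sub_path_restrict r X x p : path (restrict r X) x p -> path r x p.
Proof. by apply: sub_path => a b /and3P[]. Qed.

Lemma connect_walk r x p : symmetric r -> path r x p ->
  {in [set:: x :: p] &, forall a b, connect (restrict r [set:: x :: p]) a b}.
Proof.
move=> sr pp; have symR : connect_sym (restrict r [set:: x :: p]).
  by apply: sym_connect_sym => a b; rewrite /restrict sr andbCA.
have fromx a : a \in [set:: x :: p] -> connect (restrict r [set:: x :: p]) x a.
  rewrite inE => ap; move: pp; case/splitPl: ap => p1 p2 al.
  rewrite cat_path => /andP[pp1 _]; apply/connectP; exists p1 => //.
  apply: path_restrict => // z; rewrite !inE mem_cat => /orP[->//|->]; by rewrite orbT.
by move=> a b aX bX; apply: connect_trans (fromx b bX); rewrite symR fromx.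
Qed.

(** * Distance levels around a vertex and the split they yield *)

Section WalkHereditary.
Variables (H : graph U) (cH : connected H) (wH : walk_hereditary (adj H) (verts H)).

(** Heredity applied to the connected set of vertices of [t]: a short walk [p] elsewhere forces an
    equally short one using only vertices of [t]. *)
Lemma walk_short x t p : x \in verts H -> path (adj H) x t -> path (adj H) x p ->
  last x p = last x t -> exists q, [/\ path (adj H) x q, {subset q <= x :: t},
    last x q = last x t & size q <= size p].
Proof.
move=> xV xt xp e; pose X := [set:: x :: t].
have XV : X \subset verts H.
  apply/subsetP => z; rewrite inE in_cons => /orP[/eqP -> //|].
  elim: t x {e xp X xV} xt => //= d t IH x /andP[/adjP[_ dV _] dt].
  by rewrite inE => /orP[/eqP -> //|]; apply: IH dt.
have xX : x \in X by rewrite inE mem_head.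
have lX : last x p \in X by rewrite e inE mem_last.
have [q [qq ql qs]] := wH XV (connect_walk (@adjC _ H) xt) xX lX xp.
exists q; split=> //; [exact: sub_path_restrict qq | | by rewrite ql].
by move=> z /(path_restrict_sub qq); rewrite inE.
Qed.

Variables (u : U) (uV : u \in verts H).
Let lv v := dist H u v.

Lemma lv_path v : v \in verts H -> exists p, [/\ path (adj H) u p, last u p = v & size p = lv v].
Proof.
move=> vV; apply: dist_path; have /connectP[p pp ->] := connectedP _ cH u v uV vV.
by have [] := dist_le pp.
Qed.

Lemma lv_le p : path (adj H) u p -> lv (last u p) <= size p.
Proof. by case/dist_le. Qed.

Lemma lv_adj v w : adj H v w -> lv w <= (lv v).+1.
Proof.
move=> vw; have [vV _ _] := adjP vw; have [p [pp pl ps]] := lv_path vV.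
have := @lv_le (rcons p w); rewrite last_rcons size_rcons ps; apply.
by rewrite rcons_path pp pl.
Qed.

Lemma lv_u : lv u = 0.
Proof. by apply/eqP; rewrite -leqn0; apply: (@lv_le [::]). Qed.

Lemma lv0 v : v \in verts H -> lv v = 0 -> v = u.
Proof. by move=> vV e; have [p [_ pl ps]] := lv_path vV; rewrite e in ps; rewrite -pl (size0nil ps). Qed.

Lemma lv_pred v j : v \in verts H -> lv v = j.+1 -> exists s, adj H s v /\ lv s = j.
Proof.
move=> vV e; have [p] := lv_path vV; rewrite e.
case/lastP: p => [|p w]; first by case.
rewrite last_rcons rcons_path size_rcons => -[/andP[pp lw] wE [sz]].
exists (last u p); split; first by rewrite -wE.
apply/eqP; rewrite eqn_leq -{1}sz lv_le //=.
by rewrite -ltnS -e -wE lv_adj.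
Qed.

(* Otherwise a shortest path from u to s followed by the walk t, which stays above
   the level of s, contains no shortest path from u to the end of t. *)
Lemma lv_low s t : path (adj H) s t -> {in t, forall z, lv s < lv z} -> t != [::] ->
  lv (last s t) = (lv s).+1 -> adj H s (last s t).
Proof.
move=> st tl t0 le; have sV : s \in verts H.
  by case: t st t0 {tl le} => //= d t /andP[/adjP[]].
have [p [pp pl ps]] := lv_path sV.
have ut : path (adj H) u (p ++ t) by rewrite cat_path pp pl.
set w := last s t in le *.
have wV : w \in verts H.
  case/lastP: t st t0 @w {tl le ut} => // t w; rewrite rcons_path last_rcons /=.
  by move=> /andP[_ /adjP[]].
have [p' [pp' pl' ps']] := lv_path wV.
have [q [qq qsub ql qs]] : exists q, [/\ path (adj H) u q, {subset q <= u :: p ++ t},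
    last u q = w & size q <= lv w].
  have [|q [qq qsub ql qs]] := walk_short uV ut pp'; first by rewrite pl' last_cat pl.
  by exists q; split=> //; [rewrite ql last_cat pl | rewrite -ps'].
rewrite le in qs; case/lastP: q qq ql qsub qs => [|q d] /=.
  by move=> _ e; move: le; rewrite -e lv_u.
rewrite rcons_path last_rcons size_rcons ltnS => /andP[qq zw] e qsub qs; subst d.
set z := last u q in zw.
have zle : lv z <= lv s by apply: leq_trans qs; apply: lv_le.
have zge : lv s <= lv z by rewrite -ltnS -le lv_adj.
suff -> : s = z by [].
have : z \in u :: p ++ t.
  rewrite /z; case/lastP: q {qq zw qs zle zge} @z qsub => [|q d] /=; first by rewrite mem_head.
  by rewrite last_rcons => qsub; apply: qsub; rewrite mem_rcons inE mem_rcons mem_head orbT.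
rewrite -cat_cons mem_cat => /orP[|/tl]; last by rewrite ltnNge zle.
move=> zp; move: pp pl ps; case/splitPl: zp zle zge => p1 p2 zl zle zge.
rewrite cat_path last_cat => /andP[pp1 _]; case: p2 => [|d p2]; first by rewrite zl.
rewrite size_cat /= => _ sz; have := lv_le pp1; rewrite zl => h.
by have := leq_trans zge h; rewrite -sz addnS ltnNge leq_addr.
Qed.


Lemma lv_low2 s a w : adj H s a -> adj H a w -> lv a = (lv s).+1 -> lv w = (lv s).+1 ->
  adj H s w.
Proof.
move=> sa aw ea ew; have := @lv_low s [:: a; w]; apply=> //=.
- by rewrite sa aw.
- by move=> z; rewrite !inE => /orP[]/eqP ->; rewrite ?ea ?ew.
Qed.

Lemma lv_low3 s a x w : adj H s a -> adj H a x -> adj H x w ->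
  lv a = (lv s).+1 -> lv s < lv x -> lv w = (lv s).+1 -> adj H s w.
Proof.
move=> sa ax xw ea ex ew; have := @lv_low s [:: a; x; w]; apply=> //=.
- by rewrite sa ax xw.
- by move=> z; rewrite !inE => /or3P[]/eqP ->; rewrite ?ea ?ew.
Qed.

(* Otherwise x b c d is an induced path of length 3, but x a d has length 2. *)
Lemma walk_hereditary4 x a b c d : adj H x b -> adj H b c -> adj H c d ->
  ~~ adj H x c -> ~~ adj H x d -> x != d -> adj H x a -> adj H a d -> adj H b d.
Proof.
move=> xb bc cd xc xd nxd xa ad; have [xV _ _] := adjP xb.
have [] := @walk_short x [:: b; c; d] [:: a; d] xV _ _ erefl; rewrite /= ?xb ?bc ?cd ?xa ?ad //.
case=> [|z [|z' [|z'' q]]] [] //=.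
- by move=> _ _ e; rewrite e eqxx in nxd.
- by rewrite andbT => xz _ e; rewrite -e xz in xd.
case/and3P=> xz zz' _ /(_ z); rewrite !inE eqxx => /(_ isT) zin e _; subst z'.
case/or4P: zin => /eqP zE; subst z.
- by rewrite adj_irr in xz.
- by [].
- by rewrite xz in xc.
by rewrite xz in xd.
Qed.

Lemma walk_hereditary5 x a b c e y : adj H x b -> adj H b c -> adj H c e -> adj H e y ->
  ~~ adj H x c -> ~~ adj H x e -> ~~ adj H x y -> x != y -> adj H x a -> adj H a y -> adj H b y.
Proof.
move=> xb bc ce ey xc xe xy nxy xa ay; have [xV _ _] := adjP xb.
have [] := @walk_short x [:: b; c; e; y] [:: a; y] xV _ _ erefl;
  rewrite /= ?xb ?bc ?ce ?ey ?xa ?ay //.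
case=> [|z [|z' [|z'' q]]] [] //=.
- by move=> _ _ h; rewrite h eqxx in nxy.
- by rewrite andbT => xz _ h; rewrite -h xz in xy.
case/and3P=> xz zz' _ /(_ z); rewrite !inE eqxx => /(_ isT) zin h _; subst z'.
case/or4P: zin => [/eqP zE|/eqP zE|/eqP zE|/orP[]/eqP zE]; subst z => //.
- by rewrite adj_irr in xz.
- by rewrite xz in xc.
- by rewrite xz in xe.
by rewrite xz in xy.
Qed.

(** Consider the vertices farthest from [u]. If two of them are adjacent, a component of this level
    is one part, for its vertices have the same neighbors below. Otherwise, for a farthest [x] of
    least degree, all neighbors of [x] agree outside [x] and its neighborhood [S]; then [x |: S] is
    one part, or, if only [u] is left over, the twins [u] and [x]. *)
Lemma level_split b0 : b0 \in verts H -> b0 != u -> ~~ adj H u b0 -> 3 < #|verts H| ->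
  exists X Y X' Y', split_via H X Y X' Y'.
Proof.
move=> b0V b0u ub0 H4.
have symH a c : adj H a c = adj H c a by apply: adjC.
have [t tV tmax] : exists2 t, t \in verts H & {in verts H, forall w, lv w <= lv t}.
  by case: (arg_maxnP lv b0V) => t tV tmax; exists t.
set k := lv t in tmax.
have k2 : 1 < k.
  rewrite ltnNge; apply/negP => k1; have := leq_trans (tmax b0 b0V) k1.
  case e: (lv b0) => [|[|j]] // _; first by rewrite (lv0 b0V e) eqxx in b0u.
  have [s [sb s0]] := lv_pred b0V e; have [sV _ _] := adjP sb.
  by rewrite -(lv0 sV s0) sb in ub0.
have ut v : lv v = k -> v != u.
  by move=> e; apply: contraTneq k2 => vu; rewrite -e vu lv_u.
have nbr v w : adj H v w -> lv v = k -> lv w = k \/ lv w = k.-1.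
  move=> vw e; have [_ wV _] := adjP vw; have := tmax w wV; rewrite leq_eqVlt.
  case/orP=> [/eqP ->|lt]; [by left | right].
  have wv : adj H w v by rewrite symH.
  have := lv_adj wv; rewrite e => le; apply/eqP; rewrite eqn_leq -ltnS prednK; last exact: ltnW.
  by rewrite lt -ltnS prednK // ltnW.
have k1E : k.-1.+1 = k by rewrite prednK // ltnW.
case: (boolP [exists x, exists x', [&& lv x == k, lv x' == k & adj H x x']]).
  case/existsP=> x /existsP[x' /and3P[/eqP xk /eqP x'k xx']].
  have [xV x'V nxx'] := adjP xx'.
  pose r a c := [&& lv a == k, lv c == k & adj H a c].
  pose C := [set c | connect r x c].
  have symr : connect_sym r by apply: sym_connect_sym => a c; rewrite /r andbCA symH.
  have CP c : c \in C -> c \in verts H /\ lv c = k.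
    rewrite inE => /connectP[p]; elim/last_ind: p => [|p d _]; first by move=> _ ->.
    rewrite rcons_path last_rcons => /andP[_ /and3P[_ /eqP dk /adjP[_ dV _]]] ->.
    by [].
  have sameN c s : c \in C -> lv s = k.-1 -> adj H c s = adj H x s.
    rewrite inE => xc sk; rewrite ![adj H _ s]symH.
    (* An edge within the top level carries adjacency to [s] from one end to the other, by
       [lv_low2]. *)
    have cl : closed r [pred v | adj H s v].
      apply: intro_closed; first exact: symr.
      move=> a d /and3P[/eqP ak /eqP dk ad]; rewrite !inE => sa.
      by apply: lv_low2 sa ad _ _; rewrite ?ak ?dk sk k1E.
    by have := closed_connect cl xc; rewrite !inE => ->.
  have [s [sx sk]] : exists s, adj H s x /\ lv s = k.-1 by apply: lv_pred; rewrite ?k1E.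
  have [sV _ _] := adjP sx.
  exists C, (verts H :\: C), C, [set z in verts H | (lv z == k.-1) && adj H x z].
  have CV : C \subset verts H by apply/subsetP => c /CP[].
  have lowC z : lv z = k.-1 -> z \notin C.
    move=> e; apply/negP => /CP[_ e']; move: k2; rewrite -k1E -e' e.
    by move/eqP: e'; rewrite e -[in X in _ == X]k1E -{1}[k.-1]addn0 -addn1 eqn_add2l.
  have uC : u \notin C by apply/negP => /CP[_ /ut]; rewrite eqxx.
  split; split=> //.
  - by rewrite -{1}(setIidPr CV) setID.
  - by rewrite disjoints_subset; apply/subsetP => c cC; rewrite in_setC in_setD cC.
  - apply/card_gt1P; exists x, x'; split=> //; first by rewrite inE connect0.
    by rewrite inE connect1 // /r xk x'k !eqxx.
  - apply/card_gt1P; exists u, s; split=> //; rewrite ?in_setD ?uC ?uV ?sV ?lowC //.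
    apply: contraTneq k2 => us; move: sk; rewrite -us lv_u => k0.
    by rewrite -k1E -k0.
  - apply/subsetP => z; rewrite in_set in_setD => /and3P[-> /eqP zk _].
    by rewrite lowC.
  - by apply/set0Pn; exists x; rewrite inE connect0.
  - by apply/set0Pn; exists s; rewrite inE sV sk eqxx symH.
  move=> c z cC /setDP[zV zC]; rewrite cC inE zV /=.
  have [cV ck] := CP c cC; case: (boolP (lv z == k.-1)) => [/eqP zk|zk] /=.
    exact: sameN.
  apply/negP => cz; case: (nbr _ _ cz ck) => zk'; last by rewrite zk' eqxx in zk.
  case/negP: zC; rewrite inE in cC; rewrite inE; apply: connect_trans cC (connect1 _).
  by rewrite /r ck zk' eqxx.
move=> indep.
have topN v w : lv v = k -> lv w = k -> adj H v w = false.
  move=> vk wk; apply: contraNF indep => vw; apply/existsP; exists v; apply/existsP; exists w.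
  by rewrite vk wk !eqxx.
have nbrT v w : lv v = k -> adj H v w -> lv w = k.-1.
  by move=> vk vw; case: (nbr _ _ vw vk) => // wk; rewrite topN in vw.
pose N v := [set z | adj H v z].
(* Least degree ensures that a top vertex whose neighbors all lie in [S] is adjacent to all of
   [S]. *)
have [x [xV xk xmin]] : exists x, [/\ x \in verts H, lv x = k &
    forall v, v \in verts H -> lv v = k -> #|N x| <= #|N v|].
  pose T := [pred v | (v \in verts H) && (lv v == k)].
  have tT : T t by rewrite /= tV eqxx.
  case: (arg_minnP (fun v => #|N v|) tT) => x /andP[xV /eqP xk] xmin.
  by exists x; split=> // v vV vk; apply: xmin; rewrite /= vV vk eqxx.
set S := N x in xmin.
have SP a : a \in S -> [/\ adj H x a, lv a = k.-1 & a \in verts H].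
  by rewrite inE => xa; split=> //; [apply: nbrT xa | case/adjP: xa].
have [s0 s0S] : exists s0, s0 \in S.
  have [s [sx _]] := lv_pred xV (etrans xk (esym k1E)).
  by exists s; rewrite inE symH.
have k2E : k.-2.+1 = k.-1 by rewrite prednK // -ltnS k1E.
have lowS a : a \in S -> exists c, adj H c a /\ lv c = k.-2.
  by case/SP=> _ ak aV; apply: lv_pred; rewrite // k2E.
have k2lt : k.-2 < k by rewrite k2E leq_pred.
(* The walk [c], [a], [x], [b] stays above the level of [c] after its start, so [lv_low3]
   applies. *)
have lowall a c b : a \in S -> b \in S -> adj H c a -> lv c = k.-2 -> adj H c b.
  move=> /SP[xa ak _] /SP[xb bk _] ca ck.
  have ax : adj H a x by rewrite symH.
  by apply: lv_low3 ca ax xb _ _ _; rewrite ?ak ?bk ck ?xk ?k2lt ?k2E.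
have kk2 : k.-2 <> k.-1 by move=> e; have := ltnn k.-1; rewrite -{2}k2E e ltnS leqnn.
have nxc c : lv c = k.-2 -> ~~ adj H x c.
  by move=> ck; apply/negP => /(nbrT _ _ xk); rewrite ck.
have outS a b z : a \in S -> b \in S -> z \notin x |: S -> adj H a z -> adj H b z.
  move=> aS bS; rewrite in_setU1 negb_or => /andP[zx zS] az.
  have [xa ak aV] := SP a aS; have [xb bk bV] := SP b bS.
  have za : adj H z a by rewrite symH.
  have [_ zV _] := adjP az; have xz : ~~ adj H x z by move: zS; rewrite inE.
  have [c [ca ck]] := lowS a aS; have cb := lowall a c b aS bS ca ck.
  have bc : adj H b c by rewrite symH.
  have xnz : x != z by rewrite eq_sym.
  have [zk|zk|zk] : [\/ lv z = k, lv z = k.-1 | lv z = k.-2].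
    have h1 := lv_adj az; have h2 := lv_adj za; rewrite ak in h1 h2; rewrite k1E in h1.
    move: h1; rewrite leq_eqVlt => /orP[/eqP ->|]; first by constructor 1.
    rewrite -k1E ltnS leq_eqVlt => /orP[/eqP ->|]; first by constructor 2.
    rewrite -k2E ltnS leq_eqVlt => /orP[/eqP ->|]; first by constructor 3.
    by rewrite ltnNge -ltnS k2E h2.
  (* Level [k]: by the choice of [x], [z] has a neighbor [e] not adjacent to [x]. It is adjacent to
     [c], and the path [x b c e z] is too long compared with [x a z] unless [bz] is an edge. *)
  - apply: contraT => nbz.
    have [e [ez ex]] : exists e, adj H z e /\ ~~ adj H x e.
      case: (boolP [exists e, adj H z e && ~~ adj H x e]) => [/existsP[e /andP[]]|].
        by exists e.
      rewrite negb_exists => /forallP h.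
      have sub : N z \subset S.
        by apply/subsetP => e; rewrite !inE => ze; have := h e; rewrite ze negbK.
      have eqN : N z = S.
        by apply/eqP; rewrite eqEcard sub xmin.
      by move: bS; rewrite -eqN inE symH (negbTE nbz).
    have ze : adj H e z by rewrite symH.
    have ce : adj H c e.
      apply: (lv_low3 ca az ez); first by rewrite ak ck k2E.
        by rewrite ck zk.
      by rewrite ck k2E (nbrT z).
    by rewrite (walk_hereditary5 xb bc ce ze (nxc _ ck) ex xz xnz xa az) in nbz.
  (* Level [k.-1]: here [z] is itself adjacent to [c], and the path [x b c z] plays the same
     role. *)
  - have cd : adj H c z.
      by apply: lv_low2 ca az _ _; rewrite ?ak ?zk ck k2E.
    exact: (walk_hereditary4 xb bc cd (nxc _ ck) xz xnz xa az).
  by rewrite symH; apply: (lowall a z b).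
have [c [cs0 ck]] := lowS s0 s0S; have [xs0 s0k s0V] := SP s0 s0S.
have [cV _ _] := adjP cs0.
have xS : x \notin S by rewrite inE adj_irr.
have cX : c \notin x |: S.
  rewrite in_setU1 negb_or; apply/andP; split; last by rewrite inE nxc.
  by apply/eqP => cx; have := k2lt; rewrite -ck cx xk ltnn.
have uX : u \notin x |: S.
  rewrite in_setU1 negb_or eq_sym ut //=; apply/negP => /SP[_ u0 _].
  by move: k2; rewrite -k1E -u0 lv_u.
have XV : x |: S \subset verts H.
  by rewrite subUset sub1set xV; apply/subsetP => a /SP[].
pose Y' := [set z in verts H :\: (x |: S) | adj H s0 z].
have adjX a z : a \in x |: S -> z \in verts H :\: (x |: S) ->
    adj H a z = (a \in S) && (z \in Y').
  move=> /setU1P[->|aS] zY; have /setDP[zV zX] := zY.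
    rewrite (negbTE xS); apply: contraNF zX => xz.
    by rewrite in_setU1 [z \in S]inE xz orbT.
  rewrite aS inE zY /=; apply/idP/idP; exact: outS.
have cY' : c \in Y' by rewrite inE in_setD cX cV symH.
case: (ltnP 1 #|verts H :\: (x |: S)|) => Y2.
  exists (x |: S), (verts H :\: (x |: S)), S, Y'; split; split=> //.
  - by rewrite -{1}(setIidPr XV) setID.
  - by rewrite disjoints_subset; apply/subsetP => a aX; rewrite in_setC in_setD aX.
  - by rewrite cardsU1 xS ltnS; apply/card_gt0P; exists s0.
  - exact: subsetUr.
  - by apply/subsetP => z; rewrite inE => /andP[].
  - by apply/set0Pn; exists s0.
  by apply/set0Pn; exists c.
(* In the remaining case [c] is [u], so [u] is adjacent to all of [S], as [x] is; [S] has two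
   vertices because [H] has four. *)
have Yu : verts H :\: (x |: S) = [set u].
  apply/eqP; rewrite eq_sym eqEcard cards1 Y2 andbT sub1set in_setD uX; exact: uV.
have cu : c = u by apply/set1P; rewrite -Yu in_setD cX.
have xu : x != u by apply: ut.
have uS : u \notin S by move: uX; rewrite in_setU1 negb_or => /andP[].
have VE : verts H = u |: (x |: S).
  by rewrite -{1}(setID (verts H) (x |: S)) (setIidPr XV) Yu setUC.
exists [set u; x], S, [set u; x], S; split; split=> //.
- by rewrite VE setUA.
- by rewrite disjoints_subset subUset !sub1set !in_setC uS.
- by rewrite cards2 eq_sym xu.
- by move: H4; rewrite VE cardsU1 uX cardsU1 xS.
- by apply/set0Pn; exists u; rewrite !inE eqxx.
- by apply/set0Pn; exists s0.
move=> a z aux zS; rewrite aux zS /=; case/set2P: aux => ->; last by case/SP: zS.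
by rewrite -cu; apply: (lowall s0).
Qed.

End WalkHereditary.
End Distance.

(** * Shape of the bags *)

Section BagShape.
Variable U : finType.
Variables (G : graph U) (D : mgraph U).
Hypotheses (dec : decomposes G D) (wG : walk_hereditary (adj G) (verts G)).
Implicit Types (a b c d x z m : U) (X T : {set U}).

Let wfD : wf D := dec_wf dec.

(* A bag is isomorphic to the subgraph of G induced by one representative for
   each of its vertices. *)
Lemma bag_walk_hereditary z : z \in verts D ->
  walk_hereditary (adj (bag_graph D (bag D z))) (verts (bag_graph D (bag D z))).
Proof.
move=> zV; set B := bag D z; rewrite (_ : verts _ = B); last by apply/setIidPr/bag_verts.
pose u b := odflt b [pick x in reps D b].
have uR b : b \in B -> u b \in reps D b.
  move=> bB; rewrite /u; case: pickP => [x //|none].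
  have [x xR] := reps_neq0 wfD (dec_bag dec) (subsetP (bag_verts zV) _ bB).
  by have := none x; rewrite xR.
have uL b : b \in B -> u b \in leaves D b by move=> bB; apply: (rep_leaf dec); apply: uR.
have uI : {in B &, injective u}.
  by move=> a b aB bB e; apply: (leaves_uniq dec aB bB (uL a aB)); rewrite e uL.
have uA a b : a \in B -> b \in B -> adj G (u a) (u b) = uadj D a b.
  move=> aB bB; case: (eqVneq a b) => [->|ab]; first by rewrite adj_irr uadj_irr.
  by rewrite (adj_leaves dec aB bB ab (uL _ aB) (uL _ bB)) !uR.
move=> X XB cX x p xX lX xp; have XBs := subsetP XB.
pose v y := odflt y [pick b in X | u b == y].
have vu b : b \in X -> v (u b) = b.
  move=> bX; rewrite /v; case: pickP => [c /andP[cX' /eqP e]|/(_ b)]; last by rewrite /= bX eqxx.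
  by apply: uI; rewrite ?XBs.
have [] := wG (X := u @: X) _ _ (x := u x) (p := map u p).
- by apply/subsetP => y /imsetP[b bX ->]; apply: (leaf_verts dec (uL b _)); apply: XBs.
- move=> _ _ /imsetP[a aX ->] /imsetP[b bX ->].
  have /connectP[q aq ->] := cX a b aX bX; apply/connectP; exists (map u q); last by rewrite last_map.
  apply: homo_path aq => c d /and3P[cX' dX]; rewrite adj_bag_graph => /and3P[cB dB cd].
  by rewrite /restrict !imset_f ?uA.
- exact: imset_f.
- by rewrite last_map imset_f.
- by apply: homo_path xp => c d; rewrite adj_bag_graph => /and3P[cB dB cd]; rewrite uA.
move=> q [uq ql qs]; exists (map v q); split.
- rewrite -{1}(vu x xX); apply: homo_path uq => _ _ /and3P[/imsetP[a aX ->] /imsetP[b bX ->]].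
  by rewrite /restrict !vu // aX bX adj_bag_graph !uA ?XBs // => ->; rewrite !XBs.
- by rewrite -{1}(vu x xX) last_map ql last_map vu.
by rewrite size_map -(size_map u p).
Qed.

(** With four vertices or more, a missing edge yields a split by [level_split]. With three, a
    connected graph with a missing edge is a star centered at the third vertex. *)
Lemma not_prime_bag z : z \in verts D -> 2 < #|bag D z| -> prime_graph (bag_graph D (bag D z)) ->
  complete (bag_graph D (bag D z)) \/ exists c, star_at (bag_graph D (bag D z)) c.
Proof.
move=> zV B3 [cH nsplit]; have wH := bag_walk_hereditary zV; set H := bag_graph _ _ in cH nsplit wH *.
have vH : verts H = bag D z by apply/setIidPr/bag_verts.
case: (boolP (complete H)) => [|/forall_inPn[a aV]]; first by left.
case/forall_inPn=> b bV; rewrite negb_imply => /andP[nab ab].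
have nba : b != a by rewrite eq_sym.
case: (ltnP 3 #|verts H|) => H4; first by case: nsplit; apply: (level_split cH wH aV bV nba ab H4).
have [c cV [ca cb]] : exists2 c, c \in verts H & c != a /\ c != b.
  have /card_gt0P[c] : 0 < #|verts H :\ a :\ b|.
    by move: B3; rewrite -vH (cardsD1 a) aV (cardsD1 b) in_setD1 nba bV.
  by case/setD1P=> cb /setD1P[ca cV]; exists c.
have VE : verts H = [set a; b; c].
  apply/eqP; rewrite eq_sym eqEcard !subUset !sub1set aV bV cV /=.
  by rewrite -setUA cardsU1 !inE negb_or nab eq_sym ca cards2 eq_sym cb.
have nbr x : x \in verts H -> exists y, adj H x y.
  move=> xV; have [y yV yx] : exists2 y, y \in verts H & y != x.
    case: (eqVneq a x) => [e|n]; last by exists a.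
    by exists b; rewrite // -e.
  have /connectP[[|d p] /=] := connectedP _ cH x y xV yV; first by move=> _ e; rewrite e eqxx in yx.
  by case/andP=> xd _ _; exists d.
have third x y : adj H x y -> [\/ y = a, y = b | y = c].
  by move=> /adjP[_ + _]; rewrite VE !inE -orbA => /or3P[]/eqP ->; [constructor 1|constructor 2|constructor 3].
have ac : adj H a c.
  have [y ay] := nbr a aV; case: (third _ _ ay) => e; subst y => //.
    by rewrite adj_irr in ay.
  by rewrite ay in ab.
have bc : adj H b c.
  have [y ay] := nbr b bV; case: (third _ _ ay) => e; subst y => //.
    by rewrite adjC ay in ab.
  by rewrite adj_irr in ay.
right; exists c; apply: star_atI => // d e; rewrite VE !inE -!orbA.
case/or3P=> /eqP-> /or3P[]/eqP->; rewrite ?eqxx // => _; rewrite ?(adjC H c) ?ac ?bc ?orbT //.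
  by rewrite (negbTE ab) !(eq_sym _ c) (negbTE ca) (negbTE cb).
by rewrite adjC (negbTE ab) !(eq_sym _ c) (negbTE ca) (negbTE cb).
Qed.

(** A bag without marked vertices is closed under adjacency, hence contains all vertices of [D] and
    thus of [G]. *)
Lemma bag_card3 z : 2 < #|verts G| -> z \in verts D -> 2 < #|bag D z|.
Proof.
move=> G3 zV; case: (boolP [exists b in bag D z, exists m, madj D b m]).
  by case/exists_inP=> b bB /existsP[m bm]; rewrite -(bag_eq bB) (dec_bag dec bm).
rewrite negb_exists_in => /forall_inP nm; apply: leq_trans G3 _; apply/subset_leq_card/subsetP => x.
rewrite -(unm_verts dec) => /unmarked_verts xV.
have /connectP[p zp ->] := dec_connected dec zV xV.
suff main y q : y \in bag D z -> path (adj D) y q -> last y q \in bag D z.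
  by apply: main zp; apply: bag_refl.
elim: q y => //= d q IH y yB /andP[yd dq]; apply: IH dq.
rewrite -(bag_eq yB); apply: uadj_bag; move: yd; rewrite adj_mu => /orP[yd|//].
by have /existsPn/(_ d) := nm y yB; rewrite yd.
Qed.

(** Three positions in the bag of [m] have pairwise disjoint nonempty sets of leaves. *)
Lemma marked_card3 b m : madj D b m -> 2 < #|verts G|.
Proof.
move=> bm; have mb : madj D m b by rewrite madjC.
have [bV mV _] := adjP (madj_adj bm).
have repE c z : z \in verts D -> c \in bag D z -> exists x, x \in leaves D c.
  move=> zV cB; have [x xR] := reps_neq0 wfD (dec_bag dec) (subsetP (bag_verts zV) _ cB).
  by exists x; apply: (rep_leaf dec).
have /card_gt1P[c [d [cB dB cd]]] : 1 < #|bag D m :\ m|.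
  by have := dec_bag dec mb; rewrite (cardsD1 m) bag_refl.
have [cm cB'] := setD1P cB; have [dm dB'] := setD1P dB.
have [x xc] := repE c m mV cB'; have [y yd] := repE d m mV dB'.
have [w wm] := repE m m mV (bag_refl D m).
apply/card_gt2P; exists x, y, w; split; split; try exact: leaf_verts xc;
  try exact: leaf_verts yd; try exact: leaf_verts wm.
- by apply: contraNneq cd => e; rewrite e in xc; rewrite (leaves_uniq dec cB' dB' xc yd).
- by apply: contraNneq dm => e; rewrite e in yd; rewrite (leaves_uniq dec dB' (bag_refl D m) yd wm).
by apply: contraNneq cm => e; rewrite e in wm; rewrite (leaves_uniq dec cB' (bag_refl D m) xc wm).
Qed.

Lemma components_branch z T : z \in verts D ->
  (T \in components (mdel D (bag D z))) <->
  exists b m, [/\ b \in bag D z, madj D b m & T = branch D b :\ b].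
Proof.
move=> zV; split=> [/imsetP[x xV ->]|[b [m [bB bm ->]]]].
  move: xV; rewrite in_setI in_setC => /andP[xV xB].
  have [b bB xb] := bag_branch_cover (dec_connected dec) zV xV.
  have xnb : x != b by apply: contraNneq xB => ->.
  have bV := subsetP (bag_verts zV) _ bB.
  case: (boolP (unmarked_vertex D b)) => [ub|].
    by rewrite (branch_unmarked ub xb) eqxx in xnb.
  rewrite negb_and bV negbK => /existsP[m bm]; exists b, m; split=> //.
  rewrite -(component_branch wfD bm) (bag_eq bB); apply/setP => y; rewrite !inE; congr (_ && _).
  have : x \in component_of (mdel D (bag D z)) m.
    by rewrite -(bag_eq bB) (component_branch wfD bm) in_setD1 xnb.
  rewrite inE => /andP[_ mx]; apply/esym/same_connect => //.
  by apply: sym_connect_sym => u v; rewrite adjC.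
rewrite -(component_branch wfD bm) (bag_eq bB); apply: imset_f.
rewrite in_setI in_setC -(bag_eq bB) (mate_notin_bag wfD bm) andbT.
by case/adjP: (madj_adj bm).
Qed.

End BagShape.

Lemma lrw_small (U : finType) (G : graph U) : #|verts G| <= 2 -> lrw G <= 1.
Proof.
move=> G2; apply/lrw_leP; exists (enum (verts G)).
have E : [set:: enum (verts G)] = verts G by apply/setP => z; rewrite inE mem_enum.
split=> [|i]; first by rewrite /layout enum_uniq E eqxx.
case: (leqP #|verts G| i) => hi; first by rewrite take_oversize -?cardE // E cutrkT.
have i1 : i <= 1 by rewrite -ltnS; apply: leq_trans hi G2.
case: (enum (verts G)) => [|x s].
  by rewrite (_ : [set:: _] = set0) ?cutrk0 //; apply/setP => z; rewrite !inE.
case: i {hi} i1 => [|[|//]] _.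
  by rewrite (_ : [set:: _] = set0) ?cutrk0 //; apply/setP => z; rewrite !inE.
rewrite /= take0 (_ : [set:: _] = x |: set0); last by apply/setP => z; rewrite !inE orbF.
by rewrite cutrk_rkc; apply: leq_trans (rkc_addl _ _ _ _) _; rewrite rkc0l.
Qed.

Theorem theorem4p1 (U : finType) (G : graph U) (D : mgraph U) (k : nat)
    (k_gt0 : 0 < k) (G_conn : connected G) (G_dh : distance_hereditary G)
    (D_can : canonical_decomposition G D) :
  lrw G <= k <->
  forall B : {set U}, B \in bags D ->
    #|[set T in components (mdel D B) | limb_lrw D B T == k]| <= 2 /\
    (forall T' : {set U}, T' \in components (mdel D B) ->
       limb_lrw D B T' <> k -> limb_lrw D B T' <= k - 1).
Proof.
case: D_can => D_split D_type _.
have dec := split_decompositionP G_conn D_split; have wfD := dec_wf dec.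
have widthE z b : b \in bag D z -> limb_lrw D (bag D z) (branch D b :\ b) = limb_width D b.
  by move=> bB; rewrite -(bag_eq bB).
(* With at most two vertices no edge is marked: the right-hand side is vacuous and the left-hand
   side holds since [k] is positive. *)
case: (ltnP 2 #|verts G|) => [G3|G2]; last first.
  have none B T : B \in bags D -> T \in components (mdel D B) -> False.
    case/bagsP=> z zV -> /(components_branch dec _ zV)[b [m [_ bm _]]].
    by have := marked_card3 dec bm; rewrite ltnNge G2.
  split=> [_ B BD|_]; last by apply: leq_trans (lrw_small G2) k_gt0.
  split=> [|T TB]; last by case: (none B T BD TB).
  rewrite (_ : [set T in _ | _] = set0) ?cards0 //; apply/setP => T; rewrite in_set in_set0.
  by apply/negP => /andP[/(none B T BD)].
have bag3 z : z \in verts D -> 2 < #|bag D z| by exact: (bag_card3 dec).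
have bag_type z : z \in verts D ->
    complete (bag_graph D (bag D z)) \/ exists c, star_at (bag_graph D (bag D z)) c.
  move=> zV; have zB : bag D z \in bags D by apply/bagsP; exists z.
  case: (D_type _ zB) => [pr|st|cp]; [|by right|by left].
  by apply: (not_prime_bag dec (distance_hereditary_walk G_dh) zV (bag3 z zV) pr).
split=> [/lrw_leP[s [ls ws]] B /bagsP[z zV ->]|rhs].
  split=> [|T /(components_branch dec _ zV)[b [m [bB bm ->]]]]; last first.
    rewrite widthE // => wk; have := limb_width_le dec bag3 bag_type ls ws bm.
    by rewrite leq_eqVlt => /orP[/eqP //|]; rewrite -{1}(subnK k_gt0) addn1 ltnS.
  rewrite leqNgt; apply/card_gt2P => -[T1 [T2 [T3 [[]]]]]; rewrite !in_set.
  move=> /andP[/(components_branch dec _ zV)[b1 [m1 [bB1 bm1 ->]]]]; rewrite widthE // => /eqP w1.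
  move=> /andP[/(components_branch dec _ zV)[b2 [m2 [bB2 bm2 ->]]]]; rewrite widthE // => /eqP w2.
  move=> /andP[/(components_branch dec _ zV)[b3 [m3 [bB3 bm3 ->]]]]; rewrite widthE // => /eqP w3.
  case=> n12 n23 n31.
  have d12 : b1 != b2 by apply: contraNneq n12 => ->.
  have d23 : b2 != b3 by apply: contraNneq n23 => ->.
  have d31 : b3 != b1 by apply: contraNneq n31 => ->.
  exact: (limb_width_three G_conn dec bag3 bag_type ls ws k_gt0
    (And3 bB1 bB2 bB3) (And3 d12 d23 d31) (And3 bm1 bm2 bm3) (And3 w1 w2 w3)).
have inB z b m : z \in verts D -> b \in bag D z -> madj D b m ->
    branch D b :\ b \in components (mdel D (bag D z)).
  by move=> zV bB bm; apply/(components_branch dec _ zV); exists b, m.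
have width_le b m : madj D b m -> limb_width D b <= k.
  move=> bm; have [bV _ _] := adjP (madj_adj bm).
  have [] := rhs (bag D b); first by apply/bagsP; exists b.
  move=> _ /(_ _ (inB b b m bV (bag_refl D b) bm)); rewrite widthE ?bag_refl // => h.
  case: (eqVneq (limb_width D b) k) => [-> //|/eqP /h].
  by move/leq_trans; apply; apply: leq_subr.
have [] := ordered_verts dec bag3 bag_type k_gt0 width_le; last first.
  move=> s [us ss ws]; apply/lrw_leP; exists s; split=> //.
  by rewrite /layout us ss eqxx.
move=> z b1 b2 b3 m1 m2 m3 [B1 B2 B3] [n12 n23 n31] [M1 M2 M3] [W1 W2 W3].
have zV : z \in verts D.
  have /adjP[b1V _ _] := madj_adj M1; move: B1; rewrite inE connect_uadjC => b1z.
  by apply: (connect_verts _ b1z b1V) => a c /uadj_adj/adjP[-> ->].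
have [] := rhs (bag D z); first by apply/bagsP; exists z.
rewrite leqNgt => /card_gt2P no3 _; apply: no3.
exists (branch D b1 :\ b1), (branch D b2 :\ b2), (branch D b3 :\ b3).
have dist b b' m : b \in bag D z -> b' \in bag D z -> madj D b m -> b != b' ->
    branch D b :\ b != branch D b' :\ b'.
  move=> bB b'B bm; apply: contraNneq => e.
  have := mate_branch bm; rewrite e => /setD1P[_ mb']; have /setD1P[_ mb] := mate_branch bm.
  by rewrite (branch_uniq wfD _ mb mb') // (bag_eq bB).
have inK b m : b \in bag D z -> madj D b m -> limb_width D b = k ->
    branch D b :\ b \in [set T in components (mdel D (bag D z)) | limb_lrw D (bag D z) T == k].
  by move=> bB bm wk; rewrite in_set (inB z b m zV bB bm) (widthE z b bB) wk eqxx.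
split; split.
- exact: inK B1 M1 W1.
- exact: inK B2 M2 W2.
- exact: inK B3 M3 W3.
- exact: dist B1 B2 M1 n12.
- exact: dist B2 B3 M2 n23.
exact: dist B3 B1 M3 n31.
Qed.
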